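(* Let $a>0$, $\alpha>0$, $\beta>0$, $c_o\in\mathbf{R}$ and $b=0$. Let $X:\Sigma\to\mathbf{R}^3$ be an axially symmetric immersion, with axis of rotation the $z$-axis, which is critical for the Euler-Helfrich energy $E=E_{a,c_o,0,\alpha,\beta}$. Then either the surface is a part of a Delaunay surface with $H\equiv -c_o$, in which case the radii of the boundary circles are $\sqrt{\alpha/\beta}$, or, after a suitable vertical translation (replacing $X$ by $X+tE_3$ for a suitable $t\in\mathbf{R}$, $E_3=(0,0,1)$), the mean curvature of the immersion satisfies $$H+c_o=-\frac{\nu_3}{z}$$ on $\Sigma$ and the boundary $\partial\Sigma$ is composed of geodesic circles.
   Context: $\Sigma$ is a compact, connected, oriented surface with smooth boundary and $X:\Sigma\to\mathbf{R}^3$ is an immersion of class $\mathcal{C}^4$ up to the boundary, with unit normal $\nu$ (oriented so that $\nu$ points out of convex domains). $H$ is the mean curvature with sign convention $2H=-\mathrm{tr}(d\nu)$, equivalently $\Delta X=2H\nu$ (the round sphere of radius $R$ with outward normal has $H=-1/R$), and $K$ is the Gaussian curvature. $z=X\cdot E_3$, $\nu_3=\nu\cdot E_3$. Along $\partial\Sigma$ (positively oriented, arc length $s$, $(\,)'=d/ds$): $T$ is the unit tangent, $n=T\times\nu$ the outward conormal, $\kappa=\|T'\|$ the curvature, and $\kappa_g,\kappa_n,\tau_g$ (geodesic curvature, normal curvature, geodesic torsion) are defined by $T'=\kappa_g n+\kappa_n\nu$, $n'=-\kappa_g T+\tau_g\nu$, $\nu'=-\tau_g n-\kappa_n T$. A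 boundary circle is geodesic if $\kappa_g\equiv0$ along it. The Euler-Helfrich energy is $$E_{a,c_o,b,\alpha,\beta}=\int_\Sigma\left(a[H+c_o]^2+bK\right)d\Sigma+\oint_{\partial\Sigma}\left(\alpha\kappa^2+\beta\right)ds.$$ $X$ is critical for $E$ if the first variation of $E$ vanishes for all $\mathcal{C}^4$ variation fields (no boundary restriction). With $J:=2\alpha T''+(3\alpha\kappa^2-\beta)T$, this is equivalent to: $\Delta H+2(H+c_o)(H[H-c_o]-K)=0$ on $\Sigma$, and on $\partial\Sigma$: $a(H+c_o)+b\kappa_n=0$, $J'\cdot\nu-a\partial_nH+b\tau_g'=0$, $J'\cdot n+a(H+c_o)^2+bK=0$. Axially symmetric means that the surface is a surface of revolution, obtained by rotating a planar profile curve about an axis; $\Sigma$ is then a topological disc or annulus. A Delaunay surface is a surface of revolution with constant mean curvature (planes and spheres included). The equation $H+c_o=-\nu_3/z$ is understood at points where $z=0$ by continuity, i.e. as $(H+c_o)z=-\nu_3$ on $\Sigma$. *)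

(* Defs.v *)
From Stdlib Require Export Reals Lra List.
From Coquelicot Require Export Coquelicot.
Export ListNotations.
Open Scope R_scope.

Definition R3 : Type := (R * R * R)%type.
Definition c1 (p : R3) : R := fst (fst p).
Definition c2 (p : R3) : R := snd (fst p).
Definition c3 (p : R3) : R := snd p.
Definition E3 : R3 := (0, 0, 1).

Definition add3 (p q : R3) : R3 := (c1 p + c1 q, c2 p + c2 q, c3 p + c3 q).
Definition scal3 (k : R) (p : R3) : R3 := (k * c1 p, k * c2 p, k * c3 p).
Definition dot3 (p q : R3) : R := c1 p * c1 q + c2 p * c2 q + c3 p * c3 q.
Definition cross3 (p q : R3) : R3 :=
  (c2 p * c3 q - c3 p * c2 q,
   c3 p * c1 q - c1 p * c3 q,
   c1 p * c2 q - c2 p * c1 q).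
Definition norm3 (p : R3) : R := sqrt (dot3 p p).
Definition normalize3 (p : R3) : R3 := scal3 (/ norm3 p) p.

Definition Derive3 (c : R -> R3) (t : R) : R3 :=
  (Derive (fun s => c1 (c s)) t,
   Derive (fun s => c2 (c s)) t,
   Derive (fun s => c3 (c s)) t).

(** A disc or annulus is modelled, with global coordinates (u,v), as
    [{ rho <= |(u,v)| <= 1 }] with [0 <= rho < 1]: the closed disc for
    [rho = 0], a closed annulus for [0 < rho]. *)
Definition Sigma (rho u v : R) : Prop := rho <= sqrt (u ^ 2 + v ^ 2) <= 1.

(** The boundary circles, as pairs (radius, sense): sense 1 is
    counterclockwise and -1 clockwise, which orients them as the boundary of
    [Sigma rho] when the latter carries the orientation (u,v). *)
Definition boundary_circles (rho : R) : list (R * R) :=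
  if Rlt_dec 0 rho then [(1, 1); (rho, -1)] else [(1, 1)].

(** The orientation of the surface is a sign: 1 for that of (u,v), -1 for the
    opposite one. *)
Definition orientation (sigma : R) : Prop := sigma = 1 \/ sigma = -1.

(** Class C^4 up to the boundary: C^4 in a neighbourhood of each point of
    [Sigma rho], boundary points included.  [X] is a total function, but its
    values away from [Sigma rho] are irrelevant. *)
Definition C4 (rho : R) (X : R -> R -> R3) : Prop :=
  forall u v, Sigma rho u v ->
    locally_2d (fun x y =>
      ex_diff_n (fun p q => c1 (X p q)) 4 x y /\
      ex_diff_n (fun p q => c2 (X p q)) 4 x y /\
      ex_diff_n (fun p q => c3 (X p q)) 4 x y) u v.

Definition Du (X : R -> R -> R3) (u v : R) : R3 := Derive3 (fun s => X s v) u.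
Definition Dv (X : R -> R -> R3) (u v : R) : R3 := Derive3 (fun s => X u s) v.

Definition area_density X (u v : R) : R := norm3 (cross3 (Du X u v) (Dv X u v)).

Definition nu (sigma : R) X (u v : R) : R3 :=
  scal3 sigma (normalize3 (cross3 (Du X u v) (Dv X u v))).

Definition metE X (u v : R) : R := dot3 (Du X u v) (Du X u v).
Definition metF X (u v : R) : R := dot3 (Du X u v) (Dv X u v).
Definition metG X (u v : R) : R := dot3 (Dv X u v) (Dv X u v).

(** The bilinear form [(xi, eta) |-> dnu(xi) . dX(eta)] in the basis (u,v). *)
Definition dnu_uu (sigma : R) X (u v : R) := dot3 (Du (nu sigma X) u v) (Du X u v).
Definition dnu_uv (sigma : R) X (u v : R) := dot3 (Du (nu sigma X) u v) (Dv X u v).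
Definition dnu_vu (sigma : R) X (u v : R) := dot3 (Dv (nu sigma X) u v) (Du X u v).
Definition dnu_vv (sigma : R) X (u v : R) := dot3 (Dv (nu sigma X) u v) (Dv X u v).

(** Trace and determinant of the endomorphism [dnu] of the tangent plane: the
    matrix of the form above multiplied by the inverse of the metric. *)
Definition tr_dnu (sigma : R) X (u v : R) : R :=
  (dnu_uu sigma X u v * metG X u v
   - (dnu_uv sigma X u v + dnu_vu sigma X u v) * metF X u v
   + dnu_vv sigma X u v * metE X u v)
  / (metE X u v * metG X u v - metF X u v ^ 2).

Definition det_dnu (sigma : R) X (u v : R) : R :=
  (dnu_uu sigma X u v * dnu_vv sigma X u v
   - dnu_uv sigma X u v * dnu_vu sigma X u v)
  / (metE X u v * metG X u v - metF X u v ^ 2).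

(** Sign convention [2H = - tr(dnu)]: a round sphere of radius [R] with outward
    normal has [H = -1/R]. *)
Definition mean_curv (sigma : R) X (u v : R) : R := - tr_dnu sigma X u v / 2.
Definition gauss_curv (sigma : R) X (u v : R) : R := det_dnu sigma X u v.

Definition speed (c : R -> R3) (t : R) : R := norm3 (Derive3 c t).
(** Derivative of the field [w] along [c] with respect to the arc length of [c]. *)
Definition Ds (c w : R -> R3) (t : R) : R3 := scal3 (/ speed c t) (Derive3 w t).
Definition tangent (c : R -> R3) (t : R) : R3 := Ds c c t.
Definition curvature (c : R -> R3) (t : R) : R := norm3 (Ds c (tangent c) t).

(** The circle of radius [r] of the parameter domain, run through by the angle
    [omega * t], [omega] being 1 or -1. *)
Definition on_circle {A : Type} (r omega : R) (f : R -> R -> A) (t : R) : A :=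
  f (r * cos (omega * t)) (r * sin (omega * t)).

(** Geodesic curvature [T' . n] with [n = T x nu]; [(r, omega)] is an element of
    [boundary_circles], and the factor [sigma] makes [T] positively oriented. *)
Definition geod_curv (sigma : R) X (r omega t : R) : R :=
  let c := on_circle r (sigma * omega) X in
  let n := cross3 (tangent c t) (on_circle r (sigma * omega) (nu sigma X) t) in
  dot3 (Ds c (tangent c) t) n.

(** The surface integral is computed in polar coordinates [(r, t)] of the
    parameter domain, where [du dv = r dr dt]. *)
Definition surface_integral (rho : R) X (f : R -> R -> R) : R :=
  RInt (fun r =>
    RInt (fun t => on_circle r 1 (fun u v => f u v * area_density X u v) t * r)
      0 (2 * PI)) rho 1.

Definition boundary_integral (rho sigma : R) X (f : (R -> R3) -> R -> R) : R :=
  fold_right Rplus 0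
    (map (fun circ : R * R =>
       let c := on_circle (fst circ) (sigma * snd circ) X in
       RInt (fun t => f c t * speed c t) 0 (2 * PI))
     (boundary_circles rho)).

Definition energy (rho sigma a co b alpha beta : R) (X : R -> R -> R3) : R :=
  surface_integral rho X
    (fun u v => a * (mean_curv sigma X u v + co) ^ 2 + b * gauss_curv sigma X u v)
  + boundary_integral rho sigma X
    (fun c t => alpha * curvature c t ^ 2 + beta).

Definition immersion (rho : R) (X : R -> R -> R3) : Prop :=
  C4 rho X /\
  forall u v, Sigma rho u v -> cross3 (Du X u v) (Dv X u v) <> (0, 0, 0).

Definition critical (rho sigma a co b alpha beta : R) (X : R -> R -> R3) : Prop :=
  forall V : R -> R -> R3, C4 rho V ->
    is_derive
      (fun eps : R =>
         energy rho sigma a co b alpha beta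
           (fun u v => add3 (X u v) (scal3 eps (V u v))))
      0 0.

(** Rotation of the planar profile curve [t |-> (r t, z t)] about the z-axis. *)
Definition axially_symmetric (rho : R) (X : R -> R -> R3) : Prop :=
  exists r z : R -> R, forall t theta, rho <= t <= 1 ->
    X (t * cos theta) (t * sin theta) = (r t * cos theta, r t * sin theta, z t).

Definition part_of_Delaunay (rho sigma h : R) (X : R -> R -> R3) : Prop :=
  axially_symmetric rho X /\
  forall u v, Sigma rho u v -> mean_curv sigma X u v = h.

Definition axis_dist (p : R3) : R := sqrt (c1 p ^ 2 + c2 p ^ 2).

Definition vtranslate (tau : R) (X : R -> R -> R3) : R -> R -> R3 :=
  fun u v => add3 (X u v) (scal3 tau E3).

(** [H + co = - nu_3 / z], in the form that also makes sense where [z = 0]. *)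
Definition reduced_membrane (rho sigma co : R) (X : R -> R -> R3) : Prop :=
  forall u v, Sigma rho u v ->
    (mean_curv sigma X u v + co) * dot3 (X u v) E3 = - dot3 (nu sigma X u v) E3.

Definition boundary_radii (rho : R) (X : R -> R -> R3) (R0 : R) : Prop :=
  forall r omega, In (r, omega) (boundary_circles rho) ->
    forall t, axis_dist (on_circle r omega X t) = R0.

Definition geodesic_boundary (rho sigma : R) (X : R -> R -> R3) : Prop :=
  forall r omega, In (r, omega) (boundary_circles rho) ->
    forall t, geod_curv sigma X r omega t = 0.

(* Main.v *)
Require Import Defs.
From Stdlib Require Import ssreflect Lia FunctionalExtensionality Ranalysis5.

(** The surface is obtained by rotating a profile [t |-> (r t, z t)].  Let [q] be
    the speed of the profile, [(C, S)] its unit tangent ([tan_r] and [tan_z]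
    below), [f = H + co] and [s] the sign for which [nu_3 = s C].

    Criticality is only used against axially symmetric fields.  For these the
    energy is an integral over the profile plus a function of the radii of the
    boundary circles ([rev_energy]), and it is differentiated directly
    ([first_variation]).  Integration by parts ([flux_derive]) produces a momentum
    [(A, B)] with normal component [p = s r f' / q] and tangential component
    [f (s S + (co - H) r)]: the Euler-Lagrange equations read [A' = G], [B' = 0]
    ([Euler_Lagrange]), and the flux through a circle is
    [s f r eta + A phi + B psi], where [(phi, psi)] is the displacement of the
    profile and [eta] the variation of the angle of its tangent.  These three are
    independent at a boundary circle, hence [f = 0], [B = 0] and [a A] equals
    [alpha / r ^ 2 - beta] up to the sign of the conormal
    ([boundary_conditions]).  As [f = 0] leaves [A = p S] and [B = - p C], this
    says that [p C = 0], and that [p = 0] forces [r ^ 2 = alpha / beta].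

    Projected on the normal, the Euler-Lagrange equations become a linear system
    of order one in [(f, p)], the radial form of
    [Laplacian f + 2 f (H (H - co) - K) = 0] ([prof_f_derive],
    [mom_nor_derive]).  The decisive fact is that [nu_3 + f (z + tau)] solves the
    same equation for every constant [tau] ([height_f_derive],
    [height_p_derive]).  Uniqueness ([linear_system_unique]) then decides
    everything from the values on the outer circle, where [f = 0].

    - If [p = 0] there, then [f] and [p] vanish identically: [H = - co], and the
      boundary conditions give all radii.
    - If [p <> 0] there, then [C = 0], so the outer circle is geodesic and
      [nu_3 + f (z + tau)] vanishes on it.  The constant [tau] can be chosen so
      that the derivative vanishes too, and [nu_3 + f (z + tau)] is zero
      everywhere, which is the reduced equation after translation by [tau].  On an
      inner circle [p] cannot be zero, since uniqueness from that circle would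
      give [p = 0] on the outer one; hence [C = 0] there as well.

    On a disc the system is singular at the pole; it is solved away from it, and
    the conclusions reach the pole because the mean curvature is continuous there
    ([mean_curv_profile]). *)

(** * Functions of class C^n of one and two variables *)

Lemma is_derive_cont (g : R -> R) t l : is_derive g t l -> continuous g t.
Proof. intros H. apply (ex_derive_continuous (V := R_NormedModule)). now exists l. Qed.

(** The partial derivatives are quantified existentially instead of being
    [Derive] terms: a closure property is then proved by induction on [n],
    exhibiting the derivative by its usual formula. *)
Fixpoint Ck2 (n : nat) (f : R -> R -> R) (x y : R) : Prop :=
  locally_2d (continuity_2d_pt f) x y /\
  match n with
  | O => True
  | S m => exists fx fy : R -> R -> R,
      locally_2d (fun u v => is_derive (fun z => f z v) u (fx u v) /\
                             is_derive (fun z => f u z) v (fy u v)) x y /\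
      Ck2 m fx x y /\ Ck2 m fy x y
  end.

Fixpoint Ck1 (n : nat) (g : R -> R) (x : R) : Prop :=
  locally x (fun t => continuous g t) /\
  match n with
  | O => True
  | S m => exists g', locally x (fun t => is_derive g t (g' t)) /\ Ck1 m g' x
  end.

Lemma locally_2d_locally_2d P x y :
  locally_2d P x y -> locally_2d (fun u v => locally_2d P u v) x y.
Proof.
  intros H. apply locally_2d_impl_strong with (2 := H).
  apply locally_2d_forall. auto.
Qed.

Lemma locally_2d_imp (P Q : R -> R -> Prop) x y :
  (forall u v, P u v -> Q u v) -> locally_2d P x y -> locally_2d Q x y.
Proof. intros H. apply locally_2d_impl. apply locally_2d_forall. auto. Qed.

Lemma Ck2_cont n f x y : Ck2 n f x y -> locally_2d (continuity_2d_pt f) x y.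
Proof. destruct n; intros H; apply H. Qed.

Lemma Ck2_cont_pt n f x y : Ck2 n f x y -> continuity_2d_pt f x y.
Proof. intros H. apply locally_2d_singleton with (1 := Ck2_cont _ _ _ _ H). Qed.

Lemma Ck2_pred n : forall f x y, Ck2 (S n) f x y -> Ck2 n f x y.
Proof.
  induction n as [|n IH]; intros f x y [H0 (fx & fy & Hd & Hx & Hy)].
  - split; auto.
  - split; auto. exists fx, fy. auto.
Qed.

Lemma Ck2_le m n f x y : (m <= n)%nat -> Ck2 n f x y -> Ck2 m f x y.
Proof. induction 1; auto using Ck2_pred. Qed.

Lemma Ck2_ext_loc n f g x y :
  locally_2d (fun u v => f u v = g u v) x y -> Ck2 n f x y -> Ck2 n g x y.
Proof.
  intros He Hf.
  assert (Hc : locally_2d (continuity_2d_pt g) x y).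
  { apply locally_2d_impl with (2 := Ck2_cont _ _ _ _ Hf).
    apply locally_2d_imp with (2 := locally_2d_locally_2d _ _ _ He).
    intros u v H. apply continuity_2d_pt_ext_loc. exact H. }
  destruct n as [|n]; [split; auto|].
  destruct Hf as [_ (fx & fy & Hd & Hx & Hy)].
  split; auto. exists fx, fy. repeat split; auto.
  apply locally_2d_impl with (2 := Hd).
  apply locally_2d_imp with (2 := locally_2d_locally_2d _ _ _ He).
  intros u v H [H1 H2]. split.
  - apply is_derive_ext_loc with (2 := H1).
    apply (locally_2d_1d_const_y _ _ _ H).
  - apply is_derive_ext_loc with (2 := H2).
    apply (locally_2d_1d_const_x _ _ _ H).
Qed.

Lemma Ck2_locally n : forall f x y, Ck2 n f x y -> locally_2d (Ck2 n f) x y.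
Proof.
  induction n as [|n IH]; intros f x y H.
  - destruct H as [H _]. apply locally_2d_imp with (2 := locally_2d_locally_2d _ _ _ H).
    intros; split; auto.
  - destruct H as [Hc (fx & fy & Hd & Hx & Hy)].
    generalize (locally_2d_and _ _ _ _ (locally_2d_locally_2d _ _ _ Hc)
      (locally_2d_and _ _ _ _ (locally_2d_locally_2d _ _ _ Hd)
        (locally_2d_and _ _ _ _ (IH _ _ _ Hx) (IH _ _ _ Hy)))).
    apply locally_2d_imp. intros u v (A & B & C & D). split; auto.
    exists fx, fy. auto.
Qed.

Lemma Ck2_const n : forall c x y, Ck2 n (fun _ _ => c) x y.
Proof.
  induction n as [|n IH]; intros c x y; (split;
    [apply locally_2d_forall; intros; apply continuity_2d_pt_const|]); auto.
  exists (fun _ _ => 0), (fun _ _ => 0). repeat split; auto.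
  apply locally_2d_forall. split; apply @is_derive_const.
Qed.

Lemma Ck2_id1 n x y : Ck2 n (fun u _ => u) x y.
Proof.
  destruct n as [|n]; (split;
    [apply locally_2d_forall; intros; apply continuity_2d_pt_id1|]); auto.
  exists (fun _ _ => 1), (fun _ _ => 0). repeat split; auto using Ck2_const.
  apply locally_2d_forall. split; [apply @is_derive_id|apply @is_derive_const].
Qed.

Lemma Ck2_id2 n x y : Ck2 n (fun _ v => v) x y.
Proof.
  destruct n as [|n]; (split;
    [apply locally_2d_forall; intros; apply continuity_2d_pt_id2|]); auto.
  exists (fun _ _ => 0), (fun _ _ => 1). repeat split; auto using Ck2_const.
  apply locally_2d_forall. split; [apply @is_derive_const|apply @is_derive_id].
Qed.

Lemma Ck2_plus n : forall f g x y,
  Ck2 n f x y -> Ck2 n g x y -> Ck2 n (fun u v => f u v + g u v) x y.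
Proof.
  induction n as [|n IH]; intros f g x y Hf Hg.
  - split; auto. apply locally_2d_impl with (2 := Ck2_cont _ _ _ _ Hf).
    apply locally_2d_imp with (2 := Ck2_cont _ _ _ _ Hg).
    intros; now apply continuity_2d_pt_plus.
  - split.
    + apply locally_2d_impl with (2 := Ck2_cont _ _ _ _ Hf).
      apply locally_2d_imp with (2 := Ck2_cont _ _ _ _ Hg).
      intros; now apply continuity_2d_pt_plus.
    + destruct Hf as [_ (fx & fy & Hd & Hx & Hy)].
      destruct Hg as [_ (gx & gy & Hd' & Hx' & Hy')].
      exists (fun u v => fx u v + gx u v), (fun u v => fy u v + gy u v).
      repeat split; auto.
      apply locally_2d_impl with (2 := Hd).
      apply locally_2d_imp with (2 := Hd').
      intros u v [A B] [C D]; split; apply: is_derive_plus; auto.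
Qed.

Lemma Ck2_mult n : forall f g x y,
  Ck2 n f x y -> Ck2 n g x y -> Ck2 n (fun u v => f u v * g u v) x y.
Proof.
  assert (Hc : forall n f g x y, Ck2 n f x y -> Ck2 n g x y ->
    locally_2d (continuity_2d_pt (fun u v => f u v * g u v)) x y).
  { intros m f g x y Hf Hg. apply locally_2d_impl with (2 := Ck2_cont _ _ _ _ Hf).
    apply locally_2d_imp with (2 := Ck2_cont _ _ _ _ Hg).
    intros; now apply continuity_2d_pt_mult. }
  induction n as [|n IH]; intros f g x y Hf Hg; (split; [now apply (Hc _ _ _ _ _ Hf Hg)|]); auto.
  generalize (Ck2_pred _ _ _ _ Hf) (Ck2_pred _ _ _ _ Hg); intros Pf Pg.
  destruct Hf as [_ (fx & fy & Hd & Hx & Hy)].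
  destruct Hg as [_ (gx & gy & Hd' & Hx' & Hy')].
  exists (fun u v => fx u v * g u v + f u v * gx u v),
         (fun u v => fy u v * g u v + f u v * gy u v).
  repeat split; auto using Ck2_plus.
  apply locally_2d_impl with (2 := Hd).
  apply locally_2d_imp with (2 := Hd').
  intros u v [A B] [C D].
  assert (E : forall a b da db t, is_derive a t da -> is_derive b t db ->
     is_derive (fun z => a z * b z) t (da * b t + a t * db)).
  { intros a b da db t P Q. auto_derive.
    - split; [eexists; exact P|split; [eexists; exact Q|auto]].
    - rewrite (is_derive_unique _ _ _ P) (is_derive_unique _ _ _ Q). ring. }
  split; [apply (E (fun z => f z v) (fun z => g z v)) | apply (E (fun z => f u z) (fun z => g u z))]; auto.
Qed.

Lemma Ck1_cont n g x : Ck1 n g x -> locally x (fun t => continuous g t).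
Proof. destruct n; intros H; apply H. Qed.

Lemma Ck1_pred n : forall g x, Ck1 (S n) g x -> Ck1 n g x.
Proof.
  induction n as [|n IH]; intros g x [H0 (g' & Hd & Hx)]; split; auto.
  exists g'. auto.
Qed.

Lemma Ck1_le m n g x : (m <= n)%nat -> Ck1 n g x -> Ck1 m g x.
Proof. induction 1; auto using Ck1_pred. Qed.

Lemma locally_2d_comp (P : R -> Prop) f x y :
  continuity_2d_pt f x y -> locally (f x y) P -> locally_2d (fun u v => P (f u v)) x y.
Proof.
  intros Hf [d Hd]. destruct (Hf d) as [e He]. exists e. intros u v Hu Hv.
  apply Hd. apply (He u v Hu Hv).
Qed.

Lemma Ck2_comp n : forall g f x y,
  Ck1 n g (f x y) -> Ck2 n f x y -> Ck2 n (fun u v => g (f u v)) x y.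
Proof.
  assert (Hc : forall n g f x y, Ck1 n g (f x y) -> Ck2 n f x y ->
    locally_2d (continuity_2d_pt (fun u v => g (f u v))) x y).
  { intros m g f x y Hg Hf.
    apply locally_2d_impl with (2 := Ck2_cont _ _ _ _ Hf).
    generalize (locally_2d_comp _ _ _ _ (Ck2_cont_pt _ _ _ _ Hf) (Ck1_cont _ _ _ Hg)).
    apply locally_2d_imp. intros u v A B.
    apply continuity_1d_2d_pt_comp; auto. now apply continuity_pt_filterlim. }
  induction n as [|n IH]; intros g f x y Hg Hf; (split; [now apply (Hc _ _ _ _ _ Hg Hf)|]); auto.
  generalize (Ck2_pred _ _ _ _ Hf); intros Pf.
  generalize (Ck2_cont_pt _ _ _ _ Hf); intros Cf.
  destruct Hf as [_ (fx & fy & Hd & Hx & Hy)].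
  destruct Hg as [_ (g' & Hd' & Hg')].
  exists (fun u v => fx u v * g' (f u v)), (fun u v => fy u v * g' (f u v)).
  repeat split; try (apply Ck2_mult; auto).
  apply locally_2d_impl with (2 := Hd).
  generalize (locally_2d_comp _ _ _ _ Cf Hd').
  apply locally_2d_imp. intros u v A [B C]. split.
  - apply (is_derive_comp g (fun z => f z v)); auto.
  - apply (is_derive_comp g (fun z => f u z)); auto.
Qed.

Lemma Ck1_opp n x : Ck1 n Ropp x.
Proof.
  assert (D : forall t, is_derive Ropp t (-1)).
  { intros t. auto_derive; auto. }
  assert (K : forall m (c : R) x, Ck1 m (fun _ => c) x).
  { induction m; intros c y; (split; [apply filter_forall; intros; apply continuous_const|]); auto.
    exists (fun _ => 0). split; auto. apply filter_forall. intros; apply @is_derive_const. }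
  destruct n; (split; [apply filter_forall; intros; eapply is_derive_cont; apply D|]); auto.
  exists (fun _ => -1). split; auto. apply filter_forall. auto.
Qed.

Lemma Ck2_opp n f x y : Ck2 n f x y -> Ck2 n (fun u v => - f u v) x y.
Proof. apply Ck2_comp. apply Ck1_opp. Qed.

Lemma Ck2_minus n f g x y :
  Ck2 n f x y -> Ck2 n g x y -> Ck2 n (fun u v => f u v - g u v) x y.
Proof. intros. apply Ck2_plus; auto using Ck2_opp. Qed.

Lemma locally_neq0 x : x <> 0 -> locally x (fun t => t <> 0).
Proof.
  intros H. exists (mkposreal _ (Rabs_pos_lt _ H)). intros y Hy E. subst y.
  unfold ball in Hy; simpl in Hy; unfold AbsRing_ball, abs, minus, plus, opp in Hy; simpl in Hy.
  rewrite Rplus_0_l Rabs_Ropp in Hy. lra.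
Qed.

Lemma locally_gt0 x : 0 < x -> locally x (fun t => 0 < t).
Proof. intros H. apply (open_gt 0 x H). Qed.

(** The family [c / t ^ k] is stable under differentiation, which is what the
    induction on [n] needs; likewise [c * sqrt t / t ^ k] below. *)
Lemma Ck1_inv_pow n : forall c k x, x <> 0 -> Ck1 n (fun t => c * (/ t) ^ k) x.
Proof.
  assert (D : forall c k t, t <> 0 ->
    is_derive (fun t => c * (/ t) ^ k) t ((- c * INR k) * (/ t) ^ (S k))).
  { intros c k t H. auto_derive; auto. destruct k; simpl; [ring|].
    field; auto. }
  induction n as [|n IH]; intros c k x H; (split;
    [apply: filter_imp (locally_neq0 x H); intros t Ht; eapply is_derive_cont; apply D; auto|]); auto.
  exists (fun t => (- c * INR k) * (/ t) ^ (S k)). split; auto.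
  apply: filter_imp (locally_neq0 x H). auto.
Qed.

Lemma Ck1_sqrt_pow n : forall c k x, 0 < x -> Ck1 n (fun t => c * (sqrt t * (/ t) ^ k)) x.
Proof.
  assert (D : forall c k t, 0 < t ->
    is_derive (fun t => c * (sqrt t * (/ t) ^ k)) t ((c * (1 / 2 - INR k)) * (sqrt t * (/ t) ^ (S k)))).
  { intros c k t H. assert (t <> 0) by lra. auto_derive; auto.
    generalize (sqrt_lt_R0 _ H) (sqrt_sqrt t (Rlt_le _ _ H)). intros Hs Hss.
    set (q := sqrt t) in *. rewrite -Hss. destruct k; simpl; field; lra. }
  induction n as [|n IH]; intros c k x H; (split;
    [apply: filter_imp (locally_gt0 x H); intros t Ht; eapply is_derive_cont; apply D; auto|]); auto.
  exists (fun t => (c * (1 / 2 - INR k)) * (sqrt t * (/ t) ^ (S k))). split; auto.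
  apply: filter_imp (locally_gt0 x H). auto.
Qed.

Lemma Ck2_inv n f x y : f x y <> 0 -> Ck2 n f x y -> Ck2 n (fun u v => / f u v) x y.
Proof.
  intros H Hf.
  apply Ck2_ext_loc with (f := fun u v => 1 * (/ f u v) ^ 1).
  { apply locally_2d_forall. intros. ring. }
  apply (Ck2_comp n (fun t => 1 * (/ t) ^ 1)); auto. apply Ck1_inv_pow; auto.
Qed.

Lemma Ck2_div n f g x y : g x y <> 0 ->
  Ck2 n f x y -> Ck2 n g x y -> Ck2 n (fun u v => f u v / g u v) x y.
Proof. intros. apply Ck2_mult; auto using Ck2_inv. Qed.

Lemma Ck2_sqrt n f x y : 0 < f x y -> Ck2 n f x y -> Ck2 n (fun u v => sqrt (f u v)) x y.
Proof.
  intros H Hf.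
  apply Ck2_ext_loc with (f := fun u v => 1 * (sqrt (f u v) * (/ f u v) ^ 0)).
  { apply locally_2d_forall. intros. simpl; ring. }
  apply (Ck2_comp n (fun t => 1 * (sqrt t * (/ t) ^ 0))); auto. apply Ck1_sqrt_pow; auto.
Qed.

Lemma Ck2_pow n f x y k : Ck2 n f x y -> Ck2 n (fun u v => f u v ^ k) x y.
Proof.
  intros H. induction k; simpl; auto using Ck2_const, Ck2_mult.
Qed.

Lemma Ck2_slice n : forall f x y, Ck2 n f x y -> Ck1 n (fun u => f u y) x.
Proof.
  assert (Hc : forall n f x y, Ck2 n f x y -> locally x (fun t => continuous (fun u => f u y) t)).
  { intros m f x y Hf. generalize (locally_2d_1d_const_y _ _ _ (Ck2_cont _ _ _ _ Hf)).
    apply filter_imp. intros t H P [e He]. destruct (H e) as [d Hd].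
    exists d. intros z Hz. apply He. apply Hd; auto.
    rewrite Rminus_eq_0 Rabs_R0. apply cond_pos. }
  induction n as [|n IH]; intros f x y Hf; (split; [apply (Hc _ _ _ _ Hf)|]); auto.
  destruct Hf as [_ (fx & fy & Hd & Hx & Hy)].
  exists (fun u => fx u y). split; auto.
  generalize (locally_2d_1d_const_y _ _ _ Hd). apply filter_imp. intros t [A _]; auto.
Qed.

Lemma Ck1_lift1 n g x y : Ck1 n g x -> Ck2 n (fun u _ => g u) x y.
Proof. intros H. apply (Ck2_comp n g (fun u _ => u)); auto using Ck2_id1. Qed.

Lemma Ck1_lift2 n g x y : Ck1 n g y -> Ck2 n (fun _ v => g v) x y.
Proof. intros H. apply (Ck2_comp n g (fun _ v => v)); auto using Ck2_id2. Qed.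

Lemma Ck2_continuous_y n f x y : Ck2 n f x y -> continuous (fun v => f x v) y.
Proof.
  intros H P [e He]. destruct (Ck2_cont_pt _ _ _ _ H e) as [d Hd].
  exists d. intros z Hz. apply He. apply Hd; auto.
  rewrite Rminus_eq_0 Rabs_R0. apply cond_pos.
Qed.

(** One-variable closure properties are read off from the two-variable ones, a
    function of one variable being one that is constant in the other. *)
Lemma Ck1_const n c x : Ck1 n (fun _ => c) x.
Proof. apply (Ck2_slice n (fun _ _ => c) x 0). apply Ck2_const. Qed.
Lemma Ck1_id n x : Ck1 n (fun t => t) x.
Proof. apply (Ck2_slice n (fun u _ => u) x 0). apply Ck2_id1. Qed.
Lemma Ck1_plus n f g x : Ck1 n f x -> Ck1 n g x -> Ck1 n (fun t => f t + g t) x.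
Proof.
  intros. apply (Ck2_slice n (fun u _ => f u + g u) x 0).
  apply Ck2_plus; now apply Ck1_lift1.
Qed.
Lemma Ck1_mult n f g x : Ck1 n f x -> Ck1 n g x -> Ck1 n (fun t => f t * g t) x.
Proof.
  intros. apply (Ck2_slice n (fun u _ => f u * g u) x 0).
  apply Ck2_mult; now apply Ck1_lift1.
Qed.
Lemma Ck1_neg n f x : Ck1 n f x -> Ck1 n (fun t => - f t) x.
Proof.
  intros. apply (Ck2_slice n (fun u _ => - f u) x 0). apply Ck2_opp; now apply Ck1_lift1.
Qed.
Lemma Ck1_minus n f g x : Ck1 n f x -> Ck1 n g x -> Ck1 n (fun t => f t - g t) x.
Proof. intros. apply Ck1_plus; auto using Ck1_neg. Qed.
Lemma Ck1_inv n f x : f x <> 0 -> Ck1 n f x -> Ck1 n (fun t => / f t) x.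
Proof.
  intros. apply (Ck2_slice n (fun u _ => / f u) x 0). apply Ck2_inv; auto. now apply Ck1_lift1.
Qed.
Lemma Ck1_div n f g x : g x <> 0 -> Ck1 n f x -> Ck1 n g x -> Ck1 n (fun t => f t / g t) x.
Proof. intros. apply Ck1_mult; auto using Ck1_inv. Qed.
Lemma Ck1_sqrt n f x : 0 < f x -> Ck1 n f x -> Ck1 n (fun t => sqrt (f t)) x.
Proof.
  intros. apply (Ck2_slice n (fun u _ => sqrt (f u)) x 0). apply Ck2_sqrt; auto. now apply Ck1_lift1.
Qed.
Lemma Ck1_pow n f x k : Ck1 n f x -> Ck1 n (fun t => f t ^ k) x.
Proof. intros H. induction k; simpl; auto using Ck1_const, Ck1_mult. Qed.
Lemma Ck1_compose n g f x : Ck1 n g (f x) -> Ck1 n f x -> Ck1 n (fun t => g (f t)) x.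
Proof.
  intros. apply (Ck2_slice n (fun u _ => g (f u)) x 0). apply Ck2_comp; auto. now apply Ck1_lift1.
Qed.

Lemma Ck1_ext_loc n f g x : locally x (fun t => f t = g t) -> Ck1 n f x -> Ck1 n g x.
Proof.
  intros [d E] H. apply (Ck2_slice n (fun u _ => g u) x 0).
  apply Ck2_ext_loc with (f := fun u _ => f u); [|now apply Ck1_lift1].
  exists d. intros u v Hu _. apply E. exact Hu.
Qed.

Lemma Ck1_Derive n f x : Ck1 (S n) f x -> is_derive f x (Derive f x) /\ Ck1 n (Derive f) x.
Proof.
  intros [_ (f' & Hd & Hf')]. split.
  - apply Derive_correct. exists (f' x). apply (locally_singleton _ _ Hd).
  - apply Ck1_ext_loc with (2 := Hf'). apply: filter_imp Hd. intros t H. symmetry.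
    now apply is_derive_unique.
Qed.

Lemma Ck1_continuous n f x : Ck1 n f x -> continuous f x.
Proof. intros H. apply (locally_singleton _ _ (Ck1_cont _ _ _ H)). Qed.

(** ** Comparison with [ex_diff_n], chain rule *)

Lemma Ck2_ex_diff_n n : forall f x y, Ck2 n f x y -> ex_diff_n f n x y.
Proof.
  induction n as [|n IH]; intros f x y Hf; (split; [apply (Ck2_cont_pt _ _ _ _ Hf)|]); auto.
  destruct Hf as [_ (fx & fy & Hd & Hx & Hy)].
  generalize (locally_2d_singleton _ _ _ Hd). intros [A B].
  split; [eexists; exact A|]. split; [eexists; exact B|].
  split.
  - apply ex_diff_n_ext_loc with (f := fx); auto.
    apply locally_2d_imp with (2 := Hd). intros u v [P _]. symmetry. now apply is_derive_unique.
  - apply ex_diff_n_ext_loc with (f := fy); auto.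
    apply locally_2d_imp with (2 := Hd). intros u v [_ P]. symmetry. now apply is_derive_unique.
Qed.

Lemma ex_diff_n_Ck2 n : forall f x y, locally_2d (ex_diff_n f n) x y -> Ck2 n f x y.
Proof.
  induction n as [|n IH]; intros f x y H.
  - split; auto. apply locally_2d_imp with (2 := H). intros u v A; apply A.
  - split. { apply locally_2d_imp with (2 := H). intros u v A; apply A. }
    exists (fun u v => Derive (fun z => f z v) u), (fun u v => Derive (fun z => f u z) v).
    repeat split.
    + apply locally_2d_imp with (2 := H). intros u v (_ & A & B & _).
      split; apply Derive_correct; auto.
    + apply IH. apply locally_2d_imp with (2 := H). intros u v (_ & A & B & C & D). auto.
    + apply IH. apply locally_2d_imp with (2 := H). intros u v (_ & A & B & C & D). auto.
Qed.

Definition dx (f : R -> R -> R) u v := Derive (fun z => f z v) u.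
Definition dy (f : R -> R -> R) u v := Derive (fun z => f u z) v.

Lemma Ck2_dx n f x y : Ck2 (S n) f x y -> Ck2 n (dx f) x y.
Proof.
  intros [_ (fx & fy & Hd & Hx & Hy)]. apply Ck2_ext_loc with (2 := Hx).
  apply locally_2d_imp with (2 := Hd). intros u v [A _]. symmetry. now apply is_derive_unique.
Qed.

Lemma Ck2_dy n f x y : Ck2 (S n) f x y -> Ck2 n (dy f) x y.
Proof.
  intros [_ (fx & fy & Hd & Hx & Hy)]. apply Ck2_ext_loc with (2 := Hy).
  apply locally_2d_imp with (2 := Hd). intros u v [_ A]. symmetry. now apply is_derive_unique.
Qed.

Lemma Ck2_is_derive n f x y : Ck2 (S n) f x y ->
  is_derive (fun z => f z y) x (dx f x y) /\ is_derive (fun z => f x z) y (dy f x y).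
Proof.
  intros [_ (fx & fy & Hd & Hx & Hy)].
  destruct (locally_2d_singleton _ _ _ Hd) as [A B].
  split; apply Derive_correct; eexists; eauto.
Qed.

Lemma Ck2_differentiable f x y : Ck2 1 f x y ->
  differentiable_pt_lim f x y (dx f x y) (dy f x y).
Proof.
  intros H. apply filterdiff_differentiable_pt_lim.
  assert (K : filterdiff (fun u : R * R => f (fst u) (snd u)) (locally (x, y))
    (fun u : R * R => plus (scal (fst u) (dx f x y)) (scal (snd u) (dy f x y)))).
  { apply is_derive_filterdiff.
    - generalize (Ck2_locally _ _ _ _ H). intros HL.
      apply locally_2d_locally in HL. apply: filter_imp HL.
      intros [u v] A. apply (Ck2_is_derive 0 f u v A).
    - apply (Ck2_is_derive 0 f x y H).
    - apply continuity_2d_pt_filterlim. apply (Ck2_cont_pt 0). apply Ck2_dx; auto. }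
  exact K.
Qed.

Lemma Ck2_chain f g h t dg dh : Ck2 1 f (g t) (h t) ->
  is_derive g t dg -> is_derive h t dh ->
  is_derive (fun z => f (g z) (h z)) t (dx f (g t) (h t) * dg + dy f (g t) (h t) * dh).
Proof.
  intros H Hg Hh. apply is_derive_Reals.
  apply derivable_pt_lim_comp_2d; try apply is_derive_Reals; auto.
  apply Ck2_differentiable; auto.
Qed.

(** * Surfaces of revolution in polar coordinates *)

(** The symmetry of the surface is known on the closed parameter domain only.
    At a boundary point the derivatives of the smooth extension are still
    determined by the values on one side. *)
Lemma is_derive_unique_on (g h : R -> R) a b t l1 l2 :
  a < b -> a <= t <= b -> (forall x, a <= x <= b -> g x = h x) ->
  is_derive g t l1 -> is_derive h t l2 -> l1 = l2.
Proof.
  intros Hab Ht E Hg Hh.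
  assert (Hk : is_derive (fun x => g x - h x) t (l1 - l2)) by (apply: is_derive_minus; auto).
  apply is_derive_Reals in Hk.
  destruct (Req_dec l1 l2) as [|N]; auto. exfalso.
  assert (Np : 0 < Rabs (l1 - l2)) by (apply Rabs_pos_lt; lra).
  destruct (Hk _ Np) as [d Hd]. pose proof (cond_pos d) as Hdp.
  assert (X : exists k, k <> 0 /\ Rabs k < d /\ a <= t + k <= b).
  { destruct (Rlt_dec t b) as [L|L].
    - exists (Rmin (d / 2) (b - t)). assert (0 < Rmin (d / 2) (b - t)) by (apply Rmin_glb_lt; lra).
      pose proof (Rmin_l (d / 2) (b - t)). pose proof (Rmin_r (d / 2) (b - t)).
      rewrite Rabs_pos_eq; lra.
    - exists (- Rmin (d / 2) (t - a)). assert (0 < Rmin (d / 2) (t - a)) by (apply Rmin_glb_lt; lra).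
      pose proof (Rmin_l (d / 2) (t - a)). pose proof (Rmin_r (d / 2) (t - a)).
      rewrite Rabs_Ropp Rabs_pos_eq; lra. }
  destruct X as (k & K0 & K1 & K2).
  specialize (Hd k K0 K1). rewrite (E _ K2) (E _ Ht) in Hd.
  replace ((h (t + k) - h (t + k) - (h t - h t)) / k - (l1 - l2)) with (- (l1 - l2)) in Hd by (field; auto).
  rewrite Rabs_Ropp in Hd. lra.
Qed.

Lemma triple_eq (a b c a' b' c' : R) : a = a' -> b = b' -> c = c' -> (a, b, c) = (a', b', c').
Proof. now intros -> -> ->. Qed.

Definition smooth_at n (Y : R -> R -> R3) u v : Prop :=
  Ck2 n (fun x y => c1 (Y x y)) u v /\ Ck2 n (fun x y => c2 (Y x y)) u v /\
  Ck2 n (fun x y => c3 (Y x y)) u v.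

Definition polar rho (Y : R -> R -> R3) (r z : R -> R) : Prop :=
  forall t th, rho <= t <= 1 ->
    Y (t * cos th) (t * sin th) = (r t * cos th, r t * sin th, z t).

Lemma Sigma_polar rho t th : 0 <= rho -> rho <= t <= 1 -> Sigma rho (t * cos th) (t * sin th).
Proof.
  intros H0 H. unfold Sigma.
  replace ((t * cos th) ^ 2 + (t * sin th) ^ 2) with (t ^ 2).
  - rewrite sqrt_pow2; lra.
  - pose proof (sin2_cos2 th) as E. unfold Rsqr in E. nra.
Qed.

Lemma Sigma_polar_inv rho u v : Sigma rho u v ->
  exists t th, rho <= t <= 1 /\ 0 <= t /\ u = t * cos th /\ v = t * sin th.
Proof.
  intros H. set (t := sqrt (u ^ 2 + v ^ 2)).
  assert (Ht : 0 <= t) by apply sqrt_pos.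
  assert (Ht2 : t ^ 2 = u ^ 2 + v ^ 2) by (unfold t; rewrite pow2_sqrt; nra).
  exists t. destruct (Req_dec t 0) as [Z|Z].
  - exists 0. rewrite Z in Ht2. rewrite Z cos_0 sin_0. split; [unfold Sigma in H; fold t in H; lra|].
    split; [lra|]. split; nra.
  - assert (Hu : -1 <= u / t <= 1).
    { split; apply Rmult_le_reg_r with t; try lra; unfold Rdiv; rewrite Rmult_assoc Rinv_l; nra. }
    destruct (Rle_dec 0 v) as [V|V].
    + exists (acos (u / t)). split; [exact H|]. split; auto.
      rewrite cos_acos; auto. rewrite sin_acos; auto. split; [field; auto|].
      replace (1 - Rsqr (u / t)) with ((v / t) ^ 2).
      * rewrite sqrt_pow2; [field; auto|]. apply Rdiv_le_0_compat; lra.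
      * unfold Rsqr. field_simplify_eq; auto. nra.
    + exists (- acos (u / t)). split; [exact H|]. split; auto.
      rewrite cos_neg sin_neg cos_acos; auto. rewrite sin_acos; auto. split; [field; auto|].
      replace (1 - Rsqr (u / t)) with ((- v / t) ^ 2).
      * rewrite sqrt_pow2; [field; auto|]. apply Rdiv_le_0_compat; lra.
      * unfold Rsqr. field_simplify_eq; auto. nra.
Qed.

(** For [t > 0] the radial and angular derivatives determine [Du] and [Dv].  At
    the pole the angular ones carry no information, and the rays of angle [0]
    and [PI / 2] are used; comparing the rays [0] and [PI] shows that the
    profile meets the axis horizontally.  The factor [k] is [r / t], continued
    by [r'] at the pole.  The lemma is applied to the surface and also to
    its unit normal, which is the rotation of a profile too. *)
Lemma polar_frame rho Y r z r1 z1 t th :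
  0 <= rho < 1 -> polar rho Y r z -> rho <= t <= 1 ->
  (forall a, smooth_at 1 Y (t * cos a) (t * sin a)) ->
  is_derive r t r1 -> is_derive z t z1 ->
  exists k, t * k = r t /\ (t = 0 -> k = r1 /\ z1 = 0) /\
    let c := cos th in let s := sin th in
    Du Y (t * c) (t * s) = (r1 * c ^ 2 + k * s ^ 2, (r1 - k) * (s * c), z1 * c) /\
    Dv Y (t * c) (t * s) = ((r1 - k) * (s * c), r1 * s ^ 2 + k * c ^ 2, z1 * s).
Proof.
  intros Hrho HY Ht Hs Hr Hz.
  assert (Rad : forall a,
    let D f := dx f (t * cos a) (t * sin a) * cos a + dy f (t * cos a) (t * sin a) * sin a in
    D (fun x y => c1 (Y x y)) = r1 * cos a /\ D (fun x y => c2 (Y x y)) = r1 * sin a /\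
    D (fun x y => c3 (Y x y)) = z1).
  { intros a. destruct (Hs a) as (S1 & S2 & S3).
    assert (G : is_derive (fun x => x * cos a) t (cos a)) by (auto_derive; auto; ring).
    assert (G' : is_derive (fun x => x * sin a) t (sin a)) by (auto_derive; auto; ring).
    repeat split.
    - apply (is_derive_unique_on (fun x => c1 (Y (x * cos a) (x * sin a))) (fun x => r x * cos a) rho 1 t); try lra.
      + intros x Hx. rewrite HY; auto.
      + apply (Ck2_chain (fun x y => c1 (Y x y)) (fun x => x * cos a) (fun x => x * sin a)); auto.
      + replace (r1 * cos a) with (r1 * cos a + r t * 0) by ring.
        apply (is_derive_scal_l r t r1 (cos a)) in Hr.
        replace (r1 * cos a + r t * 0) with (scal r1 (cos a)); auto. unfold scal; simpl; unfold mult; simpl; ring.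
    - apply (is_derive_unique_on (fun x => c2 (Y (x * cos a) (x * sin a))) (fun x => r x * sin a) rho 1 t); try lra.
      + intros x Hx. rewrite HY; auto.
      + apply (Ck2_chain (fun x y => c2 (Y x y)) (fun x => x * cos a) (fun x => x * sin a)); auto.
      + apply (is_derive_scal_l r t r1 (sin a)) in Hr. exact Hr.
    - apply (is_derive_unique_on (fun x => c3 (Y (x * cos a) (x * sin a))) z rho 1 t); try lra; auto.
      + intros x Hx. rewrite HY; auto.
      + apply (Ck2_chain (fun x y => c3 (Y x y)) (fun x => x * cos a) (fun x => x * sin a)); auto. }
  assert (Ang :
    let D f := dx f (t * cos th) (t * sin th) * (- t * sin th) + dy f (t * cos th) (t * sin th) * (t * cos th) in
    D (fun x y => c1 (Y x y)) = - r t * sin th /\ D (fun x y => c2 (Y x y)) = r t * cos th /\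
    D (fun x y => c3 (Y x y)) = 0).
  { destruct (Hs th) as (S1 & S2 & S3).
    assert (G : is_derive (fun x => t * cos x) th (- t * sin th)) by (auto_derive; auto; ring).
    assert (G' : is_derive (fun x => t * sin x) th (t * cos th)) by (auto_derive; auto; ring).
    repeat split.
    - apply (is_derive_unique_on (fun x => c1 (Y (t * cos x) (t * sin x))) (fun x => r t * cos x) (th - 1) (th + 1) th); try lra.
      + intros x Hx. rewrite HY; auto.
      + apply (Ck2_chain (fun x y => c1 (Y x y)) (fun x => t * cos x) (fun x => t * sin x)); auto.
      + auto_derive; auto; ring.
    - apply (is_derive_unique_on (fun x => c2 (Y (t * cos x) (t * sin x))) (fun x => r t * sin x) (th - 1) (th + 1) th); try lra.
      + intros x Hx. rewrite HY; auto.
      + apply (Ck2_chain (fun x y => c2 (Y x y)) (fun x => t * cos x) (fun x => t * sin x)); auto.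
      + auto_derive; auto; ring.
    - apply (is_derive_unique_on (fun x => c3 (Y (t * cos x) (t * sin x))) (fun x => z t) (th - 1) (th + 1) th); try lra.
      + intros x Hx. rewrite HY; auto.
      + apply (Ck2_chain (fun x y => c3 (Y x y)) (fun x => t * cos x) (fun x => t * sin x)); auto.
      + auto_derive; auto; ring. }
  unfold Du, Dv, Derive3.
  destruct (Req_dec t 0) as [T0|T0].
  - subst t. exists r1.
    generalize (Rad 0) (Rad PI) (Rad (PI / 2)). cbv zeta.
    rewrite !Rmult_0_l cos_0 sin_0 cos_PI sin_PI cos_PI2 sin_PI2.
    intros (A1 & A2 & A3) (B1 & B2 & B3) (C1 & C2 & C3).
    generalize (HY 0 0 Ht) (HY 0 PI Ht). rewrite !Rmult_0_l cos_0 sin_0 cos_PI sin_PI. intros E1 E2.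
    rewrite E1 in E2. injection E2 as E3.
    assert (Z0 : z1 = 0) by lra. split; [lra|]. split; [auto|].
    unfold dx, dy in *. pose proof (sin2_cos2 th) as SC. unfold Rsqr in SC.
    rewrite ?Rmult_1_r ?Rmult_0_r ?Rplus_0_r ?Rplus_0_l in A1 A2 A3 C1 C2 C3.
    rewrite A1 A2 A3 C1 C2 C3 Z0.
    split; apply triple_eq; try ring.
    + rewrite -{1}(Rmult_1_r r1) -SC. ring.
    + rewrite -{1}(Rmult_1_r r1) -SC. ring.
  - exists (r t / t). split; [field; auto|]. split; [contradiction|].
    destruct (Rad th) as (A1 & A2 & A3). destruct Ang as (B1 & B2 & B3).
    pose proof (sin2_cos2 th) as SC. unfold Rsqr in SC. unfold dx, dy in *.
    assert (Sol : forall x y p q, x * cos th + y * sin th = p ->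
       x * (- t * sin th) + y * (t * cos th) = q ->
       x = p * cos th - q / t * sin th /\ y = p * sin th + q / t * cos th).
    { intros x y p q P Q. split.
      - transitivity (x * (sin th * sin th + cos th * cos th)); [rewrite SC; ring|].
        rewrite -P -Q. field; auto.
      - transitivity (y * (sin th * sin th + cos th * cos th)); [rewrite SC; ring|].
        rewrite -P -Q. field; auto. }
    destruct (Sol _ _ _ _ A1 B1) as [X1 Y1].
    destruct (Sol _ _ _ _ A2 B2) as [X2 Y2].
    destruct (Sol _ _ _ _ A3 B3) as [X3 Y3].
    rewrite X1 X2 X3 Y1 Y2 Y3.
    split; apply triple_eq; field; auto.
Qed.

(** ** Unit normal and mean curvature *)

Definition is_sign (e : R) : Prop := e = 1 \/ e = -1.

Lemma is_sign_sq e : is_sign e -> e * e = 1.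
Proof. intros [->| ->]; ring. Qed.

Lemma cross_frame r1 k z1 c s : c ^ 2 + s ^ 2 = 1 ->
  cross3 (r1 * c ^ 2 + k * s ^ 2, (r1 - k) * (s * c), z1 * c)
         ((r1 - k) * (s * c), r1 * s ^ 2 + k * c ^ 2, z1 * s)
  = (- k * z1 * c, - k * z1 * s, k * r1).
Proof.
  intros H. unfold cross3, c1, c2, c3; simpl fst; simpl snd. apply triple_eq.
  - transitivity (- k * z1 * c * (c ^ 2 + s ^ 2)); [ring|rewrite H; ring].
  - transitivity (- k * z1 * s * (c ^ 2 + s ^ 2)); [ring|rewrite H; ring].
  - transitivity (k * r1 * (c ^ 2 + s ^ 2) ^ 2); [ring|rewrite H; ring].
Qed.

Lemma norm_cross_frame e k r1 z1 c s : c ^ 2 + s ^ 2 = 1 -> is_sign e -> 0 < e * k ->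
  norm3 (- k * z1 * c, - k * z1 * s, k * r1) = e * k * sqrt (r1 ^ 2 + z1 ^ 2).
Proof.
  intros H He Hk. unfold norm3, dot3, c1, c2, c3; simpl fst; simpl snd.
  replace (- k * z1 * c * (- k * z1 * c) + - k * z1 * s * (- k * z1 * s) + k * r1 * (k * r1))
    with ((e * k) ^ 2 * (r1 ^ 2 + z1 ^ 2)).
  - rewrite sqrt_mult; [|apply pow2_ge_0|nra]. rewrite sqrt_pow2; lra.
  - transitivity (k ^ 2 * (z1 ^ 2 * (c ^ 2 + s ^ 2) + r1 ^ 2)); [|ring].
    rewrite H. replace ((e * k) ^ 2) with (e * e * k ^ 2) by ring. rewrite is_sign_sq; auto. ring.
Qed.

Lemma nu_of_frame sigma Y u v e k r1 z1 c s :
  c ^ 2 + s ^ 2 = 1 -> is_sign e -> 0 < e * k -> 0 < r1 ^ 2 + z1 ^ 2 ->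
  Du Y u v = (r1 * c ^ 2 + k * s ^ 2, (r1 - k) * (s * c), z1 * c) ->
  Dv Y u v = ((r1 - k) * (s * c), r1 * s ^ 2 + k * c ^ 2, z1 * s) ->
  let q := sqrt (r1 ^ 2 + z1 ^ 2) in
  area_density Y u v = e * k * q /\
  nu sigma Y u v = (- (sigma * e) * (z1 / q) * c, - (sigma * e) * (z1 / q) * s,
                    sigma * e * (r1 / q)).
Proof.
  intros H He Hk Hq EU EV q.
  unfold area_density, nu, normalize3. rewrite EU EV cross_frame; auto.
  rewrite (norm_cross_frame e); auto. fold q. split; auto.
  assert (Q : 0 < q) by (apply sqrt_lt_R0; auto).
  assert (K : k <> 0) by (intros ->; lra).
  pose proof (is_sign_sq e He) as E2.
  assert (E0 : e <> 0) by (destruct He; lra).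
  assert (Ei : / e = e) by (apply Rmult_eq_reg_l with e; auto; rewrite Rinv_r; auto).
  unfold scal3, c1, c2, c3; simpl fst; simpl snd.
  rewrite !Rinv_mult Ei. apply triple_eq; field; auto with real.
Qed.

(** Up to the sign of the normal, the principal curvatures along the meridian
    and along the parallel. *)
Definition curv_meridian (r1 r2 z1 z2 : R) : R := (r1 * z2 - z1 * r2) / sqrt (r1 ^ 2 + z1 ^ 2) ^ 3.
Definition curv_parallel (r r1 z1 : R) : R := z1 / (sqrt (r1 ^ 2 + z1 ^ 2) * r).

(** The trace does not depend on the frame: in the orthonormal frame turned by
    the angle of the point, the metric is the diagonal [(r1 ^ 2 + z1 ^ 2, k ^ 2)]
    and the second fundamental form is diagonal as well. *)
Lemma mean_curv_of_frame sigma Y u v k r1 z1 kn n1 m1 c s :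
  c ^ 2 + s ^ 2 = 1 -> k <> 0 -> 0 < r1 ^ 2 + z1 ^ 2 ->
  Du Y u v = (r1 * c ^ 2 + k * s ^ 2, (r1 - k) * (s * c), z1 * c) ->
  Dv Y u v = ((r1 - k) * (s * c), r1 * s ^ 2 + k * c ^ 2, z1 * s) ->
  Du (nu sigma Y) u v = (n1 * c ^ 2 + kn * s ^ 2, (n1 - kn) * (s * c), m1 * c) ->
  Dv (nu sigma Y) u v = ((n1 - kn) * (s * c), n1 * s ^ 2 + kn * c ^ 2, m1 * s) ->
  mean_curv sigma Y u v = - ((n1 * r1 + m1 * z1) / (r1 ^ 2 + z1 ^ 2) + kn / k) / 2.
Proof.
  intros H K Hq EU EV NU NV.
  unfold mean_curv, tr_dnu, dnu_uu, dnu_uv, dnu_vu, dnu_vv, metE, metF, metG.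
  rewrite EU EV NU NV. unfold dot3, c1, c2, c3; simpl fst; simpl snd.
  assert (C : c ^ 2 = 1 - s ^ 2) by lra.
  set (W := n1 * r1 + m1 * z1). set (V := kn * k). set (q2 := r1 ^ 2 + z1 ^ 2) in *.
  match goal with |- - ((?a * ?g - (?b + ?b') * ?f + ?d * ?e) / _) / 2 = _ =>
    replace a with (W * c ^ 2 + V * s ^ 2); [replace g with (q2 * s ^ 2 + k ^ 2 * c ^ 2);
      [replace b with ((W - V) * (s * c)); [replace b' with ((W - V) * (s * c));
        [replace f with ((q2 - k ^ 2) * (s * c)); [replace d with (W * s ^ 2 + V * c ^ 2);
         [replace e with (q2 * c ^ 2 + k ^ 2 * s ^ 2)|]|]|]|]|]|] end.
  1: replace ((q2 * c ^ 2 + k ^ 2 * s ^ 2) * (q2 * s ^ 2 + k ^ 2 * c ^ 2) - ((q2 - k ^ 2) * (s * c)) ^ 2)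
       with (q2 * k ^ 2 * (c ^ 2 + s ^ 2) ^ 2) by ring.
  1: match goal with |- - (?n / _) / 2 = _ =>
     replace n with ((W * k ^ 2 + V * q2) * (c ^ 2 + s ^ 2) ^ 2) by ring end.
  1: rewrite H; unfold V; field; split; auto; lra.
  all: unfold W, V, q2; clear - H C.
  - transitivity ((r1 ^ 2 * c ^ 2 + k ^ 2 * s ^ 2) * (c ^ 2 + s ^ 2) + z1 ^ 2 * c ^ 2);
     [rewrite H|]; ring.
  - transitivity ((n1 * r1 * s ^ 2 + kn * k * c ^ 2) * (c ^ 2 + s ^ 2) + m1 * z1 * s ^ 2);
     [rewrite H|]; ring.
  - transitivity ((r1 ^ 2 - k ^ 2) * (s * c) * (c ^ 2 + s ^ 2) + z1 ^ 2 * (s * c)); [rewrite H|]; ring.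
  - transitivity ((n1 * r1 - kn * k) * (s * c) * (c ^ 2 + s ^ 2) + m1 * z1 * (s * c)); [rewrite H|]; ring.
  - transitivity ((n1 * r1 - kn * k) * (s * c) * (c ^ 2 + s ^ 2) + m1 * z1 * (s * c)); [rewrite H|]; ring.
  - transitivity ((r1 ^ 2 * s ^ 2 + k ^ 2 * c ^ 2) * (c ^ 2 + s ^ 2) + z1 ^ 2 * s ^ 2);
     [rewrite H|]; ring.
  - transitivity ((n1 * r1 * c ^ 2 + kn * k * s ^ 2) * (c ^ 2 + s ^ 2) + m1 * z1 * c ^ 2);
     [rewrite H|]; ring.
Qed.

(** The sign [e] makes [e * r] the distance to the axis.  The derivatives of the
    profile are fields, so that a perturbed profile can be described by
    [r + eps * phi], [r1 + eps * phi1] and so on. *)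
Record revolution (rho : R) (Y : R -> R -> R3) (e : R) (r r1 r2 z z1 z2 : R -> R) : Prop := {
  rev_rho : 0 <= rho < 1;
  rev_smooth : forall u v, Sigma rho u v -> smooth_at 2 Y u v;
  rev_polar : polar rho Y r z;
  rev_r : forall t, rho <= t <= 1 -> is_derive r t (r1 t);
  rev_r1 : forall t, rho <= t <= 1 -> is_derive r1 t (r2 t);
  rev_z : forall t, rho <= t <= 1 -> is_derive z t (z1 t);
  rev_z1 : forall t, rho <= t <= 1 -> is_derive z1 t (z2 t);
  rev_sign : is_sign e;
  rev_pos : forall t, rho <= t <= 1 -> 0 < t -> 0 < e * r t;
  rev_origin : rho = 0 -> 0 < e * r1 0;
  rev_reg : forall t, rho <= t <= 1 -> 0 < r1 t ^ 2 + z1 t ^ 2 }.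

Lemma smooth_at_le m n Y u v : (m <= n)%nat -> smooth_at n Y u v -> smooth_at m Y u v.
Proof. intros H (A & B & C). repeat split; eapply Ck2_le; eauto. Qed.

Lemma rev_frame rho Y e r r1 r2 z z1 z2 t th :
  revolution rho Y e r r1 r2 z z1 z2 -> rho <= t <= 1 ->
  exists k, 0 < e * k /\ t * k = r t /\ (t = 0 -> k = r1 0 /\ z1 0 = 0) /\
    let c := cos th in let s := sin th in
    Du Y (t * c) (t * s) = (r1 t * c ^ 2 + k * s ^ 2, (r1 t - k) * (s * c), z1 t * c) /\
    Dv Y (t * c) (t * s) = ((r1 t - k) * (s * c), r1 t * s ^ 2 + k * c ^ 2, z1 t * s).
Proof.
  intros HR Ht. pose proof (rev_rho _ _ _ _ _ _ _ _ _ HR) as Hrho.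
  destruct (polar_frame rho Y r z (r1 t) (z1 t) t th) as (k & K1 & K2 & K3); auto.
  - apply HR.
  - intros a. apply smooth_at_le with 2%nat; auto. apply HR. apply Sigma_polar; lra.
  - apply HR; auto.
  - apply HR; auto.
  - exists k. split; [|split; auto; split; auto].
    + destruct (Req_dec t 0) as [T0|T0].
      * destruct (K2 T0) as [E _]. rewrite E T0. apply HR. lra.
      * assert (T : 0 < t) by lra. pose proof (rev_pos _ _ _ _ _ _ _ _ _ HR t Ht T) as P.
        rewrite -K1 in P. apply Rmult_lt_reg_l with t; auto. lra.
    + intros T0. rewrite T0 in K2. apply K2. auto.
Qed.

Lemma cos2_sin2 th : cos th ^ 2 + sin th ^ 2 = 1.
Proof. pose proof (sin2_cos2 th) as E. unfold Rsqr in E. lra. Qed.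

Lemma rev_nu rho Y sigma e r r1 r2 z z1 z2 :
  revolution rho Y e r r1 r2 z z1 z2 ->
  polar rho (nu sigma Y)
    (fun t => - (sigma * e) * (z1 t / sqrt (r1 t ^ 2 + z1 t ^ 2)))
    (fun t => sigma * e * (r1 t / sqrt (r1 t ^ 2 + z1 t ^ 2))).
Proof.
  intros HR t th Ht.
  destruct (rev_frame _ _ _ _ _ _ _ _ _ t th HR Ht) as (k & Hk & _ & _ & EU & EV).
  apply (nu_of_frame sigma Y _ _ e k); auto using cos2_sin2; apply HR; auto.
Qed.

Lemma rev_area rho Y e r r1 r2 z z1 z2 t th :
  revolution rho Y e r r1 r2 z z1 z2 -> rho <= t <= 1 ->
  area_density Y (t * cos th) (t * sin th) * t = e * r t * sqrt (r1 t ^ 2 + z1 t ^ 2).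
Proof.
  intros HR Ht.
  destruct (rev_frame _ _ _ _ _ _ _ _ _ t th HR Ht) as (k & Hk & K & _ & EU & EV).
  destruct (nu_of_frame 1 Y _ _ e k _ _ _ _ (cos2_sin2 th) (rev_sign _ _ _ _ _ _ _ _ _ HR) Hk
    (rev_reg _ _ _ _ _ _ _ _ _ HR t Ht) EU EV) as [A _].
  rewrite A -K. ring.
Qed.

Lemma rev_nu_smooth rho Y sigma e r r1 r2 z z1 z2 u v :
  revolution rho Y e r r1 r2 z z1 z2 -> Sigma rho u v -> smooth_at 1 (nu sigma Y) u v.
Proof.
  intros HR HS. destruct (rev_smooth _ _ _ _ _ _ _ _ _ HR u v HS) as (S1 & S2 & S3).
  assert (P : 0 < dot3 (cross3 (Du Y u v) (Dv Y u v)) (cross3 (Du Y u v) (Dv Y u v))).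
  { destruct (Sigma_polar_inv rho u v HS) as (t & th & Ht & _ & -> & ->).
    destruct (rev_frame _ _ _ _ _ _ _ _ _ t th HR Ht) as (k & Hk & K & _ & EU & EV).
    pose proof (norm_cross_frame e k (r1 t) (z1 t) _ _ (cos2_sin2 th) (rev_sign _ _ _ _ _ _ _ _ _ HR) Hk) as N.
    rewrite EU EV cross_frame; [|apply cos2_sin2].
    unfold norm3 in N.
    assert (0 < sqrt (r1 t ^ 2 + z1 t ^ 2)) by (apply sqrt_lt_R0; apply HR; auto).
    match goal with |- 0 < ?x => destruct (Rlt_dec 0 x) as [L|L]; auto; exfalso end.
    rewrite sqrt_neg_0 in N; [|lra]. nra. }
  unfold cross3, dot3, Du, Dv, Derive3, c1, c2, c3 in P; simpl fst in P; simpl snd in P.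
  unfold nu, normalize3, scal3, norm3, cross3, dot3, Du, Dv, Derive3, smooth_at, c1, c2, c3;
    simpl fst; simpl snd.
  unfold c1, c2, c3 in S1, S2, S3.
  pose proof (Ck2_dx _ _ _ _ S1). pose proof (Ck2_dx _ _ _ _ S2). pose proof (Ck2_dx _ _ _ _ S3).
  pose proof (Ck2_dy _ _ _ _ S1). pose proof (Ck2_dy _ _ _ _ S2). pose proof (Ck2_dy _ _ _ _ S3).
  unfold dx, dy in *.
  split; [|split]; repeat first [apply Ck2_const | assumption | apply Ck2_mult | apply Ck2_plus
    | apply Ck2_opp | apply Ck2_inv | apply Ck2_sqrt | (apply Rgt_not_eq; apply sqrt_lt_R0)].
  all: try exact P.
Qed.

(** Derivative of the angle of the tangent [(r1, z1)]. *)
Definition turn (r1 r2 z1 z2 : R) : R := (r1 * z2 - z1 * r2) / (r1 ^ 2 + z1 ^ 2).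

Lemma is_derive_cos_profile (r1 z1 : R -> R) t dr dz :
  is_derive r1 t dr -> is_derive z1 t dz -> 0 < r1 t ^ 2 + z1 t ^ 2 ->
  is_derive (fun t => r1 t / sqrt (r1 t ^ 2 + z1 t ^ 2)) t
    (- (z1 t / sqrt (r1 t ^ 2 + z1 t ^ 2)) * turn (r1 t) dr (z1 t) dz).
Proof.
  intros Hr Hz Hq. pose proof (sqrt_lt_R0 _ Hq) as Q. pose proof (sqrt_sqrt _ (Rlt_le _ _ Hq)) as QQ.
  auto_derive.
  - repeat split; try (eexists; eassumption); auto; simpl in *; nra.
  - rewrite (is_derive_unique _ _ _ Hr) (is_derive_unique _ _ _ Hz). unfold turn.
    simpl in *. set (q := sqrt _) in *. rewrite !Rmult_1_r in QQ |- *. rewrite -QQ.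
    field_simplify_eq; [|lra]. replace (q ^ 2) with (r1 t * r1 t + z1 t * z1 t) by lra. ring.
Qed.

Lemma is_derive_sin_profile (r1 z1 : R -> R) t dr dz :
  is_derive r1 t dr -> is_derive z1 t dz -> 0 < r1 t ^ 2 + z1 t ^ 2 ->
  is_derive (fun t => z1 t / sqrt (r1 t ^ 2 + z1 t ^ 2)) t
    (r1 t / sqrt (r1 t ^ 2 + z1 t ^ 2) * turn (r1 t) dr (z1 t) dz).
Proof.
  intros Hr Hz Hq. pose proof (sqrt_lt_R0 _ Hq) as Q. pose proof (sqrt_sqrt _ (Rlt_le _ _ Hq)) as QQ.
  auto_derive.
  - repeat split; try (eexists; eassumption); auto; simpl in *; nra.
  - rewrite (is_derive_unique _ _ _ Hr) (is_derive_unique _ _ _ Hz). unfold turn.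
    simpl in *. set (q := sqrt _) in *. rewrite !Rmult_1_r in QQ |- *. rewrite -QQ.
    field_simplify_eq; [|lra]. replace (q ^ 2) with (r1 t * r1 t + z1 t * z1 t) by lra. ring.
Qed.

Definition mean_curv_of s r r1 r2 z1 z2 := s / 2 * (curv_meridian r1 r2 z1 z2 + curv_parallel r r1 z1).

(** Here [kap] is the curvature along the parallel.  The factor [t] includes the
    pole, where [kap] agrees with the curvature of the meridian since every
    direction is principal there. *)
Lemma rev_mean_curv_aux rho Y sigma e r r1 r2 z z1 z2 t th :
  revolution rho Y e r r1 r2 z z1 z2 -> rho <= t <= 1 ->
  exists kap, t * kap = t * curv_parallel (r t) (r1 t) (z1 t) /\
   (t = 0 -> kap = curv_meridian (r1 0) (r2 0) (z1 0) (z2 0)) /\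
  mean_curv sigma Y (t * cos th) (t * sin th)
  = sigma * e / 2 * (curv_meridian (r1 t) (r2 t) (z1 t) (z2 t) + kap).
Proof.
  intros HR Ht.
  pose proof (rev_rho _ _ _ _ _ _ _ _ _ HR) as Hrho.
  pose proof (rev_reg _ _ _ _ _ _ _ _ _ HR t Ht) as Q2.
  pose proof (sqrt_lt_R0 _ Q2) as Q. pose proof (sqrt_sqrt _ (Rlt_le _ _ Q2)) as QQ.
  pose proof (rev_r1 _ _ _ _ _ _ _ _ _ HR t Ht) as Dr.
  pose proof (rev_z1 _ _ _ _ _ _ _ _ _ HR t Ht) as Dz.
  destruct (rev_frame _ _ _ _ _ _ _ _ _ t th HR Ht) as (k & Hk & K & K0 & EU & EV).
  assert (K1 : k <> 0) by (intros ->; lra).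
  destruct (polar_frame rho (nu sigma Y) _ _
     (scal (- (sigma * e)) (r1 t / sqrt (r1 t ^ 2 + z1 t ^ 2) * turn (r1 t) (r2 t) (z1 t) (z2 t)))
     (scal (sigma * e) (- (z1 t / sqrt (r1 t ^ 2 + z1 t ^ 2)) * turn (r1 t) (r2 t) (z1 t) (z2 t)))
     t th Hrho (rev_nu rho Y sigma e r r1 r2 z z1 z2 HR) Ht) as (kn & N & N0 & NU & NV).
  - intros a. apply (rev_nu_smooth rho Y sigma e r r1 r2 z z1 z2); auto. apply Sigma_polar; lra.
  - apply: is_derive_scal. apply is_derive_sin_profile; auto.
  - apply: is_derive_scal. apply is_derive_cos_profile; auto.
  - rewrite (mean_curv_of_frame sigma Y _ _ _ _ _ _ _ _ _ _ (cos2_sin2 th) K1 Q2 EU EV NU NV).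
    clear NU NV EU EV. unfold scal in *; simpl in *; unfold mult in *; simpl in *.
    unfold turn, curv_meridian, curv_parallel in *; simpl in *.
    rewrite !Rmult_1_r in QQ Q Q2 N N0 |- *.
    set (q := sqrt _) in *.
    assert (E2 := is_sign_sq e (rev_sign _ _ _ _ _ _ _ _ _ HR)).
    assert (E0 : e <> 0) by (intros ->; lra).
    destruct (Req_dec t 0) as [T0|T0].
    + destruct (N0 T0) as [Ekn _]. destruct (K0 T0) as [Ek Ez].
      subst t. exists ((r1 0 * z2 0 - z1 0 * r2 0) / (q * (q * q))).
      split; [ring|]. split.
      { intros _. reflexivity. }
      rewrite Ekn Ek Ez in QQ |- *. rewrite -QQ. rewrite Ek in K1.
      assert (RR : q * q = r1 0 * r1 0) by lra.
      match goal with |- - (?a / (q * q) + ?b) / 2 = _ =>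
        replace a with (- (sigma * e) * (r1 0 * r1 0) / q * (r1 0 * z2 0 / (q * q))) by (field; lra);
        replace b with (- (sigma * e) * (r1 0 * z2 0 / (q * (q * q)))) by (field; lra) end.
      rewrite -RR. field. lra.
    + exists (z1 t / (q * r t)). split; [auto|]. split; [contradiction|].
      assert (R0 : r t <> 0) by (rewrite -K; apply Rmult_integral_contrapositive; auto).
      replace (kn / k) with (- (sigma * e) * (z1 t / (q * r t))).
      2:{ transitivity (t * kn / r t); [rewrite N; field; split; auto; lra|rewrite -K; field; auto]. }
      rewrite -QQ. replace (z1 t * r1 t) with (r1 t * z1 t) by ring.
      set (om := r1 t * z2 t - z1 t * r2 t). set (kap := z1 t / (q * r t)).
      match goal with |- - (?a / (q * q) + _) / 2 = _ =>
        replace a with (- (sigma * e) * (r1 t * r1 t + z1 t * z1 t) / q * (om / (q * q))) end.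
      2:{ unfold om. field. lra. }
      rewrite -QQ. field. lra.
Qed.

Lemma rev_mean_curv rho Y sigma e r r1 r2 z z1 z2 t th :
  revolution rho Y e r r1 r2 z z1 z2 -> rho <= t <= 1 -> 0 < t ->
  mean_curv sigma Y (t * cos th) (t * sin th)
  = mean_curv_of (sigma * e) (r t) (r1 t) (r2 t) (z1 t) (z2 t).
Proof.
  intros HR Ht T.
  destruct (rev_mean_curv_aux rho Y sigma e r r1 r2 z z1 z2 t th HR Ht) as (kap & A & _ & B).
  rewrite B. unfold mean_curv_of. apply Rmult_eq_reg_l in A; [|lra]. now rewrite A.
Qed.

(** The integral and continuity lemmas produce equalities in a normed module;
    [ring] and [field] want them in [R]. *)
Ltac as_real := match goal with |- @eq _ ?x ?y => change (@eq R x y) end.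

(** * Parallel circles *)

Definition circle_curve (r z w : R) (t : R) : R3 := (r * cos (w * t), r * sin (w * t), z).

Lemma Derive3_eq (c : R -> R3) t a b d :
  is_derive (fun s => c1 (c s)) t a -> is_derive (fun s => c2 (c s)) t b ->
  is_derive (fun s => c3 (c s)) t d -> Derive3 c t = (a, b, d).
Proof.
  intros A B C. unfold Derive3.
  now rewrite (is_derive_unique _ _ _ A) (is_derive_unique _ _ _ B) (is_derive_unique _ _ _ C).
Qed.

Lemma Derive3_circle r z w t :
  Derive3 (circle_curve r z w) t = (- r * w * sin (w * t), r * w * cos (w * t), 0).
Proof.
  apply Derive3_eq; unfold circle_curve, c1, c2, c3; simpl; auto_derive; auto; ring.
Qed.

Lemma speed_circle r z w e t : is_sign w -> is_sign e -> 0 < e * r ->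
  speed (circle_curve r z w) t = e * r.
Proof.
  intros Hw He Hr. unfold speed. rewrite Derive3_circle.
  unfold norm3, dot3, c1, c2, c3; simpl.
  match goal with |- sqrt ?x = _ => replace x with ((e * r) ^ 2) end.
  - rewrite sqrt_pow2; lra.
  - transitivity (r ^ 2 * (w * w) * (cos (w * t) ^ 2 + sin (w * t) ^ 2)); [|ring].
    rewrite cos2_sin2 is_sign_sq; auto. transitivity (e * e * r ^ 2); [ring|]. rewrite is_sign_sq; auto. ring.
Qed.

Lemma tangent_circle r z w e : is_sign w -> is_sign e -> 0 < e * r ->
  tangent (circle_curve r z w) = fun t => (- (e * w) * sin (w * t), e * w * cos (w * t), 0).
Proof.
  intros Hw He Hr. extensionality t. unfold tangent, Ds.
  rewrite (speed_circle r z w e) ?Derive3_circle; auto.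
  assert (r <> 0) by (intros ->; lra). pose proof (is_sign_sq e He).
  assert (e <> 0) by (intros ->; lra).
  unfold scal3, c1, c2, c3; simpl.
  assert (Ei : / (e * r) * r = e).
  { apply Rmult_eq_reg_l with e; auto. rewrite H0. field; auto. }
  apply triple_eq.
  - transitivity (- (/ (e * r) * r * w) * sin (w * t)); [ring|rewrite Ei; ring].
  - transitivity ((/ (e * r) * r * w) * cos (w * t)); [ring|rewrite Ei; ring].
  - ring.
Qed.

Lemma curvature_vector_circle r z w e t : is_sign w -> is_sign e -> 0 < e * r ->
  Ds (circle_curve r z w) (tangent (circle_curve r z w)) t
  = (- / r * cos (w * t), - / r * sin (w * t), 0).
Proof.
  intros Hw He Hr. unfold Ds at 1.
  rewrite (speed_circle r z w e) ?(tangent_circle r z w e); auto.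
  rewrite (Derive3_eq _ t (- (e * w) * w * cos (w * t)) (- (e * w) * w * sin (w * t)) 0);
    try (unfold c1, c2, c3; simpl; auto_derive; auto; ring).
  assert (r <> 0) by (intros ->; lra). assert (e <> 0) by (intros ->; lra).
  pose proof (is_sign_sq w Hw) as W2.
  unfold scal3, c1, c2, c3; simpl. apply triple_eq.
  - transitivity (- / r * (w * w) * cos (w * t)); [field; auto|rewrite W2; ring].
  - transitivity (- / r * (w * w) * sin (w * t)); [field; auto|rewrite W2; ring].
  - ring.
Qed.

Lemma curvature_circle r z w e t : is_sign w -> is_sign e -> 0 < e * r ->
  curvature (circle_curve r z w) t = / (e * r).
Proof.
  intros Hw He Hr. unfold curvature. rewrite (curvature_vector_circle r z w e); auto.
  unfold norm3, dot3, c1, c2, c3; simpl.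
  assert (r <> 0) by (intros ->; lra). assert (E : e <> 0) by (intros ->; lra).
  match goal with |- sqrt ?x = _ => replace x with ((/ (e * r)) ^ 2) end.
  - rewrite sqrt_pow2; auto. apply Rlt_le, Rinv_0_lt_compat; auto.
  - transitivity ((/ r) ^ 2 * (cos (w * t) ^ 2 + sin (w * t) ^ 2)); [|ring].
    rewrite cos2_sin2. rewrite Rinv_mult. transitivity ((/ (e * e)) * (/ r) ^ 2).
    + rewrite Rinv_mult; ring.
    + rewrite is_sign_sq; auto. field; auto.
Qed.

Lemma is_sign_mult a b : is_sign a -> is_sign b -> is_sign (a * b).
Proof. unfold is_sign. intros [->| ->] [->| ->]; [left|right|right|left]; ring. Qed.

Lemma on_circle_polar rho (Y : R -> R -> R3) r z rad w :
  polar rho Y r z -> rho <= rad <= 1 ->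
  on_circle rad w Y = circle_curve (r rad) (z rad) w.
Proof. intros HY H. extensionality t. apply HY; auto. Qed.

Lemma rev_geod_curv rho Y sigma e r r1 r2 z z1 z2 rad om t :
  revolution rho Y e r r1 r2 z z1 z2 -> is_sign sigma -> is_sign om ->
  rho <= rad <= 1 -> 0 < rad ->
  geod_curv sigma Y rad om t
  = - om * (r1 rad / sqrt (r1 rad ^ 2 + z1 rad ^ 2)) / r rad.
Proof.
  intros HR Hs Ho Ht T. unfold geod_curv.
  pose proof (rev_pos _ _ _ _ _ _ _ _ _ HR rad Ht T) as P.
  pose proof (rev_sign _ _ _ _ _ _ _ _ _ HR) as He.
  rewrite (on_circle_polar rho Y r z); auto; [|apply HR].
  rewrite (on_circle_polar rho (nu sigma Y) _ _ rad (sigma * om) (rev_nu rho Y sigma e r r1 r2 z z1 z2 HR)); auto.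
  pose proof (is_sign_mult _ _ Hs Ho) as Hw.
  rewrite (curvature_vector_circle _ _ _ e); auto. rewrite (tangent_circle _ _ _ e); auto.
  unfold circle_curve, cross3, dot3, c1, c2, c3; cbn [fst snd].
  assert (r rad <> 0) by (intros E; rewrite E in P; lra).
  cbv beta; set (C := r1 rad / _). clearbody C. set (S := z1 rad / _). clearbody S. set (w := sigma * om) in *.
  transitivity (- (e * e) * (w * sigma) * C / r rad * (cos (w * t) ^ 2 + sin (w * t) ^ 2)).
  - field; auto.
  - rewrite cos2_sin2 is_sign_sq; auto. unfold w.
    replace (sigma * om * sigma) with (om * (sigma * sigma)) by ring. rewrite is_sign_sq; auto. field; auto.
Qed.

Lemma rev_axis_dist rho Y e r r1 r2 z z1 z2 rad om t :
  revolution rho Y e r r1 r2 z z1 z2 -> rho <= rad <= 1 -> 0 < rad ->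
  axis_dist (on_circle rad om Y t) = e * r rad.
Proof.
  intros HR Ht T. pose proof (rev_pos _ _ _ _ _ _ _ _ _ HR rad Ht T) as P.
  rewrite (on_circle_polar rho Y r z); auto; [|apply HR].
  unfold circle_curve, axis_dist, c1, c2; cbn [fst snd].
  match goal with |- sqrt ?x = _ => replace x with ((e * r rad) ^ 2) end.
  - rewrite sqrt_pow2; lra.
  - transitivity (e * e * r rad ^ 2 * 1); [ring|]. rewrite -(cos2_sin2 (om * t)).
    rewrite is_sign_sq; [ring|]. apply HR.
Qed.

(** * The energy of a surface of revolution *)

Definition bending_density a co s e (r r1 r2 z1 z2 : R) : R :=
  a * (mean_curv_of s r r1 r2 z1 z2 + co) ^ 2 * (e * r * sqrt (r1 ^ 2 + z1 ^ 2)).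

(** Energy, divided by [2 * PI], of a circle of radius [x]: its curvature is
    [1 / x]. *)
Definition circle_energy alpha beta (x : R) : R := alpha / x + beta * x.

(** A disc has no inner boundary circle. *)
Definition on_inner (rho x : R) : R := match Rlt_dec 0 rho with left _ => x | right _ => 0 end.

Lemma rev_surface_integral rho Y sigma e r r1 r2 z z1 z2 a co :
  revolution rho Y e r r1 r2 z z1 z2 ->
  surface_integral rho Y (fun u v => a * (mean_curv sigma Y u v + co) ^ 2 + 0 * gauss_curv sigma Y u v)
  = RInt (fun t => 2 * PI * bending_density a co (sigma * e) e (r t) (r1 t) (r2 t) (z1 t) (z2 t)) rho 1.
Proof.
  intros HR. pose proof (rev_rho _ _ _ _ _ _ _ _ _ HR) as Hrho.
  unfold surface_integral. apply RInt_ext. intros t.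
  rewrite Rmin_left ?Rmax_right; try lra. intros Ht.
  assert (Ht' : rho <= t <= 1) by lra.
  transitivity (RInt (fun _ => bending_density a co (sigma * e) e (r t) (r1 t) (r2 t) (z1 t) (z2 t)) 0 (2 * PI)).
  - apply RInt_ext. intros th _. unfold on_circle. rewrite !Rmult_1_l.
    rewrite (rev_mean_curv rho Y sigma e r r1 r2 z z1 z2); auto; [|lra].
    rewrite Rmult_assoc (rev_area rho Y e r r1 r2 z z1 z2); auto.
    unfold bending_density. as_real; ring.
  - rewrite RInt_const. unfold scal; simpl; unfold mult; simpl. as_real; ring.
Qed.

Lemma rev_boundary_integral rho Y sigma e r r1 r2 z z1 z2 alpha beta :
  revolution rho Y e r r1 r2 z z1 z2 -> is_sign sigma ->
  boundary_integral rho sigma Y (fun c t => alpha * curvature c t ^ 2 + beta)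
  = 2 * PI * (circle_energy alpha beta (e * r 1)
      + on_inner rho (circle_energy alpha beta (e * r rho))).
Proof.
  intros HR Hs. pose proof (rev_rho _ _ _ _ _ _ _ _ _ HR) as Hrho.
  pose proof (rev_sign _ _ _ _ _ _ _ _ _ HR) as He.
  assert (K : forall rad om, rho <= rad <= 1 -> 0 < rad -> is_sign om ->
    RInt (fun t => (alpha * curvature (on_circle rad (sigma * om) Y) t ^ 2 + beta)
       * speed (on_circle rad (sigma * om) Y) t) 0 (2 * PI)
    = 2 * PI * circle_energy alpha beta (e * r rad)).
  { intros rad om H T Ho. pose proof (rev_pos _ _ _ _ _ _ _ _ _ HR rad H T) as P.
    rewrite (on_circle_polar rho Y r z); auto; [|apply HR].
    transitivity (RInt (fun _ => circle_energy alpha beta (e * r rad)) 0 (2 * PI)).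
    - apply RInt_ext. intros t _. pose proof (is_sign_mult _ _ Hs Ho) as Hw.
      rewrite (curvature_circle _ _ _ e) ?(speed_circle _ _ _ e); auto.
      unfold circle_energy. as_real. set (x := e * r rad) in *. clearbody x. field. lra.
    - rewrite RInt_const. unfold scal; simpl; unfold mult; simpl. as_real; ring. }
  unfold boundary_integral, boundary_circles, on_inner. destruct (Rlt_dec 0 rho) as [P|P]; simpl.
  - rewrite (K 1 1) ?(K rho (-1)); unfold is_sign; try lra; ring.
  - rewrite (K 1 1); unfold is_sign; try lra; ring.
Qed.

Lemma rev_energy rho Y sigma e r r1 r2 z z1 z2 a co alpha beta :
  revolution rho Y e r r1 r2 z z1 z2 -> is_sign sigma ->
  energy rho sigma a co 0 alpha beta Y
  = RInt (fun t => 2 * PI * bending_density a co (sigma * e) e (r t) (r1 t) (r2 t) (z1 t) (z2 t)) rho 1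
  + 2 * PI * (circle_energy alpha beta (e * r 1)
      + on_inner rho (circle_energy alpha beta (e * r rho))).
Proof.
  intros HR Hs. unfold energy.
  rewrite (rev_surface_integral rho Y sigma e r r1 r2 z z1 z2); auto.
  rewrite (rev_boundary_integral rho Y sigma e r r1 r2 z z1 z2); auto.
Qed.

(** * The profile of an axially symmetric immersion *)

(** The line [v = 0] of the extended immersion gives a profile that is
    smooth on both sides of the end points.  Being an immersion makes [r] nonzero
    off the axis, hence of constant sign by the intermediate value theorem. *)
Lemma immersion_profile rho X :
  0 <= rho < 1 -> immersion rho X -> axially_symmetric rho X ->
  exists e r z,
    revolution rho X e r (Derive r) (Derive (Derive r)) z (Derive z) (Derive (Derive z)) /\
    (forall t, rho <= t <= 1 -> Ck1 4 r t /\ Ck1 4 z t).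
Proof.
  intros Hrho [HC HI] (r0 & z0 & H0).
  set (r := fun t => c1 (X t 0)). set (z := fun t => c3 (X t 0)).
  assert (Hs : forall u v, Sigma rho u v -> smooth_at 4 X u v).
  { intros u v H. pose proof (HC u v H) as L. split; [|split]; apply ex_diff_n_Ck2;
     apply: locally_2d_imp L; intros x y L; apply L. }
  assert (HP : polar rho X r z).
  { intros t th Ht. unfold r, z. generalize (H0 t 0 Ht). rewrite cos_0 sin_0 Rmult_1_r !Rmult_0_r Rmult_1_r.
    intros ->. rewrite H0; auto. }
  assert (HK : forall t, rho <= t <= 1 -> Ck1 4 r t /\ Ck1 4 z t).
  { intros t Ht. assert (S0 : Sigma rho t 0).
    { generalize (Sigma_polar rho t 0). rewrite cos_0 sin_0 Rmult_1_r Rmult_0_r. intros K; apply K; lra. }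
    destruct (Hs _ _ S0) as (A & _ & B). split.
    - apply (Ck2_slice 4 (fun x y => c1 (X x y))); auto.
    - apply (Ck2_slice 4 (fun x y => c3 (X x y))); auto. }
  assert (Hreg : forall t, rho <= t <= 1 -> (0 < t -> r t <> 0) /\ 0 < Derive r t ^ 2 + Derive z t ^ 2
     /\ (t = 0 -> r t = 0 /\ Derive r t <> 0)).
  { intros t Ht.
    destruct (polar_frame rho X r z (Derive r t) (Derive z t) t 0) as (k & K1 & K2 & EU & EV); auto.
    - intros a. apply smooth_at_le with 4%nat; [lia|]. apply Hs. apply Sigma_polar; lra.
    - destruct (HK t Ht). now apply (Ck1_Derive 3).
    - destruct (HK t Ht). now apply (Ck1_Derive 3).
    - assert (HI' := HI (t * cos 0) (t * sin 0)). rewrite EU EV in HI'. rewrite cross_frame in HI'; [|apply cos2_sin2].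
      specialize (HI' (Sigma_polar rho t 0 (proj1 Hrho) Ht)).
      assert (k <> 0). { intros ->. apply HI'. apply triple_eq; ring. }
      split; [|split].
      + intros T. rewrite -K1. apply Rmult_integral_contrapositive. split; auto. lra.
      + destruct (Req_dec (Derive r t) 0) as [E1|E1]; destruct (Req_dec (Derive z t) 0) as [E2|E2]; try nra.
        exfalso. apply HI'. rewrite E1 E2. apply triple_eq; ring.
      + intros T. destruct (K2 T) as [E _]. rewrite -E. split; auto. rewrite -K1 T. ring. }
  assert (He : exists e, is_sign e /\ 0 < e * r 1).
  { destruct (Hreg 1) as [A _]; [lra|]. specialize (A Rlt_0_1). unfold is_sign.
    destruct (Rlt_dec 0 (r 1)); [exists 1|exists (-1)]; split; auto; lra. }
  destruct He as (e & He & He1).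
  assert (Hpos : forall t, rho <= t <= 1 -> 0 < t -> 0 < e * r t).
  { intros t Ht T. destruct (Rlt_dec 0 (e * r t)) as [|N]; auto. exfalso.
    destruct (Hreg t Ht) as [A _]. specialize (A T).
    assert (e * r t <> 0) by (apply Rmult_integral_contrapositive; split; auto; destruct He; lra).
    destruct (Rle_lt_or_eq_dec t 1) as [L|L]; [lra| |subst t; auto].
    destruct (IVT_interv (fun x => e * r x) t 1) as (x & Hx & Ex); try lra.
    - intros x Hx. assert (C : Ck1 4 (fun x => e * r x) x).
      { apply Ck1_mult; [apply Ck1_const|]. apply HK. lra. }
      apply continuity_pt_filterlim. exact (Ck1_continuous _ _ _ C).
    - destruct (Hreg x) as [B _]; [lra|].
      apply Rmult_integral in Ex. destruct Ex; [destruct He; lra|]. apply B; auto. lra. }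
  exists e, r, z. split; auto. constructor; auto.
  - intros u v H. apply smooth_at_le with 4%nat; auto.
  - intros t Ht. destruct (HK t Ht) as [A _]. apply (Ck1_Derive 3 r); auto.
  - intros t Ht. destruct (HK t Ht) as [A _]. apply (Ck1_Derive 2 (Derive r)). apply (Ck1_Derive 3 r); auto.
  - intros t Ht. destruct (HK t Ht) as [_ A]. apply (Ck1_Derive 3 z); auto.
  - intros t Ht. destruct (HK t Ht) as [_ A]. apply (Ck1_Derive 2 (Derive z)). apply (Ck1_Derive 3 z); auto.
  - intros Z. assert (Ht0 : rho <= 0 <= 1) by lra. destruct (Hreg 0 Ht0) as (_ & _ & K).
    destruct (K eq_refl) as [K0 K1].
    destruct (HK 0 Ht0) as [A _]. apply (Ck1_Derive 3 r) in A. destruct A as [A _].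
    apply is_derive_Reals in A. destruct (A _ (Rabs_pos_lt _ K1)) as [d Hd].
    destruct (Rlt_dec 0 (e * Derive r 0)) as [|N]; auto. exfalso.
    set (h := Rmin (d / 2) 1). pose proof (cond_pos d).
    assert (0 < h) by (apply Rmin_glb_lt; lra).
    assert (h <= d / 2) by apply Rmin_l. assert (h <= 1) by apply Rmin_r.
    specialize (Hd h). rewrite Rplus_0_l K0 Rminus_0_r in Hd.
    assert (Hh : Rabs (r h / h - Derive r 0) < Rabs (Derive r 0)).
    { apply Hd; [lra|]. rewrite Rabs_pos_eq; lra. }
    specialize (Hpos h). assert (P : 0 < e * r h) by (apply Hpos; lra).
    assert (P' : 0 < e * (r h / h)).
    { replace (e * (r h / h)) with (e * r h * / h) by (field; lra). apply Rmult_lt_0_compat; auto.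
      now apply Rinv_0_lt_compat. }
    unfold Rabs in Hh. destruct He as [E|E]; rewrite E in N, P'; repeat destruct Rcase_abs; lra.
  - intros t Ht. apply Hreg; auto.
Qed.

(** * Axially symmetric variations *)

(** Writing the components through [u ^ 2 + v ^ 2] makes the field smooth at
    the pole. *)
Definition axial_field (Q P : R -> R) (u v : R) : R3 :=
  (u * Q (u ^ 2 + v ^ 2), v * Q (u ^ 2 + v ^ 2), P (u ^ 2 + v ^ 2)).

Definition radial_part (Q : R -> R) (t : R) : R := t * Q (t ^ 2).
Definition vertical_part (P : R -> R) (t : R) : R := P (t ^ 2).

Lemma axial_field_smooth Q P u v :
  (forall w, Ck1 4 Q w) -> (forall w, Ck1 4 P w) -> smooth_at 4 (axial_field Q P) u v.
Proof.
  intros HQ HP. unfold axial_field, smooth_at, c1, c2, c3; cbn [fst snd].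
  assert (W : Ck2 4 (fun x y => x ^ 2 + y ^ 2) u v).
  { apply Ck2_plus; apply Ck2_pow; [apply Ck2_id1|apply Ck2_id2]. }
  split; [|split].
  - apply Ck2_mult; [apply Ck2_id1|]. apply (Ck2_comp 4 Q); auto.
  - apply Ck2_mult; [apply Ck2_id2|]. apply (Ck2_comp 4 Q); auto.
  - apply (Ck2_comp 4 P); auto.
Qed.

Lemma axial_field_C4 rho Q P :
  (forall w, Ck1 4 Q w) -> (forall w, Ck1 4 P w) -> C4 rho (axial_field Q P).
Proof.
  intros HQ HP u v _. apply locally_2d_forall. intros x y.
  destruct (axial_field_smooth Q P x y HQ HP) as (A & B & C).
  split; [|split]; apply Ck2_ex_diff_n; auto.
Qed.

Lemma radial_part_smooth Q t : (forall w, Ck1 4 Q w) -> Ck1 4 (radial_part Q) t.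
Proof.
  intros HQ. apply Ck1_mult; [apply Ck1_id|]. apply (Ck1_compose 4 Q); auto.
  apply Ck1_pow, Ck1_id.
Qed.

Lemma vertical_part_smooth P t : (forall w, Ck1 4 P w) -> Ck1 4 (vertical_part P) t.
Proof. intros HP. apply (Ck1_compose 4 P); auto. apply Ck1_pow, Ck1_id. Qed.

Definition perturb (X : R -> R -> R3) (V : R -> R -> R3) (eps : R) (u v : R) : R3 :=
  add3 (X u v) (scal3 eps (V u v)).

Lemma is_derive_affine f g t df dg eps : is_derive f t df -> is_derive g t dg ->
  is_derive (fun x => f x + eps * g x) t (df + eps * dg).
Proof.
  intros A B. apply: is_derive_plus; auto. apply: is_derive_scal. auto.
Qed.

Lemma perturb_revolution rho X e r z Q P eps :
  revolution rho X e r (Derive r) (Derive (Derive r)) z (Derive z) (Derive (Derive z)) ->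
  (forall w, Ck1 4 Q w) -> (forall w, Ck1 4 P w) ->
  let phi := radial_part Q in let psi := vertical_part P in
  (forall t, rho <= t <= 1 -> 0 < t -> 0 < e * (r t + eps * phi t)) ->
  (rho = 0 -> Derive phi 0 = 0) ->
  (forall t, rho <= t <= 1 ->
     0 < (Derive r t + eps * Derive phi t) ^ 2 + (Derive z t + eps * Derive psi t) ^ 2) ->
  revolution rho (perturb X (axial_field Q P) eps) e
    (fun t => r t + eps * phi t) (fun t => Derive r t + eps * Derive phi t)
    (fun t => Derive (Derive r) t + eps * Derive (Derive phi) t)
    (fun t => z t + eps * psi t) (fun t => Derive z t + eps * Derive psi t)
    (fun t => Derive (Derive z) t + eps * Derive (Derive psi) t).
Proof.
  intros HR HQ HP phi psi Hpos Horig Hreg.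
  assert (Hphi : forall t, Ck1 4 phi t) by (intros; now apply radial_part_smooth).
  assert (Hpsi : forall t, Ck1 4 psi t) by (intros; now apply vertical_part_smooth).
  destruct HR as [Hrho Hs Hp Hr Hr1 Hz Hz1 He Hpos0 Ho Hreg0]. constructor; auto.
  - intros u v H. destruct (Hs u v H) as (A & B & C).
    destruct (smooth_at_le 2 4 _ _ _ ltac:(lia) (axial_field_smooth Q P u v HQ HP)) as (A' & B' & C').
    unfold perturb, add3, scal3, smooth_at, c1, c2, c3 in *; cbn [fst snd] in *.
    split; [|split]; apply Ck2_plus; auto; apply Ck2_mult; auto; apply Ck2_const.
  - intros t th Ht. unfold perturb. rewrite (Hp t th Ht). unfold axial_field, add3, scal3, c1, c2, c3; cbn [fst snd].
    replace ((t * cos th) ^ 2 + (t * sin th) ^ 2) with (t ^ 2 * (cos th ^ 2 + sin th ^ 2)) by ring.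
    rewrite cos2_sin2 Rmult_1_r. unfold phi, psi, radial_part, vertical_part. apply triple_eq; ring.
  - intros t Ht. apply is_derive_affine; auto. apply (Ck1_Derive 3); auto.
  - intros t Ht. apply is_derive_affine; auto. apply (Ck1_Derive 2). apply (Ck1_Derive 3); auto.
  - intros t Ht. apply is_derive_affine; auto. apply (Ck1_Derive 3); auto.
  - intros t Ht. apply is_derive_affine; auto. apply (Ck1_Derive 2). apply (Ck1_Derive 3); auto.
  - intros Z. rewrite Horig; auto. rewrite Rmult_0_r Rplus_0_r. auto.
Qed.

Lemma uniform_pos (f g : R -> R) a b : a <= b ->
  (forall t, a <= t <= b -> continuous f t) -> (forall t, a <= t <= b -> continuous g t) ->
  (forall t, a <= t <= b -> 0 < f t) ->
  exists d : posreal, forall eps t, Rabs eps < d -> a <= t <= b -> 0 < f t + eps * g t.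
Proof.
  intros Hab Hf Hg Hp.
  destruct (continuity_ab_min f a b Hab) as (x & Hx & Hxab).
  { intros t Ht. apply continuity_pt_filterlim. apply Hf; auto. }
  destruct (continuity_ab_maj (fun t => Rabs (g t)) a b Hab) as (y & Hy & Hyab).
  { intros t Ht. apply (continuity_pt_comp g Rabs).
    - apply continuity_pt_filterlim. apply Hg; auto.
    - apply Rcontinuity_abs. }
  pose proof (Hp x Hxab) as Px. set (m := f x) in *. set (M := Rabs (g y)) in *.
  assert (HM : 0 <= M) by apply Rabs_pos.
  assert (Hd : 0 < m / (M + 1)) by (apply Rdiv_lt_0_compat; lra).
  exists (mkposreal _ Hd). intros eps t He Ht. simpl in He.
  assert (Rabs (eps * g t) < m).
  { rewrite Rabs_mult. apply Rle_lt_trans with (Rabs eps * M).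
    - apply Rmult_le_compat_l; [apply Rabs_pos|]. apply Hy; auto.
    - apply Rle_lt_trans with (Rabs eps * (M + 1)).
      + apply Rmult_le_compat_l; [apply Rabs_pos|lra].
      + apply Rmult_lt_reg_r with (/ (M + 1)); [apply Rinv_0_lt_compat; lra|].
        rewrite Rmult_assoc Rinv_r; [|lra]. rewrite Rmult_1_r. exact He. }
  pose proof (Hx t Ht) as Hm. fold m in Hm. unfold Rabs in H. destruct Rcase_abs; lra.
Qed.

(** The curvature [z' / (q r)] along the parallels is singular at the pole as an
    expression in the profile, so test functions are made to vanish up to a
    radius [c].  On an annulus [c = rho] is allowed and then there is no such
    condition, which gives access to the inner circle. *)
Definition admissible rho c (Q P : R -> R) : Prop :=
  rho <= c /\ 0 < c < 1 /\ (forall w, Ck1 4 Q w) /\ (forall w, Ck1 4 P w) /\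
  (rho < c -> forall w, w <= c ^ 2 -> Q w = 0 /\ P w = 0).

Lemma admissible_zero rho c Q P t : 0 <= rho -> admissible rho c Q P -> rho <= t < c ->
  let phi := radial_part Q in let psi := vertical_part P in
  phi t = 0 /\ Derive phi t = 0 /\ Derive (Derive phi) t = 0 /\
  psi t = 0 /\ Derive psi t = 0 /\ Derive (Derive psi) t = 0.
Proof.
  intros Hrho (Hc & Hc1 & HQ & HP & HZ) Ht phi psi.
  assert (Z : forall x, rho <= x <= c -> phi x = 0 /\ psi x = 0).
  { intros x Hx. destruct (HZ ltac:(lra) (x ^ 2)) as [A B]; [nra|].
    unfold phi, psi, radial_part, vertical_part. rewrite A B. split; ring. }
  assert (Step : forall f, (forall x, rho <= x <= c -> f x = 0) ->
     (forall x, is_derive f x (Derive f x)) -> forall x, rho <= x <= c -> Derive f x = 0).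
  { intros f F0 F1 x Hx.
    apply (is_derive_unique_on f (fun _ => 0) rho c x _ _); auto; try lra.
    apply @is_derive_const. }
  assert (Hphi : forall t, Ck1 4 phi t) by (intros; now apply radial_part_smooth).
  assert (Hpsi : forall t, Ck1 4 psi t) by (intros; now apply vertical_part_smooth).
  assert (A1 : forall x, rho <= x <= c -> Derive phi x = 0).
  { apply Step. intros; apply Z; auto. intros; apply (Ck1_Derive 3); auto. }
  assert (A2 : forall x, rho <= x <= c -> Derive psi x = 0).
  { apply Step. intros; apply Z; auto. intros; apply (Ck1_Derive 3); auto. }
  destruct (Z t ltac:(lra)) as [B1 B2].
  split; auto. split; [apply A1; lra|]. split.
  { apply (Step (Derive phi)); auto; try lra. intros; apply (Ck1_Derive 2). apply (Ck1_Derive 3); auto. }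
  split; auto. split; [apply A2; lra|].
  apply (Step (Derive psi)); auto; try lra. intros; apply (Ck1_Derive 2). apply (Ck1_Derive 3); auto.
Qed.

(** Small perturbations are again surfaces of revolution, so that [rev_energy]
    computes their energy. *)
Lemma perturb_small rho X e r z c Q P :
  revolution rho X e r (Derive r) (Derive (Derive r)) z (Derive z) (Derive (Derive z)) ->
  (forall t, rho <= t <= 1 -> Ck1 4 r t /\ Ck1 4 z t) ->
  admissible rho c Q P ->
  let phi := radial_part Q in let psi := vertical_part P in
  exists d : posreal, forall eps, Rabs eps < d ->
  (forall t, c <= t <= 1 -> 0 < e * (r t + eps * phi t)) /\
  (forall t, c <= t <= 1 ->
     0 < (Derive r t + eps * Derive phi t) ^ 2 + (Derive z t + eps * Derive psi t) ^ 2) /\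
  revolution rho (perturb X (axial_field Q P) eps) e
    (fun t => r t + eps * phi t) (fun t => Derive r t + eps * Derive phi t)
    (fun t => Derive (Derive r) t + eps * Derive (Derive phi) t)
    (fun t => z t + eps * psi t) (fun t => Derive z t + eps * Derive psi t)
    (fun t => Derive (Derive z) t + eps * Derive (Derive psi) t).
Proof.
  intros HR HK HA phi psi. pose proof HA as (Hc & Hc1 & HQ & HP & HZ).
  pose proof (rev_rho _ _ _ _ _ _ _ _ _ HR) as Hrho.
  assert (Hphi : forall t, Ck1 4 phi t) by (intros; now apply radial_part_smooth).
  assert (Hpsi : forall t, Ck1 4 psi t) by (intros; now apply vertical_part_smooth).
  assert (Cont : forall t, rho <= t <= 1 -> Ck1 3 (Derive r) t /\ Ck1 3 (Derive z) t /\
     Ck1 3 (Derive phi) t /\ Ck1 3 (Derive psi) t).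
  { intros t Ht. destruct (HK t Ht). repeat split; apply (Ck1_Derive 3); auto. }
  destruct (uniform_pos (fun t => e * r t) (fun t => e * phi t) c 1) as [da Ha]; try lra.
  { intros t Ht. apply (Ck1_continuous 4). apply Ck1_mult; [apply Ck1_const|]. apply HK; lra. }
  { intros t Ht. apply (Ck1_continuous 4). apply Ck1_mult; [apply Ck1_const|]. apply Hphi. }
  { intros t Ht. apply HR; lra. }
  destruct (uniform_pos (fun t => Derive r t * Derive r t + Derive z t * Derive z t)
     (fun t => 2 * (Derive r t * Derive phi t + Derive z t * Derive psi t)) c 1) as [db Hb]; try lra.
  { intros t Ht. destruct (Cont t ltac:(lra)) as (A & B & C & D). apply (Ck1_continuous 3).
    apply Ck1_plus; apply Ck1_mult; auto. }
  { intros t Ht. destruct (Cont t ltac:(lra)) as (A & B & C & D). apply (Ck1_continuous 3).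
    apply Ck1_mult; [apply Ck1_const|]. apply Ck1_plus; apply Ck1_mult; auto. }
  { intros t Ht. pose proof (rev_reg _ _ _ _ _ _ _ _ _ HR t ltac:(lra)). lra. }
  assert (Hd : 0 < Rmin da db) by (apply Rmin_glb_lt; apply cond_pos).
  exists (mkposreal _ Hd). simpl. intros eps Heps.
  pose proof (Rmin_l da db). pose proof (Rmin_r da db).
  assert (P1 : forall t, c <= t <= 1 -> 0 < e * (r t + eps * phi t)).
  { intros t Ht. pose proof (Ha eps t ltac:(lra) Ht). lra. }
  assert (P2 : forall t, c <= t <= 1 ->
     0 < (Derive r t + eps * Derive phi t) ^ 2 + (Derive z t + eps * Derive psi t) ^ 2).
  { intros t Ht. pose proof (Hb eps t ltac:(lra) Ht) as K.
    pose proof (pow2_ge_0 (eps * Derive phi t)). pose proof (pow2_ge_0 (eps * Derive psi t)). nra. }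
  split; auto. split; auto. apply perturb_revolution; auto; fold phi psi.
  - intros t Ht T. destruct (Rlt_dec t c) as [L|L]; [|apply P1; lra].
    destruct (admissible_zero rho c Q P t) as (E & _); auto; try lra.
    fold phi in E. rewrite E Rmult_0_r Rplus_0_r. apply HR; auto.
  - intros Z. destruct (admissible_zero rho c Q P 0) as (_ & E & _); auto; lra.
  - intros t Ht. destruct (Rlt_dec t c) as [L|L]; [|apply P2; lra].
    destruct (admissible_zero rho c Q P t) as (_ & E & _ & _ & E' & _); auto; try lra.
    fold phi in E. fold psi in E'. rewrite E E' !Rmult_0_r !Rplus_0_r. apply HR; auto.
Qed.

(** * First variation of the energy *)

Definition bending_along a co s e (r z phi psi : R -> R) (eps t : R) : R :=
  bending_density a co s e (r t + eps * phi t) (Derive r t + eps * Derive phi t)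
    (Derive (Derive r) t + eps * Derive (Derive phi) t)
    (Derive z t + eps * Derive psi t)
    (Derive (Derive z) t + eps * Derive (Derive psi) t).

Lemma bending_along_smooth a co s e r z phi psi eps t :
  Ck1 4 r t -> Ck1 4 z t -> Ck1 4 phi t -> Ck1 4 psi t ->
  r t + eps * phi t <> 0 ->
  0 < (Derive r t + eps * Derive phi t) ^ 2 + (Derive z t + eps * Derive psi t) ^ 2 ->
  Ck2 1 (bending_along a co s e r z phi psi) eps t.
Proof.
  intros Hr Hz Hphi Hpsi H0 Hq.
  assert (L : forall f g, Ck1 1 f t -> Ck1 1 g t -> Ck2 1 (fun x y => f y + x * g y) eps t).
  { intros f g A B. apply Ck2_plus; [now apply Ck1_lift2|].
    apply Ck2_mult; [apply Ck2_id1|now apply Ck1_lift2]. }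
  assert (D1 : forall f, Ck1 4 f t -> Ck1 1 f t /\ Ck1 1 (Derive f) t /\ Ck1 1 (Derive (Derive f)) t).
  { intros f A. pose proof (proj2 (Ck1_Derive 3 _ _ A)) as B. pose proof (proj2 (Ck1_Derive 2 _ _ B)) as C.
    split; [|split]; eapply Ck1_le; try eassumption; lia. }
  destruct (D1 _ Hr) as (R0 & R1 & R2). destruct (D1 _ Hz) as (Z0 & Z1 & Z2).
  destruct (D1 _ Hphi) as (F0 & F1 & F2). destruct (D1 _ Hpsi) as (G0 & G1 & G2).
  pose proof (L _ _ R0 F0). pose proof (L _ _ R1 F1). pose proof (L _ _ R2 F2).
  pose proof (L _ _ Z1 G1). pose proof (L _ _ Z2 G2).
  assert (Q : Ck2 1 (fun x y => sqrt ((Derive r y + x * Derive phi y) ^ 2 + (Derive z y + x * Derive psi y) ^ 2)) eps t).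
  { apply Ck2_sqrt; auto. apply Ck2_plus; apply Ck2_pow; auto. }
  pose proof (sqrt_lt_R0 _ Hq) as Hq'.
  unfold bending_along, bending_density, mean_curv_of, curv_meridian, curv_parallel.
  apply Ck2_mult.
  - apply Ck2_mult; [apply Ck2_const|]. apply Ck2_pow. apply Ck2_plus; [|apply Ck2_const].
    apply Ck2_mult; [apply Ck2_const|]. apply Ck2_plus.
    + apply Ck2_div; [apply pow_nonzero; lra| |apply Ck2_pow; auto].
      apply Ck2_minus; apply Ck2_mult; auto.
    + apply Ck2_div; auto; [|apply Ck2_mult; auto].
      apply Rmult_integral_contrapositive. split; auto. lra.
  - apply Ck2_mult; auto. apply Ck2_mult; auto. apply Ck2_const.
Qed.

(** The variation of [f ^ 2 q r], with [f = H + co], organised by the variation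
    [eta = (C psi' - S phi') / q] of the angle of the unit tangent [(C, S)] and by
    the variation [C phi' + S psi'] of the speed. *)
Definition variation_density co s r r1 r2 z1 z2 phi phi1 phi2 psi1 psi2 : R :=
  let q := sqrt (r1 ^ 2 + z1 ^ 2) in
  let C := r1 / q in let S := z1 / q in
  let H := mean_curv_of s r r1 r2 z1 z2 in let f := H + co in
  let eta := (r1 * psi1 - z1 * phi1) / (r1 ^ 2 + z1 ^ 2) in
  let eta1 := (r2 * psi1 + r1 * psi2 - z2 * phi1 - z1 * phi2) / (r1 ^ 2 + z1 ^ 2)
     - 2 * (r1 * psi1 - z1 * phi1) * (r1 * r2 + z1 * z2) / (r1 ^ 2 + z1 ^ 2) ^ 2 in
  s * f * r1 * eta + s * f * r * eta1
  + (s * f * S + f * (co - H) * r) * (C * phi1 + S * psi1)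
  + (f ^ 2 * q - s * f * q * S / r) * phi.

Definition mean_curv_variation s r r1 r2 z1 z2 phi phi1 phi2 psi1 psi2 : R :=
  let q := sqrt (r1 ^ 2 + z1 ^ 2) in
  let lambda := (r1 * phi1 + z1 * psi1) / q in
  s / 2 * ((phi1 * z2 + r1 * psi2 - psi1 * r2 - z1 * phi2) / q ^ 3
    - 3 * (r1 * z2 - z1 * r2) * lambda / q ^ 4
    + psi1 / (q * r) - z1 * lambda / (q ^ 2 * r) - z1 * phi / (q * r ^ 2)).

(** The identities [Ee] and [Ep] of the proof express that the tangent turns at
    the rate [eta] and stretches at the rate [lambda]. *)
Lemma variation_density_eq co s r r1 r2 z1 z2 phi phi1 phi2 psi1 psi2 :
  is_sign s -> r <> 0 -> 0 < r1 ^ 2 + z1 ^ 2 ->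
  let q := sqrt (r1 ^ 2 + z1 ^ 2) in
  let f := mean_curv_of s r r1 r2 z1 z2 + co in
  2 * f * mean_curv_variation s r r1 r2 z1 z2 phi phi1 phi2 psi1 psi2 * (r * q)
  + f ^ 2 * (phi * q + r * ((r1 * phi1 + z1 * psi1) / q))
  = variation_density co s r r1 r2 z1 z2 phi phi1 phi2 psi1 psi2.
Proof.
  intros Hs Hr Hq. cbv zeta. unfold variation_density, mean_curv_variation. cbv zeta.
  pose proof (sqrt_lt_R0 _ Hq) as Q. pose proof (sqrt_sqrt _ (Rlt_le _ _ Hq)) as QQ.
  set (q := sqrt (r1 ^ 2 + z1 ^ 2)) in *.
  assert (EH : mean_curv_of s r r1 r2 z1 z2 = s / 2 * ((r1 * z2 - z1 * r2) / q ^ 3 + z1 / (q * r))) by reflexivity.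
  set (H := mean_curv_of s r r1 r2 z1 z2) in *. set (f := H + co).
  replace (co - H) with (f - 2 * H) by (unfold f; ring).
  clearbody f. clearbody q H.
  assert (ZZ : z1 ^ 2 = q ^ 2 - r1 ^ 2) by lra.
  rewrite -QQ.
  pose proof (is_sign_sq s Hs) as S2.
  set (om := r1 * z2 - z1 * r2) in *.
  set (lambda := (r1 * phi1 + z1 * psi1) / q).
  set (eta := (r1 * psi1 - z1 * phi1) / (q * q)).
  assert (Ee : om * lambda / q = eta * (r1 * r2 + z1 * z2) - (r2 * psi1 - z2 * phi1)).
  { apply Rmult_eq_reg_r with (q ^ 2); [|apply pow_nonzero; lra].
    transitivity (om * (r1 * phi1 + z1 * psi1)); [unfold lambda; field; lra|].
    transitivity ((r1 * psi1 - z1 * phi1) * (r1 * r2 + z1 * z2) - q ^ 2 * (r2 * psi1 - z2 * phi1));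
      [|unfold eta; field; lra].
    replace (q ^ 2) with (r1 ^ 2 + z1 ^ 2) by lra. unfold om. ring. }
  assert (Ep : psi1 = r1 * eta + z1 * lambda / q).
  { apply Rmult_eq_reg_r with (q ^ 2); [|apply pow_nonzero; lra].
    transitivity (r1 * (r1 * psi1 - z1 * phi1) + z1 * (r1 * phi1 + z1 * psi1));
      [|unfold eta, lambda; field; lra].
    replace (q ^ 2) with (r1 ^ 2 + z1 ^ 2) by lra. ring. }
  set (Om1 := phi1 * z2 + r1 * psi2 - psi1 * r2 - z1 * phi2).
  transitivity (s * f * r * (Om1 / q ^ 2 - 3 * (om * lambda / q) / q ^ 2)
     + s * f * (psi1 - z1 * lambda / q - z1 * phi / r) + f ^ 2 * (phi * q + r * lambda)).
  { clearbody lambda om Om1. field. lra. }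
  transitivity (s * f * r1 * eta
    + s * f * r * ((Om1 + 2 * (r2 * psi1 - z2 * phi1) - 2 * eta * (r1 * r2 + z1 * z2)) / q ^ 2)
    + (s * f * (z1 / q) + f * f * r) * lambda
    - f * (s * (om / q ^ 3 + z1 / (q * r))) * r * lambda
    + (f ^ 2 * q - s * f * z1 / r) * phi).
  { replace (f * (s * (om / q ^ 3 + z1 / (q * r))) * r * lambda)
      with (f * s * r * (om * lambda / q) / q ^ 2 + f * s * (z1 * lambda / q))
      by (clearbody lambda om; field; lra).
    replace (psi1 - z1 * lambda / q) with (r1 * eta) by lra. rewrite Ee. clearbody eta lambda Om1. field. lra. }
  replace (s * (om / q ^ 3 + z1 / (q * r))) with (2 * H) by (rewrite EH; field; lra).
  replace ((r1 / q) * phi1 + (z1 / q) * psi1) with lambda by (unfold lambda; field; lra).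
  replace (2 * (r1 * psi1 - z1 * phi1) * (r1 * r2 + z1 * z2) / (q * q) ^ 2)
    with (2 * eta * (r1 * r2 + z1 * z2) / (q * q)) by (unfold eta; field; lra).
  clearbody lambda eta. unfold Om1. field. lra.
Qed.

Lemma bending_variation a co s e r r1 r2 z1 z2 phi phi1 phi2 psi1 psi2 :
  is_sign s -> r <> 0 -> 0 < r1 ^ 2 + z1 ^ 2 ->
  is_derive (fun eps => bending_density a co s e (r + eps * phi) (r1 + eps * phi1)
    (r2 + eps * phi2) (z1 + eps * psi1) (z2 + eps * psi2)) 0
   (a * e * variation_density co s r r1 r2 z1 z2 phi phi1 phi2 psi1 psi2).
Proof.
  intros Hs Hr Hq. rewrite -variation_density_eq; auto. cbv zeta.
  pose proof (sqrt_lt_R0 _ Hq) as Q.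
  set (q := sqrt (r1 ^ 2 + z1 ^ 2)) in *.
  set (qf := fun eps => sqrt ((r1 + eps * phi1) ^ 2 + (z1 + eps * psi1) ^ 2)).
  assert (E0 : qf 0 = q) by (unfold qf, q; f_equal; ring).
  assert (Dq : is_derive qf 0 ((r1 * phi1 + z1 * psi1) / q)).
  { unfold qf. auto_derive.
    - replace (_ + _) with (r1 ^ 2 + z1 ^ 2) by ring. auto.
    - replace ((r1 + 0 * phi1) * ((r1 + 0 * phi1) * 1) + (z1 + 0 * psi1) * ((z1 + 0 * psi1) * 1)) with (r1 ^ 2 + z1 ^ 2) by ring.
      fold q. field. lra. }
  set (Hf := fun eps => mean_curv_of s (r + eps * phi) (r1 + eps * phi1)
    (r2 + eps * phi2) (z1 + eps * psi1) (z2 + eps * psi2)).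
  assert (EH : Hf 0 = mean_curv_of s r r1 r2 z1 z2) by (unfold Hf; cbv beta; rewrite !Rmult_0_l !Rplus_0_r; auto).
  assert (DH : is_derive Hf 0 (mean_curv_variation s r r1 r2 z1 z2 phi phi1 phi2 psi1 psi2)).
  { apply (is_derive_ext (fun eps => s / 2 * (((r1 + eps * phi1) * (z2 + eps * psi2)
     - (z1 + eps * psi1) * (r2 + eps * phi2)) / qf eps ^ 3 + (z1 + eps * psi1) / (qf eps * (r + eps * phi)))));
     [reflexivity|].
    auto_derive; rewrite E0 ?Rmult_0_l ?Rplus_0_r.
    - repeat split; try (eexists; exact Dq).
      + repeat apply Rmult_integral_contrapositive_currified; lra.
      + apply Rmult_integral_contrapositive_currified; lra.
    - rewrite (is_derive_unique _ _ _ Dq). unfold mean_curv_variation. cbv zeta. fold q.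
      set (lambda := (r1 * phi1 + z1 * psi1) / q). clearbody q lambda. field. lra. }
  apply (is_derive_ext (fun eps => a * (Hf eps + co) ^ 2 * (e * (r + eps * phi) * qf eps))); [reflexivity|].
  clearbody Hf qf.
  auto_derive.
  - repeat split; eexists; eassumption.
  - rewrite (is_derive_unique _ _ _ Dq) (is_derive_unique _ _ _ DH) E0 EH. ring.
Qed.

(** ** Regularity at the pole *)

Definition slope (f : R -> R) (l t : R) : R :=
  match Req_EM_T t 0 with left _ => l | right _ => f t / t end.

Lemma slope_continuous f l : is_derive f 0 l -> f 0 = 0 -> continuous (slope f l) 0.
Proof.
  intros D F0. apply is_derive_Reals in D. apply continuity_pt_filterlim.
  intros eps Heps. destruct (D eps Heps) as [d Hd]. exists d. split; [apply cond_pos|].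
  intros x [_ Hx]. unfold Rdist in *. simpl in *. unfold Rdist in *. rewrite Rminus_0_r in Hx.
  unfold slope. destruct (Req_EM_T 0 0) as [_|N]; [|lra].
  destruct (Req_EM_T x 0) as [E|N].
  - rewrite Rminus_eq_0 Rabs_R0. auto.
  - specialize (Hd x N Hx). rewrite Rplus_0_l F0 Rminus_0_r in Hd. exact Hd.
Qed.

Lemma continuous_mult_R (f g : R -> R) t : continuous f t -> continuous g t ->
  continuous (fun x => f x * g x) t.
Proof. intros A B. apply (continuous_mult f g t); auto. Qed.

Lemma continuous_inv_R (f : R -> R) t : continuous f t -> f t <> 0 -> continuous (fun x => / f x) t.
Proof. intros A B. apply (continuous_Rinv_comp f t); auto. Qed.

(** At the pole the curvature along the parallel is a quotient of two functions
    that vanish there, with limit [z'' / r']; everywhere else it is an algebraic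
    expression in the profile. *)
Lemma mean_curv_profile rho X sigma e r z :
  revolution rho X e r (Derive r) (Derive (Derive r)) z (Derive z) (Derive (Derive z)) ->
  (forall t, rho <= t <= 1 -> Ck1 4 r t /\ Ck1 4 z t) ->
  exists Hb : R -> R,
    (forall t, rho <= t <= 1 -> continuous Hb t) /\
    (forall t th, rho <= t <= 1 -> mean_curv sigma X (t * cos th) (t * sin th) = Hb t) /\
    (forall t, rho <= t <= 1 -> 0 < t -> Hb t = mean_curv_of (sigma * e) (r t) (Derive r t)
       (Derive (Derive r) t) (Derive z t) (Derive (Derive z) t)).
Proof.
  intros HR HK. pose proof (rev_rho _ _ _ _ _ _ _ _ _ HR) as Hrho.
  set (r1 := Derive r) in *. set (r2 := Derive r1) in *.
  set (z1 := Derive z) in *. set (z2 := Derive z1) in *.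
  set (q := fun t => sqrt (r1 t ^ 2 + z1 t ^ 2)).
  assert (D1 : forall t, rho <= t <= 1 -> Ck1 2 r t /\ Ck1 2 r1 t /\ Ck1 2 r2 t /\ Ck1 2 z1 t /\ Ck1 2 z2 t).
  { intros t Ht. destruct (HK t Ht) as [A B].
    pose proof (proj2 (Ck1_Derive 3 _ _ A)) as A1. pose proof (proj2 (Ck1_Derive 2 _ _ A1)) as A2.
    pose proof (proj2 (Ck1_Derive 3 _ _ B)) as B1. pose proof (proj2 (Ck1_Derive 2 _ _ B1)) as B2.
    split; [apply Ck1_le with 4%nat; auto; lia|].
    split; [apply Ck1_le with 3%nat; auto; lia|]. split; auto.
    split; [apply Ck1_le with 3%nat; auto; lia|]. auto. }
  assert (Cq : forall t, rho <= t <= 1 -> Ck1 2 q t /\ 0 < q t).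
  { intros t Ht. destruct (D1 t Ht) as (A & B & C & D & E).
    pose proof (rev_reg _ _ _ _ _ _ _ _ _ HR t Ht) as Q. split.
    - apply Ck1_sqrt; auto. apply Ck1_plus; apply Ck1_pow; auto.
    - apply sqrt_lt_R0; auto. }
  set (kr := fun t => curv_meridian (r1 t) (r2 t) (z1 t) (z2 t)).
  set (kt := fun t => curv_parallel (r t) (r1 t) (z1 t)).
  assert (Ckr : forall t, rho <= t <= 1 -> continuous kr t).
  { intros t Ht. destruct (D1 t Ht) as (A & B & C & D & E). destruct (Cq t Ht) as [Q Q0].
    apply (Ck1_continuous 2). unfold kr, curv_meridian. apply Ck1_div.
    - apply pow_nonzero. unfold q in Q0. lra.
    - apply Ck1_minus; apply Ck1_mult; auto.
    - apply (Ck1_pow 2 q); auto. }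
  assert (Ckt : forall t, rho <= t <= 1 -> 0 < t -> continuous kt t).
  { intros t Ht T. destruct (D1 t Ht) as (A & B & C & D & E). destruct (Cq t Ht) as [Q Q0].
    pose proof (rev_pos _ _ _ _ _ _ _ _ _ HR t Ht T) as P.
    apply (Ck1_continuous 2). unfold kt, curv_parallel. apply Ck1_div; auto.
    - apply Rmult_integral_contrapositive. split.
      + unfold q in Q0. lra.
      + intros Z. rewrite Z in P. lra.
    - apply (Ck1_mult 2 q); auto. }
  set (kap := fun t => match Req_EM_T t 0 with left _ => kr 0 | right _ => kt t end).
  assert (Ek : forall t, t <> 0 -> kap t = kt t).
  { intros t N. unfold kap. destruct (Req_EM_T t 0); auto. contradiction. }
  assert (Ck : forall t, rho <= t <= 1 -> continuous kap t).
  { intros t Ht. destruct (Req_dec t 0) as [T|T].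
    - assert (R0 : rho = 0) by lra. subst t.
      destruct (D1 0 Ht) as (A & B & C & D & E). destruct (Cq 0 Ht) as [Q Q0].
      pose proof (rev_origin _ _ _ _ _ _ _ _ _ HR R0) as O.
      assert (O1 : r1 0 <> 0) by (intros Z; rewrite Z in O; lra).
      assert (HR0 := HR).
      destruct (rev_frame _ _ _ _ _ _ _ _ _ 0 0 HR Ht) as (k & Hk & K1 & K2 & _).
      destruct (K2 eq_refl) as [K3 Z10]. rewrite Rmult_0_l in K1.
      apply (continuous_ext (fun t => slope z1 (z2 0) t * / (q t * slope r (r1 0) t))).
      + intros t. as_real. unfold kap, slope. destruct (Req_EM_T t 0) as [T|T].
        * subst t. unfold kr, curv_meridian. fold (q 0). rewrite Z10.
          assert (QQ : q 0 * q 0 = r1 0 * r1 0).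
          { unfold q. rewrite sqrt_sqrt; [rewrite Z10; ring|]. rewrite Z10. nra. }
          transitivity (r1 0 * z2 0 / (q 0 * (r1 0 * r1 0))); [field; split; auto; lra|].
          rewrite -QQ. field. lra.
        * unfold kt, curv_parallel. fold (q t). destruct (Req_dec (r t) 0) as [Z|Z].
          { rewrite Z. unfold Rdiv. rewrite !Rmult_0_l !Rmult_0_r Rinv_0. ring. }
          destruct (Req_dec (q t) 0) as [Z'|Z'].
          { rewrite Z'. unfold Rdiv. rewrite !Rmult_0_l Rinv_0. ring. }
          field. auto.
      + apply continuous_mult_R.
        * apply slope_continuous; auto. apply (Ck1_Derive 2). apply (Ck1_Derive 3). apply HK; auto.
        * apply continuous_inv_R.
          -- apply continuous_mult_R. apply (Ck1_continuous 2); auto.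
             apply slope_continuous; auto. apply (Ck1_Derive 3). apply HK; auto.
          -- unfold slope. destruct (Req_EM_T 0 0); [|lra].
             apply Rmult_integral_contrapositive. split; auto. lra.
    - apply (continuous_ext_loc (U := R_UniformSpace) kap kt t).
      + apply: filter_imp (locally_neq0 t T). intros x Hx. as_real. symmetry. now apply Ek.
      + apply Ckt; lra. }
  exists (fun t => sigma * e / 2 * (kr t + kap t)). repeat split.
  - intros t Ht. apply continuous_mult_R; [apply continuous_const|].
    apply (continuous_plus kr kap); auto.
  - intros t th Ht.
    destruct (rev_mean_curv_aux rho X sigma e r r1 r2 z z1 z2 t th HR Ht) as (k & A & B & C).
    rewrite C. unfold kr at 1. do 2 f_equal. destruct (Req_dec t 0) as [T|T].
    + rewrite B; auto. unfold kap. destruct (Req_EM_T t 0); [reflexivity|contradiction].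
    + rewrite Ek; auto. apply Rmult_eq_reg_l with t; auto.
  - intros t Ht T. rewrite Ek; [reflexivity|lra].
Qed.

Lemma bending_integrable rho X sigma e r z a co :
  revolution rho X e r (Derive r) (Derive (Derive r)) z (Derive z) (Derive (Derive z)) ->
  (forall t, rho <= t <= 1 -> Ck1 4 r t /\ Ck1 4 z t) ->
  ex_RInt (fun t => 2 * PI * bending_density a co (sigma * e) e (r t) (Derive r t)
     (Derive (Derive r) t) (Derive z t) (Derive (Derive z) t)) rho 1.
Proof.
  intros HR HK. pose proof (rev_rho _ _ _ _ _ _ _ _ _ HR) as Hrho.
  destruct (mean_curv_profile rho X sigma e r z HR HK) as (Hb & C & _ & E).
  apply (ex_RInt_ext (fun t => 2 * PI * (a * ((Hb t + co) * (Hb t + co)) * (e * r t * sqrt (Derive r t ^ 2 + Derive z t ^ 2))))).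
  - rewrite Rmin_left ?Rmax_right; try lra. intros t Ht. unfold bending_density. rewrite E; [|lra|lra].
    as_real. ring.
  - apply (ex_RInt_continuous (V := R_CompleteNormedModule)). rewrite Rmin_left ?Rmax_right; try lra.
    intros t Ht. specialize (C t Ht).
    assert (Ch : continuous (fun t => Hb t + co) t).
    { apply (continuous_plus Hb (fun _ => co)); auto. apply continuous_const. }
    apply continuous_mult_R; [apply continuous_const|]. apply continuous_mult_R.
    + apply continuous_mult_R; [apply continuous_const|]. now apply continuous_mult_R.
    + apply continuous_mult_R.
      { apply continuous_mult_R; [apply continuous_const|]. apply (Ck1_continuous 4). apply HK; auto. }
      apply (Ck1_continuous 3). destruct (HK t Ht) as [A B]. apply Ck1_sqrt; [apply HR; auto|].
      apply Ck1_plus; apply Ck1_pow; apply (Ck1_Derive 3); auto.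
Qed.

(** ** Differentiation of the energy *)

(** Beyond the radius [c] the integrand is smooth in [(eps, t)] and one
    differentiates under the integral.  Below [c] it does not depend on [eps], but
    it has to be integrable up to the pole for that part of the energy to be split
    off as a constant. *)
Lemma first_variation a alpha beta co rho sigma X e r z c Q P :
  is_sign sigma ->
  revolution rho X e r (Derive r) (Derive (Derive r)) z (Derive z) (Derive (Derive z)) ->
  (forall t, rho <= t <= 1 -> Ck1 4 r t /\ Ck1 4 z t) ->
  admissible rho c Q P ->
  let phi := radial_part Q in let psi := vertical_part P in
  critical rho sigma a co 0 alpha beta X ->
  a * RInt (fun t => variation_density co (sigma * e) (r t) (Derive r t) (Derive (Derive r) t)
      (Derive z t) (Derive (Derive z) t) (phi t) (Derive phi t) (Derive (Derive phi) t)
      (Derive psi t) (Derive (Derive psi) t)) c 1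
  + ((beta - alpha / r 1 ^ 2) * phi 1 + on_inner rho ((beta - alpha / r rho ^ 2) * phi rho)) = 0.
Proof.
  intros Hs HR HK HA phi psi Hcrit.
  pose proof HA as (Hc & Hc1 & HQ & HP & HZ).
  pose proof (rev_rho _ _ _ _ _ _ _ _ _ HR) as Hrho.
  pose proof (rev_sign _ _ _ _ _ _ _ _ _ HR) as He.
  assert (Hphi : forall t, Ck1 4 phi t) by (intros; now apply radial_part_smooth).
  assert (Hpsi : forall t, Ck1 4 psi t) by (intros; now apply vertical_part_smooth).
  destruct (perturb_small rho X e r z c Q P HR HK HA) as (d & Hd). fold phi psi in Hd.
  specialize (Hcrit (axial_field Q P) (axial_field_C4 rho Q P HQ HP)).
  set (s := sigma * e) in *.
  set (F := bending_along a co s e r z phi psi).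
  set (VD := fun t => variation_density co s (r t) (Derive r t) (Derive (Derive r) t)
      (Derive z t) (Derive (Derive z) t) (phi t) (Derive phi t) (Derive (Derive phi) t)
      (Derive psi t) (Derive (Derive psi) t)).
  assert (Sm : forall eps t, Rabs eps < d -> c <= t <= 1 -> Ck2 1 F eps t).
  { intros eps t Heps Ht. destruct (Hd eps Heps) as (A & B & _). destruct (HK t ltac:(lra)).
    apply bending_along_smooth; auto. intros E. pose proof (A t Ht) as P'. rewrite E in P'. lra. }
  assert (Hloc : locally 0 (fun eps => Rabs eps < d)).
  { exists d. intros eps H. unfold ball in H; simpl in H.
    unfold AbsRing_ball, abs, minus, plus, opp in H; simpl in H.
    rewrite Ropp_0 Rplus_0_r in H. exact H. }
  assert (Hd0 : Rabs 0 < d) by (rewrite Rabs_R0; apply cond_pos).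
  assert (I1 : forall eps, Rabs eps < d -> ex_RInt (F eps) c 1).
  { intros eps Heps. apply (ex_RInt_continuous (V := R_CompleteNormedModule)).
    rewrite Rmin_left ?Rmax_right; try lra. intros t Ht. apply (Ck2_continuous_y 1). apply Sm; auto. }
  assert (DI : is_derive (fun eps => RInt (F eps) c 1) 0 (RInt (fun t => Derive (fun u => F u t) 0) c 1)).
  { apply is_derive_RInt_param.
    - apply: filter_imp Hloc. intros eps Heps. rewrite Rmin_left ?Rmax_right; try lra. intros t Ht.
      exists (dx F eps t). exact (proj1 (Ck2_is_derive 0 F eps t (Sm eps t Heps Ht))).
    - rewrite Rmin_left ?Rmax_right; try lra. intros t Ht.
      apply (Ck2_cont_pt 0). apply (Ck2_dx 0 F). apply Sm; auto.
    - apply: filter_imp Hloc. exact I1. }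
  assert (EI : RInt (fun t => Derive (fun u => F u t) 0) c 1 = a * e * RInt VD c 1).
  { transitivity (RInt (fun t => scal (a * e) (VD t)) c 1).
    - apply RInt_ext. rewrite Rmin_left ?Rmax_right; try lra. intros t Ht.
      apply is_derive_unique. apply bending_variation.
      + apply is_sign_mult; auto.
      + pose proof (rev_pos _ _ _ _ _ _ _ _ _ HR t ltac:(lra) ltac:(lra)) as K. intros E; rewrite E in K; lra.
      + apply HR; lra.
    - assert (a0 : ex_RInt (fun t => Derive (fun u => F u t) 0) c 1).
      { apply (ex_RInt_continuous (V := R_CompleteNormedModule)).
        rewrite Rmin_left ?Rmax_right; try lra. intros t Ht.
        apply (Ck2_continuous_y 0 (dx F)). apply Ck2_dx. apply Sm; auto. }
      destruct (Req_dec a 0) as [Za|Na].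
      + rewrite Za Rmult_0_l Rmult_0_l. transitivity (RInt (fun _ => 0) c 1).
        * apply RInt_ext. intros; unfold scal; simpl; unfold mult; simpl. as_real; ring.
        * rewrite RInt_const. unfold scal; simpl; unfold mult; simpl. as_real; ring.
      + rewrite RInt_scal; [reflexivity|].
        assert (Ne : e <> 0) by (destruct He; lra).
        apply (ex_RInt_ext (fun t => scal (/ (a * e)) (Derive (fun u => F u t) 0))).
        * rewrite Rmin_left ?Rmax_right; try lra. intros t Ht.
          assert (ED : Derive (fun u => F u t) 0 = a * e * VD t).
          { apply is_derive_unique. apply bending_variation.
            + apply is_sign_mult; auto.
            + pose proof (rev_pos _ _ _ _ _ _ _ _ _ HR t ltac:(lra) ltac:(lra)) as K. intros E; rewrite E in K; lra.
            + apply HR; lra. }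
          rewrite ED. unfold scal; simpl; unfold mult; simpl. as_real; field; auto.
        * exact (ex_RInt_scal (fun t => Derive (fun u => F u t) 0) c 1 (/ (a * e)) a0). }
  set (K0 := RInt (fun t => 2 * PI * F 0 t) rho c).
  assert (IX : ex_RInt (fun t => 2 * PI * F 0 t) rho 1).
  { apply (ex_RInt_ext (fun t => 2 * PI * bending_density a co s e (r t) (Derive r t)
     (Derive (Derive r) t) (Derive z t) (Derive (Derive z) t))).
    - intros t _. unfold F, bending_along. rewrite !Rmult_0_l !Rplus_0_r. reflexivity.
    - apply (bending_integrable rho X sigma e r z); auto. }
  assert (IX0 : ex_RInt (fun t => 2 * PI * F 0 t) rho c).
  { apply (ex_RInt_Chasles_1 (V := R_CompleteNormedModule) _ rho c 1); auto. lra. }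
  set (Bd := fun eps => circle_energy alpha beta (e * (r 1 + eps * phi 1))
      + on_inner rho (circle_energy alpha beta (e * (r rho + eps * phi rho)))).
  assert (EE : forall eps, Rabs eps < d -> energy rho sigma a co 0 alpha beta (perturb X (axial_field Q P) eps)
     = K0 + 2 * PI * RInt (F eps) c 1 + 2 * PI * Bd eps).
  { intros eps Heps. destruct (Hd eps Heps) as (_ & _ & HRe).
    rewrite (rev_energy rho _ sigma e _ _ _ _ _ _ a co alpha beta HRe Hs). fold s.
    change (RInt (fun t => 2 * PI * F eps t) rho 1 + 2 * PI * Bd eps = K0 + 2 * PI * RInt (F eps) c 1 + 2 * PI * Bd eps).
    f_equal.
    assert (Ext : forall t, rho < t < c -> 2 * PI * F 0 t = 2 * PI * F eps t).
    { intros t Ht. destruct (admissible_zero rho c Q P t) as (A1 & A2 & A3 & A4 & A5 & A6); auto; try lra.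
      fold phi psi in A1, A2, A3, A4, A5, A6.
      unfold F, bending_along. rewrite A1 A2 A3 A5 A6 !Rmult_0_r. reflexivity. }
    rewrite -(RInt_Chasles _ rho c 1).
    - unfold plus; simpl. f_equal.
      + unfold K0. symmetry. apply RInt_ext. rewrite Rmin_left ?Rmax_right; try lra. exact Ext.
      + apply (RInt_scal (F eps) c 1 (2 * PI)). auto.
    - apply (ex_RInt_ext (fun t => 2 * PI * F 0 t)); auto.
      rewrite Rmin_left ?Rmax_right; try lra. exact Ext.
    - apply (ex_RInt_scal (F eps) c 1 (2 * PI)). auto. }
  assert (Dc : forall t, rho <= t <= 1 -> 0 < t ->
     is_derive (fun eps => circle_energy alpha beta (e * (r t + eps * phi t))) 0
       (e * ((beta - alpha / r t ^ 2) * phi t))).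
  { intros t Ht T. pose proof (rev_pos _ _ _ _ _ _ _ _ _ HR t Ht T) as K.
    assert (N : r t <> 0) by (intros E; rewrite E in K; lra).
    assert (Ne : e <> 0) by (destruct He; lra).
    unfold circle_energy. auto_derive.
    - rewrite Rmult_0_l Rplus_0_r. lra.
    - rewrite Rmult_0_l Rplus_0_r. pose proof (is_sign_sq e He) as E2.
      transitivity ((e * beta - (e * alpha) / (e * e) / (r t) ^ 2) * phi t); [field; auto|].
      rewrite E2. field. auto. }
  assert (DB : is_derive Bd 0 (e * ((beta - alpha / r 1 ^ 2) * phi 1 + on_inner rho ((beta - alpha / r rho ^ 2) * phi rho)))).
  { rewrite Rmult_plus_distr_l. apply: is_derive_plus.
    - apply Dc; lra.
    - unfold on_inner. destruct (Rlt_dec 0 rho).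
      + apply Dc; lra.
      + rewrite Rmult_0_r. apply @is_derive_const. }
  set (tot := e * ((beta - alpha / r 1 ^ 2) * phi 1 + on_inner rho ((beta - alpha / r rho ^ 2) * phi rho))) in *.
  assert (DE : is_derive (fun eps => energy rho sigma a co 0 alpha beta (perturb X (axial_field Q P) eps)) 0
     (2 * PI * (a * e * RInt VD c 1) + 2 * PI * tot)).
  { apply (is_derive_ext_loc (fun eps => K0 + 2 * PI * RInt (F eps) c 1 + 2 * PI * Bd eps)).
    - apply: filter_imp Hloc. intros eps Heps. symmetry. apply EE; auto.
    - apply: is_derive_plus.
      + replace (2 * PI * (a * e * RInt VD c 1)) with (0 + 2 * PI * (a * e * RInt VD c 1)) by ring.
        apply: is_derive_plus; [apply @is_derive_const|].
        apply: is_derive_scal. rewrite -EI. exact DI.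
      + apply: is_derive_scal. exact DB. }
  apply is_derive_unique in DE. apply is_derive_unique in Hcrit.
  change (Derive (fun eps => energy rho sigma a co 0 alpha beta (perturb X (axial_field Q P) eps)) 0 = 0) in Hcrit.
  rewrite DE in Hcrit. unfold tot in Hcrit. fold VD.
  assert (Ne : e <> 0) by (destruct He; lra).
  pose proof PI_RGT_0.
  apply Rmult_eq_reg_l with (2 * PI * e).
  - rewrite Rmult_0_r -Hcrit. ring.
  - apply Rmult_integral_contrapositive_currified; auto. lra.
Qed.

(** * The Euler-Lagrange equations of the profile *)

Definition prof_speed (r z : R -> R) t : R := sqrt (Derive r t ^ 2 + Derive z t ^ 2).
Definition tan_r (r z : R -> R) t : R := Derive r t / prof_speed r z t.
Definition tan_z (r z : R -> R) t : R := Derive z t / prof_speed r z t.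
Definition prof_turn (r z : R -> R) t : R :=
  turn (Derive r t) (Derive (Derive r) t) (Derive z t) (Derive (Derive z) t).
Definition prof_H s (r z : R -> R) t : R :=
  mean_curv_of s (r t) (Derive r t) (Derive (Derive r) t) (Derive z t) (Derive (Derive z) t).
Definition prof_f s co r z t : R := prof_H s r z t + co.
(** [(mom_r, mom_z)], of normal component [mom_nor] and tangential component
    [mom_tan], is the force transmitted across a parallel of the surface.  Its
    vertical component is conserved because the energy is invariant under vertical
    translations. *)
Definition mom_nor s co r z t : R := s * r t * Derive (prof_f s co r z) t / prof_speed r z t.
Definition mom_tan s co r z t : R :=
  s * prof_f s co r z t * tan_z r z t + prof_f s co r z t * (co - prof_H s r z t) * r t.
Definition mom_r s co r z t : R := mom_nor s co r z t * tan_z r z t + mom_tan s co r z t * tan_r r z t.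
Definition mom_z s co r z t : R := - mom_nor s co r z t * tan_r r z t + mom_tan s co r z t * tan_z r z t.
Definition force_r s co r z t : R :=
  prof_f s co r z t ^ 2 * prof_speed r z t - s * prof_f s co r z t * prof_speed r z t * tan_z r z t / r t.
(** First variation of the angle of the tangent. *)
Definition tilt (r z phi psi : R -> R) t : R :=
  (Derive r t * Derive psi t - Derive z t * Derive phi t) / (Derive r t ^ 2 + Derive z t ^ 2).
Definition flux s co r z phi psi t : R :=
  s * prof_f s co r z t * r t * tilt r z phi psi t + mom_r s co r z t * phi t + mom_z s co r z t * psi t.

Definition regular_at (r z : R -> R) t : Prop :=
  Ck1 4 r t /\ Ck1 4 z t /\ r t <> 0 /\ 0 < Derive r t ^ 2 + Derive z t ^ 2.

Lemma Ck1_jets f t : Ck1 4 f t ->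
  Ck1 3 (Derive f) t /\ Ck1 2 (Derive (Derive f)) t.
Proof.
  intros A. pose proof (proj2 (Ck1_Derive 3 _ _ A)) as B.
  split; auto. apply (Ck1_Derive 2 _ _ B).
Qed.

Lemma prof_speed_pos r z t : regular_at r z t -> 0 < prof_speed r z t.
Proof. intros (_ & _ & _ & H). now apply sqrt_lt_R0. Qed.

Lemma prof_speed_smooth r z t : regular_at r z t -> Ck1 3 (prof_speed r z) t.
Proof.
  intros (A & B & C & D). destruct (Ck1_jets _ _ A) as [A1 _]. destruct (Ck1_jets _ _ B) as [B1 _].
  apply Ck1_sqrt; auto. apply Ck1_plus; apply Ck1_pow; auto.
Qed.

Lemma tan_r_smooth r z t : regular_at r z t -> Ck1 3 (tan_r r z) t.
Proof.
  intros H. pose proof (prof_speed_pos _ _ _ H) as Q. pose proof (prof_speed_smooth _ _ _ H) as Cq.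
  destruct H as (A & B & _ & _). destruct (Ck1_jets _ _ A) as [A1 _]. destruct (Ck1_jets _ _ B) as [B1 _].
  apply Ck1_div; auto. lra.
Qed.

Lemma tan_z_smooth r z t : regular_at r z t -> Ck1 3 (tan_z r z) t.
Proof.
  intros H. pose proof (prof_speed_pos _ _ _ H) as Q. pose proof (prof_speed_smooth _ _ _ H) as Cq.
  destruct H as (A & B & _ & _). destruct (Ck1_jets _ _ A) as [A1 _]. destruct (Ck1_jets _ _ B) as [B1 _].
  apply Ck1_div; auto. lra.
Qed.

Lemma prof_H_smooth s r z t : regular_at r z t -> Ck1 2 (prof_H s r z) t.
Proof.
  intros H. pose proof (prof_speed_pos _ _ _ H) as Q. pose proof (prof_speed_smooth _ _ _ H) as Cq.
  destruct H as (A & B & C & D). destruct (Ck1_jets _ _ A) as [A1 A2]. destruct (Ck1_jets _ _ B) as [B1 B2].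
  pose proof (Ck1_pred _ _ _ Cq). pose proof (Ck1_pred _ _ _ A1). pose proof (Ck1_pred _ _ _ B1).
  assert (prof_speed r z t <> 0) by lra.
  apply Ck1_mult; [apply Ck1_const|]. apply Ck1_plus.
  - apply Ck1_div.
    + apply pow_nonzero; auto.
    + apply Ck1_minus; apply Ck1_mult; auto.
    + apply (Ck1_pow 2 (prof_speed r z)); auto.
  - apply Ck1_div; [|auto|].
    + apply Rmult_integral_contrapositive; split; auto.
    + apply (Ck1_mult 2 (prof_speed r z)); auto. apply Ck1_le with 4%nat; auto.
Qed.

Lemma prof_f_smooth s co r z t : regular_at r z t -> Ck1 2 (prof_f s co r z) t.
Proof. intros H. apply Ck1_plus; [now apply prof_H_smooth|apply Ck1_const]. Qed.

Lemma mom_nor_smooth s co r z t : regular_at r z t -> Ck1 1 (mom_nor s co r z) t.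
Proof.
  intros H. pose proof (prof_speed_pos _ _ _ H) as Q. apply Ck1_div; [lra| |].
  - apply Ck1_mult; [apply Ck1_mult; [apply Ck1_const|]|].
    + apply Ck1_le with 4%nat; [lia|apply H].
    + apply (Ck1_Derive 1). now apply prof_f_smooth.
  - apply Ck1_le with 3%nat; [lia|now apply prof_speed_smooth].
Qed.

Lemma mom_tan_smooth s co r z t : regular_at r z t -> Ck1 1 (mom_tan s co r z) t.
Proof.
  intros H.
  assert (F : Ck1 1 (prof_f s co r z) t) by (apply Ck1_pred, prof_f_smooth; auto).
  assert (HH : Ck1 1 (prof_H s r z) t) by (apply Ck1_pred, prof_H_smooth; auto).
  assert (S : Ck1 1 (tan_z r z) t) by (apply Ck1_le with 3%nat; [lia|now apply tan_z_smooth]).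
  assert (Hr : Ck1 1 r t) by (apply Ck1_le with 4%nat; [lia|apply H]).
  apply Ck1_plus.
  - apply Ck1_mult; auto. apply Ck1_mult; auto using Ck1_const.
  - apply Ck1_mult; auto. apply Ck1_mult; auto. apply Ck1_minus; auto using Ck1_const.
Qed.

Lemma mom_r_smooth s co r z t : regular_at r z t -> Ck1 1 (mom_r s co r z) t.
Proof.
  intros H. apply Ck1_plus; apply Ck1_mult; auto using mom_nor_smooth, mom_tan_smooth.
  - apply Ck1_le with 3%nat; [lia|now apply tan_z_smooth].
  - apply Ck1_le with 3%nat; [lia|now apply tan_r_smooth].
Qed.

Lemma mom_z_smooth s co r z t : regular_at r z t -> Ck1 1 (mom_z s co r z) t.
Proof.
  intros H. apply Ck1_plus; apply Ck1_mult; auto using Ck1_neg, mom_nor_smooth, mom_tan_smooth.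
  - apply Ck1_le with 3%nat; [lia|now apply tan_r_smooth].
  - apply Ck1_le with 3%nat; [lia|now apply tan_z_smooth].
Qed.

Lemma force_r_smooth s co r z t : regular_at r z t -> Ck1 1 (force_r s co r z) t.
Proof.
  intros H.
  assert (F : Ck1 1 (prof_f s co r z) t) by (apply Ck1_pred, prof_f_smooth; auto).
  assert (S : Ck1 1 (tan_z r z) t) by (apply Ck1_le with 3%nat; [lia|now apply tan_z_smooth]).
  assert (Hr : Ck1 1 r t) by (apply Ck1_le with 4%nat; [lia|apply H]).
  assert (Q : Ck1 1 (prof_speed r z) t) by (apply Ck1_le with 3%nat; [lia|now apply prof_speed_smooth]).
  apply Ck1_minus.
  - apply Ck1_mult; auto. apply Ck1_pow; auto.
  - apply Ck1_div; auto. apply H. apply Ck1_mult; auto. apply Ck1_mult; auto. apply Ck1_mult; auto using Ck1_const.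
Qed.

(** Integration by parts.  Integrating [s f r eta'] leaves [- s f' r eta], which
    is a combination of [phi'] and [psi'] with coefficients [mom_nor] times the
    unit normal.  Together with the tangential coefficients they make up the
    momentum, and one more integration leaves only [phi] and [psi]. *)
Lemma flux_derive s co r z phi psi t : is_sign s -> regular_at r z t -> Ck1 4 phi t -> Ck1 4 psi t ->
  is_derive (flux s co r z phi psi) t
    (variation_density co s (r t) (Derive r t) (Derive (Derive r) t)
      (Derive z t) (Derive (Derive z) t) (phi t) (Derive phi t) (Derive (Derive phi) t)
      (Derive psi t) (Derive (Derive psi) t)
     + (Derive (mom_r s co r z) t - force_r s co r z t) * phi t + Derive (mom_z s co r z) t * psi t).
Proof.
  intros Hs H Hphi Hpsi.
  pose proof (prof_speed_pos _ _ _ H) as Q.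
  pose proof H as (Hr & Hz & Hr0 & Hreg).
  destruct (Ck1_Derive 1 _ _ (prof_f_smooth s co _ _ _ H)) as [DF _].
  destruct (Ck1_Derive 0 _ _ (mom_r_smooth s co _ _ _ H)) as [DA _].
  destruct (Ck1_Derive 0 _ _ (mom_z_smooth s co _ _ _ H)) as [DB _].
  destruct (Ck1_Derive 3 _ _ Hr) as [Dr Hr1]. destruct (Ck1_Derive 2 _ _ Hr1) as [Dr1 _].
  destruct (Ck1_Derive 3 _ _ Hz) as [Dz Hz1]. destruct (Ck1_Derive 2 _ _ Hz1) as [Dz1 _].
  destruct (Ck1_Derive 3 _ _ Hphi) as [Dphi Hphi1]. destruct (Ck1_Derive 2 _ _ Hphi1) as [Dphi1 _].
  destruct (Ck1_Derive 3 _ _ Hpsi) as [Dpsi Hpsi1]. destruct (Ck1_Derive 2 _ _ Hpsi1) as [Dpsi1 _].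
  assert (EF : s * r t * Derive (prof_f s co r z) t = mom_nor s co r z t * prof_speed r z t).
  { unfold mom_nor. field. lra. }
  set (f := prof_f s co r z) in *. set (A := mom_r s co r z) in *. set (B := mom_z s co r z) in *.
  set (r1 := Derive r) in *. set (r2 := Derive r1) in *. set (z1 := Derive z) in *. set (z2 := Derive z1) in *.
  set (phi1 := Derive phi) in *. set (phi2 := Derive phi1) in *.
  set (psi1 := Derive psi) in *. set (psi2 := Derive psi1) in *.
  assert (Deta : is_derive (tilt r z phi psi) t
    ((r2 t * psi1 t + r1 t * psi2 t - z2 t * phi1 t - z1 t * phi2 t) / (r1 t ^ 2 + z1 t ^ 2)
     - 2 * (r1 t * psi1 t - z1 t * phi1 t) * (r1 t * r2 t + z1 t * z2 t) / (r1 t ^ 2 + z1 t ^ 2) ^ 2)).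
  { unfold tilt. fold r1 z1 phi1 psi1. auto_derive.
    - repeat split; try (eexists; eassumption). simpl in *; lra.
    - rewrite (is_derive_unique _ _ _ Dr1) (is_derive_unique _ _ _ Dz1)
       (is_derive_unique _ _ _ Dphi1) (is_derive_unique _ _ _ Dpsi1). field. lra. }
  unfold flux. fold f A B.
  set (eta := tilt r z phi psi) in *.
  evar (l : R). assert (K : is_derive (fun t => s * f t * r t * eta t + A t * phi t + B t * psi t) t l).
  { unfold l. auto_derive.
    - repeat split; try (eexists; eassumption).
    - reflexivity. }
  replace (_ + _ * phi t + _) with l; auto. unfold l.
  rewrite (is_derive_unique _ _ _ Dr) (is_derive_unique _ _ _ Deta) (is_derive_unique _ _ _ Dphi) (is_derive_unique _ _ _ Dpsi).
  rewrite (is_derive_unique _ _ _ DF) (is_derive_unique _ _ _ DA) (is_derive_unique _ _ _ DB).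
  unfold variation_density. change (mean_curv_of s (r t) (r1 t) (r2 t) (z1 t) (z2 t)) with (prof_H s r z t).
  change (sqrt (r1 t ^ 2 + z1 t ^ 2)) with (prof_speed r z t). change (prof_H s r z t + co) with (f t).
  change (r1 t / prof_speed r z t) with (tan_r r z t). change (z1 t / prof_speed r z t) with (tan_z r z t).
  change ((r1 t * psi1 t - z1 t * phi1 t) / (r1 t ^ 2 + z1 t ^ 2)) with (eta t).
  set (eta1 := _ / (r1 t ^ 2 + z1 t ^ 2) - _ / _).
  change (A t) with (mom_nor s co r z t * tan_z r z t + mom_tan s co r z t * tan_r r z t).
  change (B t) with (- mom_nor s co r z t * tan_r r z t + mom_tan s co r z t * tan_z r z t).
  unfold force_r, mom_tan. fold f.
  assert (EEta : mom_nor s co r z t * tan_z r z t * phi1 t - mom_nor s co r z t * tan_r r z t * psi1 t = - (s * r t * Derive f t) * eta t).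
  { rewrite EF. unfold eta, tilt, tan_z, tan_r. fold r1 z1 phi1 psi1.
    assert (QQ : r1 t ^ 2 + z1 t ^ 2 = prof_speed r z t * prof_speed r z t) by (symmetry; apply sqrt_sqrt; apply Rlt_le; exact Hreg).
    rewrite QQ. field. lra. }
  set (p := mom_nor s co r z t) in *.
  replace (- (s * r t * Derive f t) * eta t) with (- (s * Derive f t * r t * eta t)) in EEta by ring.
  clearbody eta1 f A B r2 z2 eta p.
  set (W := s * Derive f t * r t * eta t) in *.
  transitivity (W + s * f t * (r1 t * eta t) + s * f t * r t * eta1
    + (s * f t * tan_z r z t + f t * (co - prof_H s r z t) * r t) * (tan_r r z t * phi1 t + tan_z r z t * psi1 t)
    + (p * tan_z r z t * phi1 t - p * tan_r r z t * psi1 t) + Derive A t * phi t + Derive B t * psi t).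
  { unfold W. ring. }
  rewrite EEta. ring.
Qed.

Definition EL_r s co r z t : R := Derive (mom_r s co r z) t - force_r s co r z t.
Definition EL_z s co r z t : R := Derive (mom_z s co r z) t.

Lemma EL_continuous s co r z t : regular_at r z t -> continuous (EL_r s co r z) t /\ continuous (EL_z s co r z) t.
Proof.
  intros H. split.
  - apply (Ck1_continuous 0). apply Ck1_minus.
    + apply (Ck1_Derive 0 (mom_r s co r z)). now apply mom_r_smooth.
    + apply Ck1_pred. now apply force_r_smooth.
  - apply (Ck1_continuous 0). apply (Ck1_Derive 0 (mom_z s co r z)). now apply mom_z_smooth.
Qed.

Lemma flux_smooth s co r z phi psi t : regular_at r z t -> Ck1 4 phi t -> Ck1 4 psi t ->
  Ck1 1 (flux s co r z phi psi) t.
Proof.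
  intros H Hphi Hpsi.
  assert (F : Ck1 1 (prof_f s co r z) t) by (apply Ck1_pred, prof_f_smooth; auto).
  assert (Hr : Ck1 1 r t) by (apply Ck1_le with 4%nat; [lia|apply H]).
  assert (HA := mom_r_smooth s co r z t H). assert (HB := mom_z_smooth s co r z t H).
  assert (Eta : Ck1 1 (tilt r z phi psi) t).
  { destruct H as (A & B & C & D).
    pose proof (proj1 (Ck1_jets _ _ A)) as A1. pose proof (proj1 (Ck1_jets _ _ B)) as B1.
    pose proof (proj1 (Ck1_jets _ _ Hphi)) as F1. pose proof (proj1 (Ck1_jets _ _ Hpsi)) as G1.
    apply Ck1_le with 3%nat; [lia|]. apply Ck1_div; [lra| |].
    - apply Ck1_minus; apply Ck1_mult; auto.
    - apply Ck1_plus; apply Ck1_pow; auto. }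
  assert (Ck1 1 phi t) by (apply Ck1_le with 4%nat; [lia|auto]).
  assert (Ck1 1 psi t) by (apply Ck1_le with 4%nat; [lia|auto]).
  apply Ck1_plus; [apply Ck1_plus|].
  - apply Ck1_mult; auto. apply Ck1_mult; auto. apply Ck1_mult; auto. apply Ck1_const.
  - apply Ck1_mult; auto.
  - apply Ck1_mult; auto.
Qed.

Lemma revolution_regular rho X e r z t :
  revolution rho X e r (Derive r) (Derive (Derive r)) z (Derive z) (Derive (Derive z)) ->
  (forall t, rho <= t <= 1 -> Ck1 4 r t /\ Ck1 4 z t) ->
  rho <= t <= 1 -> 0 < t -> regular_at r z t.
Proof.
  intros HR HK Ht T. destruct (HK t Ht) as [A B]. split; auto. split; auto. split.
  - pose proof (rev_pos _ _ _ _ _ _ _ _ _ HR t Ht T) as K. intros E; rewrite E in K; lra.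
  - apply HR; auto.
Qed.

Record critical_profile (a alpha beta co rho sigma : R) (X : R -> R -> R3) e r z : Prop := {
  cp_sign : is_sign sigma;
  cp_rev : revolution rho X e r (Derive r) (Derive (Derive r)) z (Derive z) (Derive (Derive z));
  cp_smooth : forall t, rho <= t <= 1 -> Ck1 4 r t /\ Ck1 4 z t;
  cp_critical : critical rho sigma a co 0 alpha beta X;
  cp_a : 0 < a }.

Lemma weak_equation a alpha beta co rho sigma X e r z c Q P :
  critical_profile a alpha beta co rho sigma X e r z -> admissible rho c Q P ->
  let phi := radial_part Q in let psi := vertical_part P in let s := sigma * e in
  a * (flux s co r z phi psi 1 - flux s co r z phi psi c
       - RInt (fun t => EL_r s co r z t * phi t + EL_z s co r z t * psi t) c 1)
  + ((beta - alpha / r 1 ^ 2) * phi 1 + on_inner rho ((beta - alpha / r rho ^ 2) * phi rho)) = 0.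
Proof.
  intros [Hs HR HK Hcrit Ha] HA phi psi s. pose proof HA as (Hc & Hc1 & HQ & HP & HZ).
  rewrite -(first_variation a alpha beta co rho sigma X e r z c Q P Hs HR HK HA Hcrit).
  fold phi psi s. do 2 f_equal.
  assert (Hphi : forall t, Ck1 4 phi t) by (intros; now apply radial_part_smooth).
  assert (Hpsi : forall t, Ck1 4 psi t) by (intros; now apply vertical_part_smooth).
  assert (Hs' : is_sign s) by (apply is_sign_mult; auto; apply HR).
  assert (G : forall t, c <= t <= 1 -> regular_at r z t).
  { intros t Ht. apply (revolution_regular rho X e); auto; lra. }
  set (Fl := flux s co r z phi psi) in *.
  set (E := fun t => EL_r s co r z t * phi t + EL_z s co r z t * psi t).
  assert (CE : forall t, c <= t <= 1 -> continuous E t).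
  { intros t Ht. destruct (EL_continuous s co r z t (G t Ht)).
    apply (continuous_plus (fun t => EL_r s co r z t * phi t) (fun t => EL_z s co r z t * psi t)).
    - apply continuous_mult_R; auto. apply (Ck1_continuous 4); auto.
    - apply continuous_mult_R; auto. apply (Ck1_continuous 4); auto. }
  assert (CF : forall t, c <= t <= 1 -> is_derive Fl t (Derive Fl t) /\ continuous (Derive Fl) t).
  { intros t Ht. destruct (Ck1_Derive 0 Fl t) as [A B]; [apply flux_smooth; auto|].
    split; auto. apply (Ck1_continuous 0); auto. }
  transitivity (RInt (fun t => minus (Derive Fl t) (E t)) c 1).
  - rewrite RInt_minus.
    + assert (RF : RInt (Derive Fl) c 1 = Fl 1 - Fl c).
      { apply is_RInt_unique. apply (is_RInt_derive Fl); rewrite Rmin_left ?Rmax_right; try lra; apply CF. }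
      rewrite RF. reflexivity.
    + apply (ex_RInt_continuous (V := R_CompleteNormedModule)). rewrite Rmin_left ?Rmax_right; try lra. apply CF.
    + apply (ex_RInt_continuous (V := R_CompleteNormedModule)). rewrite Rmin_left ?Rmax_right; try lra. exact CE.
  - apply RInt_ext. rewrite Rmin_left ?Rmax_right; try lra. intros t Ht.
    assert (Ht' : c <= t <= 1) by lra.
    assert (D := flux_derive s co r z phi psi t Hs' (G t Ht') (Hphi t) (Hpsi t)).
    apply is_derive_unique in D. fold Fl in D. rewrite D. unfold E, EL_r, EL_z, minus, plus, opp; simpl.
    as_real. ring.
Qed.

(** ** Bump functions *)

Definition pos (x : R) : R := Rmax 0 x.

Lemma pos_eq x : 0 <= x -> pos x = x.
Proof. apply Rmax_right. Qed.
Lemma pos_0 x : x <= 0 -> pos x = 0.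
Proof. apply Rmax_left. Qed.

Lemma is_derive_pos_pow k x : is_derive (fun t => pos t ^ S (S k)) x (INR (S (S k)) * pos x ^ S k).
Proof.
  destruct (total_order_T x 0) as [[L|E]|L].
  - apply is_derive_ext_loc with (fun _ => 0).
    + assert (N : 0 < - x) by lra. exists (mkposreal _ N). intros y Hy.
      unfold ball in Hy; simpl in Hy; unfold AbsRing_ball, abs, minus, plus, opp in Hy; simpl in Hy.
      rewrite pos_0; [simpl; as_real; ring|]. apply Rabs_def2 in Hy. lra.
    + rewrite (pos_0 x); [|lra]. rewrite pow_i ?Rmult_0_r; [apply @is_derive_const|lia].
  - subst x. rewrite (pos_0 0); [|lra]. rewrite pow_i ?Rmult_0_r; [|lia].
    apply is_derive_Reals. intros eps Heps.
    assert (M : 0 < Rmin eps 1) by (apply Rmin_glb_lt; lra).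
    exists (mkposreal _ M). simpl. intros h H0 Hh. rewrite Rplus_0_l (pos_0 0); [|lra].
    pose proof (Rmin_l eps 1). pose proof (Rmin_r eps 1).
    replace ((pos h * (pos h * pos h ^ k) - 0 * (0 * 0 ^ k)) / h - 0) with (pos h * (pos h * pos h ^ k) / h)
      by (field; auto).
    destruct (Rle_dec h 0) as [L|L].
    + rewrite pos_0; auto. unfold Rdiv. rewrite !Rmult_0_l Rabs_R0. auto.
    + rewrite pos_eq; [|lra]. rewrite Rabs_pos_eq in Hh; [|lra].
      replace (h * (h * h ^ k) / h) with (h * h ^ k) by (field; auto).
      assert (0 < h ^ k) by (apply pow_lt; lra).
      assert (h ^ k <= 1 ^ k) by (apply pow_incr; lra). rewrite pow1 in H3.
      rewrite Rabs_pos_eq; nra.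
  - apply is_derive_ext_loc with (fun t => t ^ S (S k)).
    + apply: filter_imp (locally_gt0 x L). intros t Ht. rewrite pos_eq; auto. lra.
    + rewrite (pos_eq x); [|lra]. auto_derive; auto. simpl. ring.
Qed.

Lemma Ck1_pos_pow n : forall k c x, (n < k)%nat -> Ck1 n (fun t => c * pos t ^ S k) x.
Proof.
  assert (D : forall k c t, is_derive (fun t => c * pos t ^ S (S k)) t (c * INR (S (S k)) * pos t ^ S k)).
  { intros k c t. rewrite Rmult_assoc. apply: is_derive_scal. apply is_derive_pos_pow. }
  induction n as [|n IH]; intros [|k] c x H; try lia; (split;
    [apply filter_forall; intros t; eapply is_derive_cont; apply D|]); auto.
  exists (fun t => c * INR (S (S k)) * pos t ^ S k). split.
  - apply filter_forall. intros; apply D.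
  - apply IH. lia.
Qed.

Lemma pos6_smooth g w : Ck1 4 g w -> Ck1 4 (fun x => pos (g x) ^ 6) w.
Proof.
  intros H. apply Ck1_ext_loc with (fun x => 1 * pos (g x) ^ 6).
  - apply filter_forall. intros; ring.
  - apply (Ck1_compose 4 (fun x => 1 * pos x ^ 6)); auto. apply Ck1_pos_pow. lia.
Qed.

(** The sixth power leaves more than four continuous derivatives. *)
Definition bump (u v w : R) : R := pos ((w - u) * (v - w)) ^ 6.

Lemma bump_smooth u v w : Ck1 4 (bump u v) w.
Proof.
  apply pos6_smooth. apply Ck1_mult; apply Ck1_minus; auto using Ck1_const, Ck1_id.
Qed.

Lemma bump_out u v w : u < v -> w <= u \/ v <= w -> bump u v w = 0.
Proof. intros H K. unfold bump. rewrite pos_0; [ring|]. destruct K; nra. Qed.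

Lemma bump_in u v w : u < w < v -> 0 < bump u v w.
Proof. intros H. unfold bump. apply pow_lt. rewrite pos_eq; nra. Qed.

(** The weight [wt] is there because the radial part of a test field is [t] times
    a function of [t ^ 2]. *)
Lemma fundamental_lemma (g wt : R -> R) c t0 : 0 < c < t0 -> t0 < 1 ->
  (forall t, c <= t <= 1 -> continuous g t) -> (forall t, c <= t <= 1 -> continuous wt t) ->
  (forall t, c <= t <= 1 -> 0 < wt t) ->
  (forall u v, c ^ 2 < u -> u < v -> v < 1 -> RInt (fun t => g t * (wt t * bump u v (t ^ 2))) c 1 = 0) ->
  g t0 = 0.
Proof.
  intros Hc Ht0 Cg Cw Pw HI. destruct (Req_dec (g t0) 0) as [|N]; auto. exfalso.
  assert (Hloc : locally t0 (fun t => 0 < g t0 * g t)).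
  { assert (Cont : continuous (fun t => g t0 * g t) t0).
    { apply continuous_mult_R; [apply continuous_const|apply Cg; lra]. }
    apply (Cont (fun y => 0 < y)). apply (open_gt 0). nra. }
  destruct Hloc as [d Hd].
  set (h := Rmin (d / 2) (Rmin ((t0 - c) / 2) ((1 - t0) / 2))).
  pose proof (cond_pos d).
  assert (Hh : 0 < h) by (unfold h; repeat apply Rmin_glb_lt; lra).
  assert (h <= d / 2) by apply Rmin_l.
  assert (h <= (t0 - c) / 2) by (eapply Rle_trans; [apply Rmin_r|apply Rmin_l]).
  assert (h <= (1 - t0) / 2) by (eapply Rle_trans; [apply Rmin_r|apply Rmin_r]).
  set (u := (t0 - h) ^ 2). set (v := (t0 + h) ^ 2).
  specialize (HI u v).
  assert (Z : RInt (fun t => g t * (wt t * bump u v (t ^ 2))) c 1 = 0).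
  { apply HI; unfold u, v; nra. } clear HI.
  set (k := fun t => g t0 * (g t * (wt t * bump u v (t ^ 2)))).
  assert (Ck0 : forall t, c <= t <= 1 -> continuous (fun t => g t * (wt t * bump u v (t ^ 2))) t).
  { intros t Ht. apply continuous_mult_R; auto. apply continuous_mult_R; auto.
    apply (Ck1_continuous 4). apply (Ck1_compose 4 (bump u v)); [apply bump_smooth|apply Ck1_pow, Ck1_id]. }
  assert (Ck : forall t, c <= t <= 1 -> continuous k t).
  { intros t Ht. apply continuous_mult_R; [apply continuous_const|]. auto. }
  assert (Ex : forall x y, c <= x -> x <= y -> y <= 1 -> ex_RInt k x y).
  { intros x y A B C. apply (ex_RInt_continuous (V := R_CompleteNormedModule)).
    rewrite Rmin_left ?Rmax_right; try lra. intros t Ht. apply Ck. lra. }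
  assert (Zk : RInt k c 1 = 0).
  { transitivity (scal (g t0) (RInt (fun t => g t * (wt t * bump u v (t ^ 2))) c 1)).
    - apply (RInt_scal (fun t => g t * (wt t * bump u v (t ^ 2)))).
      apply (ex_RInt_continuous (V := R_CompleteNormedModule)).
      rewrite Rmin_left ?Rmax_right; try lra. exact Ck0.
    - rewrite Z. unfold scal; simpl; unfold mult; simpl. ring. }
  assert (Zout : forall x y, x <= y -> (forall t, x < t < y -> bump u v (t ^ 2) = 0) -> RInt k x y = 0).
  { intros x y Hxy B. transitivity (RInt (fun _ => 0) x y).
    - apply RInt_ext. rewrite Rmin_left ?Rmax_right; auto. intros t Ht. unfold k. rewrite B; auto. as_real; ring.
    - rewrite RInt_const. unfold scal; simpl; unfold mult; simpl. as_real; ring. }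
  rewrite -(RInt_Chasles k c (t0 - h) 1) in Zk; [| apply Ex; lra | apply Ex; lra].
  rewrite -(RInt_Chasles k (t0 - h) (t0 + h) 1) in Zk; [| apply Ex; lra | apply Ex; lra].
  rewrite (Zout c (t0 - h)) in Zk; [|lra|].
  2:{ intros t Ht. apply bump_out; [unfold u, v; nra|]. left. unfold u; nra. }
  rewrite (Zout (t0 + h) 1) in Zk; [|lra|].
  2:{ intros t Ht. apply bump_out; [unfold u, v; nra|]. right. unfold v; nra. }
  unfold plus in Zk; simpl in Zk.
  assert (0 < RInt k (t0 - h) (t0 + h)).
  { apply RInt_gt_0; [lra| |].
    - intros t Ht. unfold k. replace (_ * _) with (g t0 * g t * (wt t * bump u v (t ^ 2))) by ring.
      apply Rmult_lt_0_compat.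
      + apply Hd. unfold ball; simpl; unfold AbsRing_ball, abs, minus, plus, opp; simpl.
        apply Rabs_def1; lra.
      + apply Rmult_lt_0_compat; [apply Pw; lra|]. apply bump_in. unfold u, v. nra.
    - intros t Ht. apply Ck. lra. }
  lra.
Qed.

Lemma flux_vanish s co r z phi psi a b t :
  (forall x, Ck1 4 phi x) -> (forall x, Ck1 4 psi x) ->
  a < b -> a <= t <= b -> (forall x, a <= x <= b -> phi x = 0 /\ psi x = 0) ->
  flux s co r z phi psi t = 0.
Proof.
  intros Hphi Hpsi Hab Ht H0.
  assert (D : forall f, (forall x, Ck1 4 f x) -> (forall x, a <= x <= b -> f x = 0) -> Derive f t = 0).
  { intros f Cf Zf. apply (is_derive_unique_on f (fun _ => 0) a b t); auto.
    - apply (Ck1_Derive 3); auto.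
    - apply @is_derive_const. }
  unfold flux, tilt. rewrite (D phi) ?(D psi); auto; try (intros; apply H0; auto).
  destruct (H0 t Ht) as [-> ->]. unfold Rdiv. ring.
Qed.

Lemma on_inner_0 rho : on_inner rho 0 = 0.
Proof. unfold on_inner. destruct Rlt_dec; auto. Qed.

(** The test functions vanish near both ends of the segment on which the weak
    equation is written, hence so do all boundary terms. *)
Lemma Euler_Lagrange a alpha beta co rho sigma X e r z t0 :
  critical_profile a alpha beta co rho sigma X e r z -> rho < t0 < 1 ->
  let s := sigma * e in EL_r s co r z t0 = 0 /\ EL_z s co r z t0 = 0.
Proof.
  intros HC Ht0 s. pose proof HC as [Hs HR HK Hcrit Ha].
  pose proof (rev_rho _ _ _ _ _ _ _ _ _ HR) as Hrho.
  set (c := (rho + t0) / 2). assert (Hc : rho < c < t0) by (unfold c; lra).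
  assert (G : forall t, c <= t <= 1 -> regular_at r z t).
  { intros t Ht. apply (revolution_regular rho X e); auto; lra. }
  assert (Bz : forall u v w, c ^ 2 < u -> u < v -> v < 1 -> w <= c ^ 2 \/ 1 <= w -> bump u v w = 0).
  { intros u v w H1 H2 H3 H4. apply bump_out; auto. destruct H4; [left|right]; lra. }
  assert (T : forall Q P, (forall w, Ck1 4 Q w) -> (forall w, Ck1 4 P w) ->
    (forall w, w <= c ^ 2 \/ 1 <= w -> Q w = 0 /\ P w = 0) ->
    RInt (fun t => EL_r s co r z t * radial_part Q t + EL_z s co r z t * vertical_part P t) c 1 = 0).
  { intros Q P HQ HP HZ.
    assert (HA : admissible rho c Q P).
    { split; [lra|]. split; [lra|]. split; auto. }
    pose proof (weak_equation a alpha beta co rho sigma X e r z c Q P HC HA) as W. cbv zeta in W. fold s in W.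
    assert (Hphi : forall t, Ck1 4 (radial_part Q) t) by (intros; now apply radial_part_smooth).
    assert (Hpsi : forall t, Ck1 4 (vertical_part P) t) by (intros; now apply vertical_part_smooth).
    assert (V : forall t, rho <= t <= c \/ 1 <= t -> radial_part Q t = 0 /\ vertical_part P t = 0).
    { intros t Ht. unfold radial_part, vertical_part.
      destruct (HZ (t ^ 2)) as [-> ->]; [|split; ring]. destruct Ht; [left|right]; nra. }
    rewrite (flux_vanish s co r z _ _ rho c c) in W; auto; [|lra|lra].
    rewrite (flux_vanish s co r z _ _ 1 2 1) in W; auto; [|lra|lra|].
    2:{ intros x Hx. apply V. right. lra. }
    destruct (V 1) as [E1 _]; [right; lra|]. destruct (V rho) as [E2 _]; [left; lra|].
    rewrite E1 E2 !Rmult_0_r on_inner_0 in W.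
    match type of W with a * (0 - 0 - ?x) + _ = 0 => set (I := x) in * end.
    apply Rmult_eq_reg_l with a; lra. }
  assert (Zs : forall w, Ck1 4 (fun _ : R => 0) w) by (intros; apply Ck1_const).
  split.
  - apply (fundamental_lemma (EL_r s co r z) (fun t => t) c t0); try lra.
    + intros t Ht. exact (proj1 (EL_continuous s co r z t (G t Ht))).
    + intros t Ht. apply continuous_id.
    + intros t Ht. lra.
    + intros u v Hu Huv Hv. rewrite -(T (bump u v) (fun _ => 0)); auto.
      * apply RInt_ext. intros t _. unfold radial_part, vertical_part. as_real. ring.
      * intros. apply bump_smooth.
  - apply (fundamental_lemma (EL_z s co r z) (fun t => 1) c t0); try lra.
    + intros t Ht. exact (proj2 (EL_continuous s co r z t (G t Ht))).
    + intros t Ht. apply continuous_const.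
    + intros t Ht. lra.
    + intros u v Hu Huv Hv. rewrite -(T (fun _ => 0) (bump u v)); auto.
      * apply RInt_ext. intros t _. unfold radial_part, vertical_part. as_real. ring.
      * intros. apply bump_smooth.
Qed.

(** ** Natural boundary conditions *)

Lemma flux_at s co r z t k1 k2 b Q P : regular_at r z t ->
  Q = (fun w => k1 * b w) -> P = (fun w => k2 * b w) -> (forall w, Ck1 4 b w) ->
  flux s co r z (radial_part Q) (vertical_part P) t =
  s * prof_f s co r z t * r t *
    ((Derive r t * (2 * t * k2 * Derive b (t ^ 2)) - Derive z t * (k1 * b (t ^ 2) + 2 * t ^ 2 * k1 * Derive b (t ^ 2)))
      / (Derive r t ^ 2 + Derive z t ^ 2))
  + mom_r s co r z t * (t * (k1 * b (t ^ 2))) + mom_z s co r z t * (k2 * b (t ^ 2)).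
Proof.
  intros G -> -> Hb. unfold flux, tilt.
  assert (Db : is_derive b (t ^ 2) (Derive b (t ^ 2))) by (apply (Ck1_Derive 3); auto).
  set (l := Derive b (t ^ 2)) in *. clearbody l.
  assert (D1 : Derive (radial_part (fun w => k1 * b w)) t = k1 * b (t ^ 2) + 2 * t ^ 2 * k1 * l).
  { apply is_derive_unique. unfold radial_part. auto_derive.
    - eexists; exact Db.
    - rewrite (is_derive_unique _ _ _ Db). change (t * (t * 1)) with (t ^ 2). ring. }
  assert (D2 : Derive (vertical_part (fun w => k2 * b w)) t = 2 * t * k2 * l).
  { apply is_derive_unique. unfold vertical_part. auto_derive.
    - eexists; exact Db.
    - rewrite (is_derive_unique _ _ _ Db). ring. }
  rewrite D1 D2. unfold radial_part, vertical_part. reflexivity.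
Qed.

(** At the boundary circle the displacement and the tilt are independent.  The
    factor [g w = w - t ^ 2] kills the displacement and leaves the tilt, whence
    [f = 0]; then [g w = 1] gives an arbitrary displacement. *)
Lemma natural_conditions s co r z t K sg a b :
  is_sign s -> is_sign sg -> 0 < a -> regular_at r z t -> 0 < t ->
  (forall w, Ck1 4 b w) -> 0 < b (t ^ 2) ->
  (forall Q P g, (forall w, Ck1 4 g w) -> (exists k1 k2, Q = (fun w => k1 * (g w * b w)) /\ P = (fun w => k2 * (g w * b w))) ->
     sg * a * flux s co r z (radial_part Q) (vertical_part P) t + K * radial_part Q t = 0) ->
  prof_f s co r z t = 0 /\ mom_z s co r z t = 0 /\ sg * a * mom_r s co r z t + K = 0.
Proof.
  intros Hs Hsg Ha G T Hb Pb H.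
  assert (C1 : forall w, Ck1 4 (fun w => w - t ^ 2) w).
  { intros w. apply Ck1_minus; auto using Ck1_const, Ck1_id. }
  assert (C2 : forall w : R, Ck1 4 (fun _ => 1) w) by (intros; apply Ck1_const).
  assert (Db : is_derive b (t ^ 2) (Derive b (t ^ 2))) by (apply (Ck1_Derive 3); auto).
  pose proof G as (Gr & Gz & G0 & Gq).
  assert (S0 : s <> 0) by (destruct Hs; lra).
  assert (Sg0 : sg * a <> 0) by (destruct Hsg as [->| ->]; lra).
  assert (F0 : prof_f s co r z t = 0).
  { (* the derivative of this field is transverse to the profile, so that its tilt is not zero *)
    pose proof (H _ _ (fun w => w - t ^ 2) C1 (ex_intro _ (- Derive z t * t) (ex_intro _ (Derive r t) (conj eq_refl eq_refl)))) as E.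
    rewrite (flux_at s co r z t (- Derive z t * t) (Derive r t) (fun w => (w - t ^ 2) * b w) _ _ G eq_refl eq_refl) in E.
    2:{ intros w. apply Ck1_mult; auto. }
    assert (DD : Derive (fun w => (w - t ^ 2) * b w) (t ^ 2) = b (t ^ 2)).
    { apply is_derive_unique. auto_derive.
      - eexists; exact Db.
      - ring. }
    rewrite DD in E. unfold radial_part in E. rewrite Rminus_eq_0 in E.
    assert (E2 : sg * a * (s * prof_f s co r z t * r t * (2 * t * b (t ^ 2) * (Derive r t ^ 2 + Derive z t ^ 2 * t ^ 2) / (Derive r t ^ 2 + Derive z t ^ 2))) = 0).
    { rewrite -E. field. lra. }
    assert (N : 2 * t * b (t ^ 2) * (Derive r t ^ 2 + Derive z t ^ 2 * t ^ 2) / (Derive r t ^ 2 + Derive z t ^ 2) <> 0).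
    { apply Rgt_not_eq. apply Rdiv_lt_0_compat; auto.
      assert (0 < t ^ 2) by nra.
      assert (0 < Derive r t ^ 2 + Derive z t ^ 2 * t ^ 2).
      { destruct (Req_dec (Derive r t) 0) as [Er|Nr].
        - rewrite Er in Gq |- *. nra.
        - pose proof (pow2_ge_0 (Derive z t)). assert (0 < Derive r t ^ 2) by nra. nra. }
      repeat apply Rmult_lt_0_compat; lra. }
    apply Rmult_integral in E2. destruct E2 as [E2|E2]; [contradiction|].
    apply Rmult_integral in E2. destruct E2 as [E2|E2]; [|contradiction].
    apply Rmult_integral in E2. destruct E2 as [E2|E2]; [|contradiction].
    apply Rmult_integral in E2. destruct E2 as [E2|E2]; [contradiction|auto]. }
  assert (C3 : forall w, Ck1 4 (fun w => 1 * b w) w) by (intros w; apply Ck1_mult; auto).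
  assert (Gen : forall k1 k2, sg * a * (mom_r s co r z t * (t * k1) + mom_z s co r z t * k2) + K * (t * k1) = 0).
  { intros k1 k2.
    pose proof (H _ _ (fun w => 1) C2 (ex_intro _ k1 (ex_intro _ k2 (conj eq_refl eq_refl)))) as E.
    rewrite (flux_at s co r z t k1 k2 (fun w => 1 * b w) _ _ G eq_refl eq_refl C3) in E.
    rewrite F0 in E. unfold radial_part in E.
    apply Rmult_eq_reg_l with (b (t ^ 2)); [|lra]. rewrite Rmult_0_r -E. ring. }
  split; auto. split.
  - pose proof (Gen 0 1) as E. apply Rmult_eq_reg_l with (sg * a); auto. lra.
  - pose proof (Gen 1 0) as E. apply Rmult_eq_reg_l with t; lra.
Qed.

(** The sign [sg] is that of the outer conormal with respect to increasing [t]. *)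
Lemma boundary_conditions a alpha beta co rho sigma X e r z :
  critical_profile a alpha beta co rho sigma X e r z ->
  let s := sigma * e in
  forall t sg, (t = 1 /\ sg = 1) \/ (0 < rho /\ t = rho /\ sg = -1) ->
  prof_f s co r z t = 0 /\ mom_z s co r z t = 0 /\ sg * a * mom_r s co r z t + (beta - alpha / r t ^ 2) = 0.
Proof.
  intros HC s t sg Ht. pose proof HC as [Hs HR HK Hcrit Ha].
  pose proof (rev_rho _ _ _ _ _ _ _ _ _ HR) as Hrho.
  assert (Hs' : is_sign s) by (apply is_sign_mult; auto; apply HR).
  (* the Euler-Lagrange terms drop out of the weak equation *)
  assert (W : forall c Q P, admissible rho c Q P ->
    a * (flux s co r z (radial_part Q) (vertical_part P) 1 - flux s co r z (radial_part Q) (vertical_part P) c)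
    + ((beta - alpha / r 1 ^ 2) * radial_part Q 1 + on_inner rho ((beta - alpha / r rho ^ 2) * radial_part Q rho)) = 0).
  { intros c Q P HA. rewrite -(weak_equation a alpha beta co rho sigma X e r z c Q P HC HA). fold s.
    assert (I0 : RInt (fun t => EL_r s co r z t * radial_part Q t + EL_z s co r z t * vertical_part P t) c 1 = 0).
    { transitivity (RInt (fun _ => 0) c 1).
      - apply RInt_ext. destruct HA as (? & ? & _). rewrite Rmin_left ?Rmax_right; try lra. intros x Hx.
        destruct (Euler_Lagrange a alpha beta co rho sigma X e r z x HC) as [E1 E2]; [lra|]. fold s in E1, E2.
        rewrite E1 E2. as_real. ring.
      - rewrite RInt_const. unfold scal; simpl; unfold mult; simpl. as_real; ring. }
    rewrite I0. ring. }
  destruct Ht as [[-> ->]|(Hr & -> & ->)].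
  - set (c := (rho + 1) / 2). assert (Hc : rho < c < 1) by (unfold c; lra).
    set (b := fun w => pos (w - c ^ 2) ^ 6).
    assert (Hb : forall w, Ck1 4 b w).
    { intros w. apply pos6_smooth. apply Ck1_minus; auto using Ck1_const, Ck1_id. }
    apply (natural_conditions s co r z 1 _ 1 a b); auto; try lra.
    + left; auto.
    + apply (revolution_regular rho X e); auto; lra.
    + unfold b. apply pow_lt. rewrite pos_eq; nra.
    + intros Q P g Hg (k1 & k2 & -> & ->).
      assert (C : forall k w, Ck1 4 (fun w => k * (g w * b w)) w).
      { intros k w. apply Ck1_mult; [apply Ck1_const|]. apply Ck1_mult; auto. }
      assert (Zb : forall w, w <= c ^ 2 -> b w = 0).
      { intros w Hw. unfold b. rewrite pos_0; [ring|lra]. }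
      assert (HA : admissible rho c (fun w => k1 * (g w * b w)) (fun w => k2 * (g w * b w))).
      { split; [lra|]. split; [lra|]. split; auto. split; auto. intros _ w Hw. rewrite Zb; auto. split; ring. }
      pose proof (W c _ _ HA) as E.
      assert (Z : forall x, rho <= x <= c -> radial_part (fun w => k1 * (g w * b w)) x = 0
         /\ vertical_part (fun w => k2 * (g w * b w)) x = 0).
      { intros x Hx. unfold radial_part, vertical_part. rewrite Zb; [|nra]. split; ring. }
      rewrite (flux_vanish s co r z _ _ rho c c) in E; auto; try lra.
      2: intros; apply radial_part_smooth; auto.
      2: intros; apply vertical_part_smooth; auto.
      destruct (Z rho) as [Z1 _]; [lra|]. rewrite Z1 Rmult_0_r on_inner_0 in E. lra.
  - set (c := (rho + 1) / 2). assert (Hc : rho < c < 1) by (unfold c; lra).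
    set (b := fun w => pos (c ^ 2 - w) ^ 6).
    assert (Hb : forall w, Ck1 4 b w).
    { intros w. apply pos6_smooth. apply Ck1_minus; auto using Ck1_const, Ck1_id. }
    apply (natural_conditions s co r z rho _ (-1) a b); auto; try lra.
    + right; auto.
    + apply (revolution_regular rho X e); auto; lra.
    + unfold b. apply pow_lt. rewrite pos_eq; nra.
    + intros Q P g Hg (k1 & k2 & -> & ->).
      assert (C : forall k w, Ck1 4 (fun w => k * (g w * b w)) w).
      { intros k w. apply Ck1_mult; [apply Ck1_const|]. apply Ck1_mult; auto. }
      assert (Zb : forall w, c ^ 2 <= w -> b w = 0).
      { intros w Hw. unfold b. rewrite pos_0; [ring|lra]. }
      assert (HA : admissible rho rho (fun w => k1 * (g w * b w)) (fun w => k2 * (g w * b w))).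
      { split; [lra|]. split; [lra|]. split; auto. split; auto. intros Hbad; lra. }
      pose proof (W rho _ _ HA) as E.
      assert (Z : forall x, c <= x <= 1 -> radial_part (fun w => k1 * (g w * b w)) x = 0
         /\ vertical_part (fun w => k2 * (g w * b w)) x = 0).
      { intros x Hx. unfold radial_part, vertical_part. rewrite Zb; [|nra]. split; ring. }
      rewrite (flux_vanish s co r z _ _ c 1 1) in E; auto; try lra.
      2: intros; apply radial_part_smooth; auto.
      2: intros; apply vertical_part_smooth; auto.
      destruct (Z 1) as [Z1 _]; [lra|]. rewrite Z1 Rmult_0_r in E.
      unfold on_inner in E. destruct (Rlt_dec 0 rho); [lra|contradiction].
Qed.

(** * The linear system satisfied by [H + co] *)

(** [E = f ^ 2 + p ^ 2] satisfies [|E'| <= M E], so that [E exp (M t)] increases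
    and [E exp (- M t)] decreases. *)
Lemma linear_system_unique (f p g1 g2 : R -> R) a b x0 :
  a < b -> x0 = a \/ x0 = b ->
  (forall t, a <= t <= b -> continuous f t /\ continuous p t /\ continuous g1 t /\ continuous g2 t) ->
  (forall t, a < t < b -> is_derive f t (g1 t * p t) /\ is_derive p t (g2 t * f t)) ->
  f x0 = 0 -> p x0 = 0 ->
  forall t, a <= t <= b -> f t = 0 /\ p t = 0.
Proof.
  intros Hab Hx0 HC HD F0 P0.
  destruct (continuity_ab_maj (fun t => Rabs (g1 t + g2 t)) a b (Rlt_le _ _ Hab)) as (y & Hy & Hyab).
  { intros t Ht. destruct (HC t Ht) as (_ & _ & C1 & C2).
    apply (continuity_pt_comp (fun t => g1 t + g2 t) Rabs).
    - apply continuity_pt_filterlim. apply (continuous_plus g1 g2); auto.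
    - apply Rcontinuity_abs. }
  set (M := Rabs (g1 y + g2 y)) in *.
  set (E := fun x => f x * f x + p x * p x).
  assert (E0 : forall x, 0 <= E x) by (intros; unfold E; nra).
  assert (Bound : forall x, a <= x <= b -> - (M * E x) <= 2 * (f x * p x) * (g1 x + g2 x) <= M * E x).
  { intros x Hx. assert (B := Hy x Hx). simpl in B.
    assert (Rabs (2 * (f x * p x)) <= E x).
    { unfold E. apply Rabs_le. split; [pose proof (Rle_0_sqr (f x + p x))|pose proof (Rle_0_sqr (f x - p x))]; unfold Rsqr in *; nra. }
    assert (Rabs (2 * (f x * p x) * (g1 x + g2 x)) <= M * E x).
    { rewrite Rabs_mult Rmult_comm. apply Rmult_le_compat; auto using Rabs_pos. }
    now apply Rabs_le_between. }
  assert (CE : forall k x, a <= x <= b -> continuity_pt (fun x => E x * exp (k * x)) x).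
  { intros k x Hx. destruct (HC x Hx) as (C1 & C2 & _).
    assert (K1 : continuous E x).
    { apply (continuous_plus (fun x => f x * f x) (fun x => p x * p x)); apply continuous_mult_R; auto. }
    assert (K2 : continuous (fun x => exp (k * x)) x).
    { apply (is_derive_cont (fun x => exp (k * x)) x (k * exp (k * x))). auto_derive; auto. ring. }
    apply continuity_pt_filterlim. exact (continuous_mult_R E (fun x => exp (k * x)) x K1 K2). }
  assert (DE : forall k x, a < x < b ->
    is_derive (fun x => E x * exp (k * x)) x ((2 * (f x * p x) * (g1 x + g2 x) + k * E x) * exp (k * x))).
  { intros k x Hx. destruct (HD x Hx) as (D1 & D2). unfold E. auto_derive.
    - repeat split; eexists; eassumption.
    - rewrite (is_derive_unique _ _ _ D1) (is_derive_unique _ _ _ D2). ring. }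
  assert (Sq : E x0 = 0) by (unfold E; rewrite F0 P0; ring).
  intros t Ht.
  assert (Et : E t <= 0).
  { destruct Hx0 as [->| ->].
    - destruct (MVT_gen (fun x => E x * exp (- M * x)) a t (fun x => (2 * (f x * p x) * (g1 x + g2 x) + - M * E x) * exp (- M * x)))
        as (xi & Hxi & Hm).
      + rewrite Rmin_left ?Rmax_right; try lra. intros x Hx. apply DE. lra.
      + rewrite Rmin_left ?Rmax_right; try lra. intros x Hx. apply CE. lra.
      + rewrite Rmin_left ?Rmax_right in Hxi; try lra. rewrite Sq in Hm.
        pose proof (Bound xi ltac:(lra)). pose proof (exp_pos (- M * xi)). pose proof (exp_pos (- M * t)).
        assert ((2 * (f xi * p xi) * (g1 xi + g2 xi) + - M * E xi) * exp (- M * xi) <= 0) by nra.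
        nra.
    - destruct (MVT_gen (fun x => E x * exp (M * x)) t b (fun x => (2 * (f x * p x) * (g1 x + g2 x) + M * E x) * exp (M * x)))
        as (xi & Hxi & Hm).
      + rewrite Rmin_left ?Rmax_right; try lra. intros x Hx. apply DE. lra.
      + rewrite Rmin_left ?Rmax_right; try lra. intros x Hx. apply CE. lra.
      + rewrite Rmin_left ?Rmax_right in Hxi; try lra. rewrite Sq in Hm.
        pose proof (Bound xi ltac:(lra)). pose proof (exp_pos (M * xi)). pose proof (exp_pos (M * t)).
        assert (0 <= (2 * (f xi * p xi) * (g1 xi + g2 xi) + M * E xi) * exp (M * xi)) by nra.
        nra. }
  unfold E in Et. split; nra.
Qed.

(** With [p = mom_nor], the system [f' = coef_f p], [p' = coef_p f] is the
    equation [Laplacian f + 2 f (H (H - co) - K) = 0] in first-order form. *)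
Definition coef_f s (r z : R -> R) t : R := s * prof_speed r z t / r t.
Definition coef_p s co (r z : R -> R) t : R :=
  s * tan_z r z t * prof_turn r z t + (co - prof_H s r z t) * r t * prof_turn r z t
  + tan_z r z t * prof_f s co r z t * prof_speed r z t - s * prof_speed r z t * tan_z r z t ^ 2 / r t.

Lemma prof_turn_eq s r z t : is_sign s -> regular_at r z t ->
  prof_turn r z t = prof_speed r z t * (2 * s * prof_H s r z t - tan_z r z t / r t).
Proof.
  intros Hs (A & B & C & D). pose proof (is_sign_sq s Hs) as S2.
  pose proof (sqrt_lt_R0 _ D) as Q. assert (QQ := sqrt_sqrt _ (Rlt_le _ _ D)).
  unfold prof_turn, prof_H, tan_z, turn, mean_curv_of, curv_meridian, curv_parallel. fold (prof_speed r z t) in *.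
  rewrite -QQ. set (om := _ - _).
  transitivity (prof_speed r z t * ((s * s) * (om / prof_speed r z t ^ 3 + Derive z t / (prof_speed r z t * r t)) - Derive z t / prof_speed r z t / r t)).
  - rewrite S2. clearbody om. field. split; auto. lra.
  - clearbody om. field. split; auto. lra.
Qed.

Lemma unit_tangent r z t : 0 < Derive r t ^ 2 + Derive z t ^ 2 -> tan_r r z t ^ 2 + tan_z r z t ^ 2 = 1.
Proof.
  intros D. pose proof (sqrt_lt_R0 _ D) as Q. assert (QQ := sqrt_sqrt _ (Rlt_le _ _ D)).
  unfold tan_r, tan_z. fold (prof_speed r z t) in *.
  transitivity ((Derive r t ^ 2 + Derive z t ^ 2) / (prof_speed r z t * prof_speed r z t)); [field; lra|].
  rewrite QQ. field. lra.
Qed.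

Lemma tan_r_derive r z t : regular_at r z t -> is_derive (tan_r r z) t (- tan_z r z t * prof_turn r z t).
Proof.
  intros (A & B & C & D). destruct (Ck1_jets _ _ A) as [A1 _]. destruct (Ck1_jets _ _ B) as [B1 _].
  exact (is_derive_cos_profile (Derive r) (Derive z) t _ _ (proj1 (Ck1_Derive 2 _ _ A1)) (proj1 (Ck1_Derive 2 _ _ B1)) D).
Qed.

Lemma tan_z_derive r z t : regular_at r z t -> is_derive (tan_z r z) t (tan_r r z t * prof_turn r z t).
Proof.
  intros (A & B & C & D). destruct (Ck1_jets _ _ A) as [A1 _]. destruct (Ck1_jets _ _ B) as [B1 _].
  exact (is_derive_sin_profile (Derive r) (Derive z) t _ _ (proj1 (Ck1_Derive 2 _ _ A1)) (proj1 (Ck1_Derive 2 _ _ B1)) D).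
Qed.

Lemma prof_f_derive s co r z t : is_sign s -> regular_at r z t ->
  is_derive (prof_f s co r z) t (coef_f s r z t * mom_nor s co r z t).
Proof.
  intros Hs G. pose proof (is_sign_sq s Hs) as S2.
  assert (D := proj1 (Ck1_Derive 1 _ _ (prof_f_smooth s co _ _ _ G))).
  assert (Q := prof_speed_pos _ _ _ G). destruct G as (_ & _ & R0 & _).
  replace (coef_f s r z t * mom_nor s co r z t) with (Derive (prof_f s co r z) t); auto.
  unfold coef_f, mom_nor. transitivity (s * s * Derive (prof_f s co r z) t); [rewrite S2; ring|].
  field. split; auto; lra.
Qed.

Lemma prof_H_derive s co r z t : is_sign s -> regular_at r z t ->
  is_derive (prof_H s r z) t (coef_f s r z t * mom_nor s co r z t).
Proof.
  intros Hs G. apply (is_derive_ext (fun x => prof_f s co r z x + - co)).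
  - intros x. unfold prof_f. as_real. ring.
  - rewrite -[X in is_derive _ _ X]Rplus_0_r. apply: is_derive_plus; [now apply prof_f_derive|apply @is_derive_const].
Qed.

(** [mom_nor] is the normal component of the momentum, whose derivative is given
    by the Euler-Lagrange equations; the other terms come from the rotation of
    the frame. *)
Lemma mom_nor_derive s co r z t : regular_at r z t -> EL_r s co r z t = 0 -> EL_z s co r z t = 0 ->
  is_derive (mom_nor s co r z) t (coef_p s co r z t * prof_f s co r z t).
Proof.
  intros G E1 E2. unfold EL_r, EL_z in E1, E2.
  assert (DA := proj1 (Ck1_Derive 0 _ _ (mom_r_smooth s co _ _ _ G))).
  assert (DB := proj1 (Ck1_Derive 0 _ _ (mom_z_smooth s co _ _ _ G))).
  assert (DC := tan_r_derive r z t G). assert (DS := tan_z_derive r z t G).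
  assert (L : locally t (fun x => 0 < Derive r x ^ 2 + Derive z x ^ 2)).
  { destruct G as (A & B & _ & D). destruct (Ck1_jets _ _ A) as [A1 _]. destruct (Ck1_jets _ _ B) as [B1 _].
    assert (C : continuous (fun x => Derive r x ^ 2 + Derive z x ^ 2) t).
    { apply (Ck1_continuous 3). apply Ck1_plus; apply Ck1_pow; auto. }
    apply (C (fun y => 0 < y)). apply (open_gt 0). auto. }
  apply (is_derive_ext_loc (fun x => tan_z r z x * mom_r s co r z x - tan_r r z x * mom_z s co r z x)).
  { apply: filter_imp L. intros x D. unfold mom_r, mom_z.
    transitivity (mom_nor s co r z x * (tan_r r z x ^ 2 + tan_z r z x ^ 2)); [as_real; ring|].
    rewrite unit_tangent; auto. as_real; ring. }
  set (A := mom_r s co r z) in *. set (B := mom_z s co r z) in *. set (C := tan_r r z) in *. set (S := tan_z r z) in *.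
  evar (l : R). assert (K : is_derive (fun x => S x * A x - C x * B x) t l).
  { unfold l. auto_derive.
    - repeat split; eexists; eassumption.
    - reflexivity. }
  replace (_ * _) with l; auto. unfold l.
  rewrite (is_derive_unique _ _ _ DA) (is_derive_unique _ _ _ DB) (is_derive_unique _ _ _ DC) (is_derive_unique _ _ _ DS).
  rewrite E2. replace (Derive A t) with (force_r s co r z t) by lra.
  assert (CS : C t ^ 2 + S t ^ 2 = 1) by (apply unit_tangent; apply G).
  assert (EM : C t * A t + S t * B t = mom_tan s co r z t).
  { unfold A, B, mom_r, mom_z. fold C S. transitivity (mom_tan s co r z t * (C t ^ 2 + S t ^ 2)); [ring|rewrite CS; ring]. }
  transitivity (prof_turn r z t * (C t * A t + S t * B t) + S t * force_r s co r z t); [ring|].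
  rewrite EM. unfold mom_tan, force_r, coef_p. fold S.
  field. apply G.
Qed.

(** For every constant [tau], [nu_3 + f (z + tau)] solves the linear equation of
    [f].  Indeed [Laplacian nu_3 = - |d nu| ^ 2 nu_3 - 2 grad H . grad z] and
    [Laplacian z = 2 H nu_3]: the gradient terms cancel, and the terms of order zero
    are [2 H f nu_3 - |d nu| ^ 2 nu_3 = - 2 (H (H - co) - K) nu_3].  [height_p] is
    the second unknown of the system, [s r / q] times the derivative of
    [height_f]. *)
Definition height_f s co tau (r z : R -> R) t : R := s * tan_r r z t + prof_f s co r z t * (z t + tau).
Definition height_p s co tau (r z : R -> R) t : R :=
  s * r t * tan_z r z t * (co - prof_H s r z t) + tan_z r z t ^ 2 + mom_nor s co r z t * (z t + tau).

Lemma height_f_derive s co tau r z t : is_sign s -> regular_at r z t ->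
  is_derive (height_f s co tau r z) t (coef_f s r z t * height_p s co tau r z t).
Proof.
  intros Hs G. pose proof (is_sign_sq s Hs) as S2.
  assert (DC := tan_r_derive r z t G). assert (DF := prof_f_derive s co r z t Hs G).
  pose proof G as (Gr & Gz & G0 & Gq). assert (Q := prof_speed_pos _ _ _ G).
  assert (DZ : is_derive z t (prof_speed r z t * tan_z r z t)).
  { replace (_ * _) with (Derive z t); [apply (Ck1_Derive 3); auto|]. unfold tan_z. field. lra. }
  assert (ET := prof_turn_eq s r z t Hs G).
  unfold height_f. set (f := prof_f s co r z) in *. set (C := tan_r r z) in *.
  evar (l : R). assert (K : is_derive (fun x => s * C x + f x * (z x + tau)) t l).
  { unfold l. auto_derive.
    - repeat split; eexists; eassumption.
    - reflexivity. }
  replace (_ * _) with l; auto. unfold l.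
  rewrite (is_derive_unique _ _ _ DC) (is_derive_unique _ _ _ DF) (is_derive_unique _ _ _ DZ).
  rewrite ET. unfold height_p, coef_f.
  replace (f t) with (prof_H s r z t + co) by reflexivity.
  set (q := prof_speed r z t) in *. set (H := prof_H s r z t) in *. set (S := tan_z r z t) in *. set (p := mom_nor s co r z t) in *.
  transitivity (- (s * s) * (2 * S * q * H) + s * S * q * S / r t + s * q / r t * p * (z t + tau) + (H + co) * (q * S)).
  { field. auto. }
  transitivity ((s * s) * q * S * (co - H) + s * q / r t * (S ^ 2 + p * (z t + tau))); [|field; auto].
  rewrite S2. field. auto.
Qed.

Lemma height_p_derive s co tau r z t : is_sign s -> regular_at r z t -> EL_r s co r z t = 0 -> EL_z s co r z t = 0 ->
  is_derive (height_p s co tau r z) t (coef_p s co r z t * height_f s co tau r z t).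
Proof.
  intros Hs G E1 E2. pose proof (is_sign_sq s Hs) as S2.
  assert (DS := tan_z_derive r z t G). assert (DP := mom_nor_derive s co r z t G E1 E2).
  assert (DH := prof_H_derive s co r z t Hs G).
  pose proof G as (Gr & Gz & G0 & Gq). assert (Q := prof_speed_pos _ _ _ G).
  assert (DZ : is_derive z t (prof_speed r z t * tan_z r z t)).
  { replace (_ * _) with (Derive z t); [apply (Ck1_Derive 3); auto|]. unfold tan_z. field. lra. }
  assert (DR : is_derive r t (prof_speed r z t * tan_r r z t)).
  { replace (_ * _) with (Derive r t); [apply (Ck1_Derive 3); auto|]. unfold tan_r. field. lra. }
  assert (ET := prof_turn_eq s r z t Hs G).
  unfold height_p. set (p := mom_nor s co r z) in *. set (S := tan_z r z) in *. set (H := prof_H s r z) in *.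
  evar (l : R). assert (K : is_derive (fun x => s * r x * S x * (co - H x) + S x ^ 2 + p x * (z x + tau)) t l).
  { unfold l. auto_derive.
    - repeat split; eexists; eassumption.
    - reflexivity. }
  replace (_ * _) with l; auto. unfold l.
  rewrite (is_derive_unique _ _ _ DS) (is_derive_unique _ _ _ DP) (is_derive_unique _ _ _ DZ)
    (is_derive_unique _ _ _ DR) (is_derive_unique _ _ _ DH).
  unfold height_f, coef_p, coef_f. fold p S H. replace (prof_f s co r z t) with (H t + co) by reflexivity.
  set (q := prof_speed r z t) in *. set (C := tan_r r z t) in *. set (om := prof_turn r z t) in *.
  set (f := H t + co).
  set (k := s * S t * om + (co - H t) * r t * om + S t * f * q - s * q * S t ^ 2 / r t).
  transitivity (k * f * (z t + tau) + s * C * (q * S t + om * r t) * (co - H t) + 2 * S t * C * om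
     + (1 - s * s) * (p t * q * S t)).
  { field. auto. }
  transitivity (k * f * (z t + tau) + (s * s) * C * (S t * om) + s * C * (co - H t) * r t * om
     + s * C * S t * f * q - (s * s) * C * q * S t ^ 2 / r t); [|unfold k; field; auto].
  rewrite S2.
  assert (EO : om * S t * C = q * S t * C * (2 * s * H t - S t / r t)) by (rewrite ET; ring).
  replace (2 * S t * C * om) with (S t * C * om + om * S t * C) by ring. rewrite EO.
  unfold f. field. auto.
Qed.

Lemma continuous_zero_limit (g : R -> R) : continuous g 0 ->
  (forall t, 0 < t <= 1 -> g t = 0) -> g 0 = 0.
Proof.
  intros C H. destruct (Req_dec (g 0) 0) as [|N]; auto. exfalso.
  assert (L : locally 0 (fun t => g t <> 0)) by (apply (C (fun y => y <> 0)); now apply locally_neq0).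
  destruct L as [d Hd]. pose proof (cond_pos d).
  assert (0 < Rmin (d / 2) 1) by (apply Rmin_glb_lt; lra).
  pose proof (Rmin_l (d / 2) 1). pose proof (Rmin_r (d / 2) 1).
  apply (Hd (Rmin (d / 2) 1)).
  - unfold ball; simpl; unfold AbsRing_ball, abs, minus, plus, opp; simpl. apply Rabs_def1; lra.
  - apply H. lra.
Qed.

Lemma on_boundary_circles (Pr : R -> R -> Prop) rho :
  Pr 1 1 -> (0 < rho -> Pr rho (-1)) -> forall x om, In (x, om) (boundary_circles rho) -> Pr x om.
Proof.
  intros H1 H2 x om. unfold boundary_circles. destruct (Rlt_dec 0 rho); simpl;
   intros K; repeat (destruct K as [K|K]; [injection K as <- <-; auto|]); contradiction.
Qed.

Lemma vtranslate_revolution rho X tau e r r1 r2 z z1 z2 :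
  revolution rho X e r r1 r2 z z1 z2 ->
  revolution rho (vtranslate tau X) e r r1 r2 (fun t => z t + tau) z1 z2.
Proof.
  intros [Hrho Hs Hp Hr Hr1 Hz Hz1 He Hpos0 Ho Hreg0]. constructor; auto.
  - intros u v H. destruct (Hs u v H) as (A & B & C).
    unfold vtranslate, add3, scal3, E3, smooth_at, c1, c2, c3 in *; cbn [fst snd] in *.
    split; [|split]; apply Ck2_plus; auto; apply Ck2_const.
  - intros t th Ht. unfold vtranslate. rewrite (Hp t th Ht).
    unfold add3, scal3, E3, c1, c2, c3; cbn [fst snd]. apply triple_eq; ring.
  - intros t Ht. rewrite -[X in is_derive _ _ X]Rplus_0_r. apply: is_derive_plus; auto. apply @is_derive_const.
Qed.

Lemma vtranslate_mean_curv rho X tau sigma e r r1 r2 z z1 z2 t th :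
  revolution rho X e r r1 r2 z z1 z2 -> rho <= t <= 1 ->
  mean_curv sigma (vtranslate tau X) (t * cos th) (t * sin th) = mean_curv sigma X (t * cos th) (t * sin th).
Proof.
  intros HR Ht. pose proof (vtranslate_revolution _ _ tau _ _ _ _ _ _ _ HR) as HR'.
  destruct (rev_mean_curv_aux rho X sigma e r r1 r2 z z1 z2 t th HR Ht) as (k & A & B & C).
  destruct (rev_mean_curv_aux rho _ sigma e r r1 r2 _ z1 z2 t th HR' Ht) as (k' & A' & B' & C').
  rewrite C C'. do 2 f_equal. destruct (Req_dec t 0) as [T|T].
  - rewrite B; auto.
  - apply Rmult_eq_reg_l with t; auto. now rewrite A A'.
Qed.

(** ** The two alternatives *)

Lemma coef_continuous s co r z t : regular_at r z t ->
  continuous (coef_f s r z) t /\ continuous (coef_p s co r z) t.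
Proof.
  intros G. assert (Q := prof_speed_pos _ _ _ G).
  assert (Cq := Ck1_continuous _ _ _ (prof_speed_smooth _ _ _ G)).
  assert (CS := Ck1_continuous _ _ _ (tan_z_smooth _ _ _ G)).
  assert (CH := Ck1_continuous _ _ _ (prof_H_smooth s _ _ _ G)).
  assert (CF := Ck1_continuous _ _ _ (prof_f_smooth s co _ _ _ G)).
  pose proof G as (A & B & R0 & D).
  assert (Cr := Ck1_continuous _ _ _ A).
  assert (CT : continuous (prof_turn r z) t).
  { destruct (Ck1_jets _ _ A) as [A1 A2]. destruct (Ck1_jets _ _ B) as [B1 B2].
    apply Ck1_pred in A1. apply Ck1_pred in B1.
    apply (Ck1_continuous 2). apply Ck1_div; [lra| |].
    - apply Ck1_minus; apply Ck1_mult; auto.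
    - apply Ck1_plus; apply Ck1_pow; auto. }
  assert (Ci : continuous (fun x => / r x) t) by (apply continuous_inv_R; auto).
  assert (CC : forall k : R, continuous (fun _ : R => k) t) by (intros; apply continuous_const).
  split.
  - apply continuous_mult_R; auto. apply continuous_mult_R; auto.
  - apply (continuous_minus (V := R_NormedModule)
      (fun t => s * tan_z r z t * prof_turn r z t + (co - prof_H s r z t) * r t * prof_turn r z t + tan_z r z t * prof_f s co r z t * prof_speed r z t)
      (fun t => s * prof_speed r z t * tan_z r z t ^ 2 / r t)).
    + apply (continuous_plus (V := R_NormedModule)
        (fun t => s * tan_z r z t * prof_turn r z t + (co - prof_H s r z t) * r t * prof_turn r z t)
        (fun t => tan_z r z t * prof_f s co r z t * prof_speed r z t)).
      * apply (continuous_plus (V := R_NormedModule)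
          (fun t => s * tan_z r z t * prof_turn r z t) (fun t => (co - prof_H s r z t) * r t * prof_turn r z t)).
        -- apply continuous_mult_R; auto. apply continuous_mult_R; auto.
        -- apply continuous_mult_R; auto. apply continuous_mult_R; auto.
           apply (continuous_minus (V := R_NormedModule) (fun _ => co) (prof_H s r z)); auto.
      * apply continuous_mult_R; auto. apply continuous_mult_R; auto.
    + apply continuous_mult_R; auto. apply continuous_mult_R; [apply continuous_mult_R; auto|].
      apply (continuous_ext (fun x => tan_z r z x * tan_z r z x)); [intros; as_real; ring|].
      apply continuous_mult_R; auto.
Qed.

Lemma curvature_system a alpha beta co rho sigma X e r z (f p : R -> R) t1 x0 :
  critical_profile a alpha beta co rho sigma X e r z -> rho <= t1 -> 0 < t1 < 1 ->
  x0 = t1 \/ x0 = 1 ->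
  let s := sigma * e in
  (forall t, t1 <= t <= 1 -> continuous f t /\ continuous p t) ->
  (forall t, t1 < t < 1 -> is_derive f t (coef_f s r z t * p t) /\ is_derive p t (coef_p s co r z t * f t)) ->
  f x0 = 0 -> p x0 = 0 -> forall t, t1 <= t <= 1 -> f t = 0 /\ p t = 0.
Proof.
  intros HC Ht1 Ht1' Hx0 s Hc Hd F0 P0.
  apply (linear_system_unique f p (coef_f s r z) (coef_p s co r z) t1 1 x0); auto; [lra|].
  intros t Ht. pose proof HC as [Hs HR HK Hcrit Ha].
  assert (G : regular_at r z t) by (apply (revolution_regular rho X e); auto; lra).
  destruct (Hc t Ht). destruct (coef_continuous s co r z t G). auto.
Qed.

Lemma curvature_vanishes a alpha beta co rho sigma X e r z t1 x0 :
  critical_profile a alpha beta co rho sigma X e r z -> rho <= t1 -> 0 < t1 < 1 ->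
  x0 = t1 \/ x0 = 1 ->
  let s := sigma * e in
  prof_f s co r z x0 = 0 -> mom_nor s co r z x0 = 0 ->
  forall t, t1 <= t <= 1 -> prof_f s co r z t = 0 /\ mom_nor s co r z t = 0.
Proof.
  intros HC Ht1 Ht1' Hx0 s F0 P0. pose proof HC as [Hs HR HK Hcrit Ha].
  assert (Hs' : is_sign s) by (apply is_sign_mult; auto; apply HR).
  assert (G : forall t, t1 <= t <= 1 -> regular_at r z t) by (intros t Ht; apply (revolution_regular rho X e); auto; lra).
  apply (curvature_system a alpha beta co rho sigma X e r z _ _ t1 x0 HC); auto; fold s.
  - intros t Ht. split.
    + exact (Ck1_continuous _ _ _ (prof_f_smooth s co _ _ _ (G t Ht))).
    + exact (Ck1_continuous _ _ _ (mom_nor_smooth s co _ _ _ (G t Ht))).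
  - intros t Ht. destruct (Euler_Lagrange a alpha beta co rho sigma X e r z t HC) as [E1 E2]; [lra|].
    split; [apply prof_f_derive|apply mom_nor_derive]; auto; apply G; lra.
Qed.

(** Uniqueness for the system of [coef_f] and [coef_p], with data on the outer
    circle. *)
Lemma height_relation a alpha beta co rho sigma X e r z tau :
  critical_profile a alpha beta co rho sigma X e r z ->
  let s := sigma * e in
  height_f s co tau r z 1 = 0 -> height_p s co tau r z 1 = 0 ->
  forall t, rho <= t <= 1 -> 0 < t -> height_f s co tau r z t = 0.
Proof.
  intros HC s W0 P0 t Ht T. pose proof HC as [Hs HR HK Hcrit Ha].
  assert (Hrho := rev_rho _ _ _ _ _ _ _ _ _ HR).
  assert (Hs' : is_sign s) by (apply is_sign_mult; auto; apply HR).
  set (t1 := Rmin t ((rho + 1) / 2)).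
  assert (T1 : rho <= t1) by (apply Rmin_glb; lra).
  assert (T2 : 0 < t1) by (apply Rmin_glb_lt; lra).
  assert (T3 : t1 <= t) by apply Rmin_l.
  assert (T4 : t1 <= (rho + 1) / 2) by apply Rmin_r.
  assert (G : forall t, t1 <= t <= 1 -> regular_at r z t) by (intros x Hx; apply (revolution_regular rho X e); auto; lra).
  apply (curvature_system a alpha beta co rho sigma X e r z (height_f s co tau r z) (height_p s co tau r z) t1 1 HC); auto;
    try lra; fold s.
  - clearbody t1. clear t Ht T T3. intros t Ht.
    assert (CS := Ck1_continuous _ _ _ (tan_z_smooth _ _ _ (G t Ht))).
    assert (CC := Ck1_continuous _ _ _ (tan_r_smooth _ _ _ (G t Ht))).
    assert (CH := Ck1_continuous _ _ _ (prof_H_smooth s _ _ _ (G t Ht))).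
    assert (CF := Ck1_continuous _ _ _ (prof_f_smooth s co _ _ _ (G t Ht))).
    assert (CP := Ck1_continuous _ _ _ (mom_nor_smooth s co _ _ _ (G t Ht))).
    assert (Cr := Ck1_continuous _ _ _ (proj1 (G t Ht))).
    assert (Cz := Ck1_continuous _ _ _ (proj1 (proj2 (G t Ht)))).
    assert (CK : forall k : R, continuous (fun _ : R => k) t) by (intros; apply continuous_const).
    assert (Cz' : continuous (fun t => z t + tau) t) by (apply (continuous_plus (V := R_NormedModule) z (fun _ => tau)); auto).
    split.
    + apply (continuous_plus (V := R_NormedModule) (fun t => s * tan_r r z t) (fun t => prof_f s co r z t * (z t + tau)));
       apply continuous_mult_R; auto.
    + apply (continuous_plus (V := R_NormedModule) (fun t => s * r t * tan_z r z t * (co - prof_H s r z t) + tan_z r z t ^ 2)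
        (fun t => mom_nor s co r z t * (z t + tau))); [|apply continuous_mult_R; auto].
      apply (continuous_plus (V := R_NormedModule) (fun t => s * r t * tan_z r z t * (co - prof_H s r z t)) (fun t => tan_z r z t ^ 2)).
      * apply continuous_mult_R; [apply continuous_mult_R; auto; apply continuous_mult_R; auto|].
        apply (continuous_minus (V := R_NormedModule) (fun _ => co) (prof_H s r z)); auto.
      * apply (continuous_ext (fun x => tan_z r z x * tan_z r z x)); [intros; as_real; ring|].
        apply continuous_mult_R; auto.
  - clearbody t1. clear t Ht T T3. intros t Ht.
    destruct (Euler_Lagrange a alpha beta co rho sigma X e r z t HC) as [E1 E2]; [lra|].
    split; [apply height_f_derive|apply height_p_derive]; auto; apply G; lra.
Qed.

Theorem proposition4p2 (a alpha beta co rho sigma : R) (X : R -> R -> R3)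
  (ha : 0 < a) (halpha : 0 < alpha) (hbeta : 0 < beta)
  (hrho : 0 <= rho < 1) (hsigma : orientation sigma)
  (himm : immersion rho X)
  (hsym : axially_symmetric rho X)
  (hcrit : critical rho sigma a co 0 alpha beta X) :
  (part_of_Delaunay rho sigma (- co) X /\
   boundary_radii rho X (sqrt (alpha / beta)))
  \/
  (exists tau : R,
     reduced_membrane rho sigma co (vtranslate tau X) /\
     geodesic_boundary rho sigma (vtranslate tau X)).
Proof.
  destruct (immersion_profile rho X hrho himm hsym) as (e & r & z & HR & HK).
  assert (HC : critical_profile a alpha beta co rho sigma X e r z) by (constructor; auto).
  assert (He := rev_sign _ _ _ _ _ _ _ _ _ HR).
  set (s := sigma * e).
  assert (Hs : is_sign s) by (apply is_sign_mult; auto).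
  assert (S2 := is_sign_sq s Hs).
  assert (G : forall t, rho <= t <= 1 -> 0 < t -> regular_at r z t) by (intros; apply (revolution_regular rho X e); auto).
  destruct (boundary_conditions _ _ _ _ _ _ _ _ _ _ HC 1 1) as (F1 & B1 & A1); [left; auto|].
  fold s in F1, B1, A1.
  assert (Bdry : 0 < rho -> prof_f s co r z rho = 0 /\ mom_z s co r z rho = 0 /\
     -1 * a * mom_r s co r z rho + (beta - alpha / r rho ^ 2) = 0).
  { intros P. apply (boundary_conditions _ _ _ _ _ _ _ _ _ _ HC rho (-1)). right; auto. }
  (* where [f = 0] the momentum is normal to the profile *)
  assert (Red : forall t, prof_f s co r z t = 0 ->
     mom_r s co r z t = mom_nor s co r z t * tan_z r z t /\ mom_z s co r z t = - mom_nor s co r z t * tan_r r z t).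
  { intros t E. unfold mom_r, mom_z, mom_tan. rewrite E. split; ring. }
  destruct (mean_curv_profile rho X sigma e r z HR HK) as (Hb & Cb & Eb & Hb1). fold s in Hb1.
  destruct (Req_dec (mom_nor s co r z 1) 0) as [P1|P1].
  - left.
    assert (V : forall t, rho <= t <= 1 -> 0 < t -> prof_f s co r z t = 0 /\ mom_nor s co r z t = 0).
    { intros t Ht T. set (t1 := Rmin t ((rho + 1) / 2)).
      assert (T1 : rho <= t1) by (apply Rmin_glb; lra).
      assert (T2 : 0 < t1) by (apply Rmin_glb_lt; lra).
      assert (T3 : t1 <= t) by apply Rmin_l.
      assert (T4 : t1 <= (rho + 1) / 2) by apply Rmin_r.
      apply (curvature_vanishes a alpha beta co rho sigma X e r z t1 1); auto; lra. }
    split.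
    + split; auto. intros u v Huv. destruct (Sigma_polar_inv rho u v Huv) as (t & th & Ht & T0 & -> & ->).
      rewrite Eb; auto.
      assert (K : forall x, rho <= x <= 1 -> 0 < x -> Hb x = - co).
      { intros x Hx Px. rewrite Hb1; auto. destruct (V x Hx Px) as [E _].
        change (mean_curv_of _ _ _ _ _ _) with (prof_H s r z x). unfold prof_f in E. lra. }
      destruct (Rle_lt_or_eq_dec 0 t T0) as [T|T]; [apply K; auto|].
      subst t. assert (R0 : rho = 0) by lra.
      assert (Z : Hb 0 + co = 0); [|lra].
      apply (continuous_zero_limit (fun x => Hb x + co)).
      * apply (continuous_plus (V := R_NormedModule) Hb (fun _ => co)); auto. apply continuous_const.
      * intros x Hx. rewrite K; lra.
    + assert (K : forall t, rho <= t <= 1 -> 0 < t -> beta - alpha / r t ^ 2 = 0 ->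
        forall om th, axis_dist (on_circle t om X th) = sqrt (alpha / beta)).
      { intros t Ht T E om th. rewrite (rev_axis_dist _ _ _ _ _ _ _ _ _ _ _ _ HR Ht T).
        pose proof (rev_pos _ _ _ _ _ _ _ _ _ HR t Ht T) as P.
        assert (r t <> 0) by (intros Z; rewrite Z in P; lra).
        replace (alpha / beta) with ((e * r t) ^ 2); [rewrite sqrt_pow2; lra|].
        transitivity (e * e * r t ^ 2); [ring|]. rewrite (is_sign_sq e He).
        replace beta with (alpha / r t ^ 2) by lra. field. split; auto; lra. }
      intros x om. apply (on_boundary_circles (fun x om => forall t, axis_dist (on_circle x om X t) = sqrt (alpha / beta))).
      * apply K; try lra. destruct (Red 1 F1) as [E _]. rewrite E P1 in A1. lra.
      * intros P. apply K; try lra. destruct (Bdry P) as (Fr & _ & Ar). destruct (Red rho Fr) as [E _].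
        destruct (V rho) as [_ Pr]; try lra. rewrite E Pr in Ar. lra.
  - (* [tau] is the constant for which the second unknown vanishes on the outer circle *)
    right. set (tau := - z 1 - (s * r 1 * tan_z r z 1 * (co - prof_H s r z 1) + tan_z r z 1 ^ 2) / mom_nor s co r z 1).
    exists tau.
    assert (C1 : tan_r r z 1 = 0).
    { destruct (Red 1 F1) as [_ E]. rewrite E in B1. apply Rmult_integral in B1. destruct B1; auto. lra. }
    assert (W : forall t, rho <= t <= 1 -> 0 < t -> height_f s co tau r z t = 0).
    { apply (height_relation a alpha beta co rho sigma X e r z tau HC); fold s.
      - unfold height_f. rewrite C1 F1. ring.
      - unfold height_p, tau. field. auto. }
    assert (HR' := vtranslate_revolution rho X tau _ _ _ _ _ _ _ HR).
    split.
    + intros u v Huv. destruct (Sigma_polar_inv rho u v Huv) as (t & th & Ht & T0 & -> & ->).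
      rewrite (vtranslate_mean_curv rho X tau sigma _ _ _ _ _ _ _ _ _ HR Ht) Eb; auto.
      rewrite (rev_nu _ _ sigma _ _ _ _ _ _ _ HR' t th Ht).
      rewrite (rev_polar _ _ _ _ _ _ _ _ _ HR' t th Ht).
      unfold dot3, E3, c1, c2, c3; cbn [fst snd]. fold s.
      change (Derive r t / sqrt (Derive r t ^ 2 + Derive z t ^ 2)) with (tan_r r z t).
      assert (K : forall x, rho <= x <= 1 -> 0 < x -> (Hb x + co) * (z x + tau) + s * tan_r r z x = 0).
      { intros x Hx Px. rewrite Hb1; auto. rewrite -(W x Hx Px). unfold height_f, prof_f, prof_H. ring. }
      assert (K0 : (Hb t + co) * (z t + tau) + s * tan_r r z t = 0); [|lra].
      destruct (Rle_lt_or_eq_dec 0 t T0) as [T|T]; [apply K; auto|].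
      subst t. assert (R0 : rho = 0) by lra.
      apply (continuous_zero_limit (fun x => (Hb x + co) * (z x + tau) + s * tan_r r z x)).
      * destruct (HK 0 Ht) as [Kr Kz]. destruct (Ck1_jets _ _ Kr) as [Kr1 _]. destruct (Ck1_jets _ _ Kz) as [Kz1 _].
        assert (CC : forall k : R, continuous (fun _ : R => k) 0) by (intros; apply continuous_const).
        apply (continuous_plus (V := R_NormedModule) (fun x => (Hb x + co) * (z x + tau)) (fun x => s * tan_r r z x));
          apply continuous_mult_R; auto.
        -- apply (continuous_plus (V := R_NormedModule) Hb (fun _ => co)); auto.
        -- apply (continuous_plus (V := R_NormedModule) z (fun _ => tau)); auto. exact (Ck1_continuous _ _ _ Kz).
        -- pose proof (rev_reg _ _ _ _ _ _ _ _ _ HR 0 Ht) as Q.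
           apply (Ck1_continuous 3). apply Ck1_div; auto.
           ++ apply Rgt_not_eq. now apply sqrt_lt_R0.
           ++ apply Ck1_sqrt; auto. apply Ck1_plus; apply Ck1_pow; auto.
      * intros x Hx. apply K; lra.
    + assert (K : forall t om, rho <= t <= 1 -> 0 < t -> is_sign om -> tan_r r z t = 0 ->
        forall th, geod_curv sigma (vtranslate tau X) t om th = 0).
      { intros t om Ht T Ho E th. rewrite (rev_geod_curv _ _ sigma _ _ _ _ _ _ _ _ _ _ HR'); auto.
        change (Derive r t / sqrt (Derive r t ^ 2 + Derive z t ^ 2)) with (tan_r r z t). rewrite E.
        unfold Rdiv. ring. }
      intros x om. apply (on_boundary_circles (fun x om => forall t, geod_curv sigma (vtranslate tau X) x om t = 0)).
      * apply K; auto; try lra. left; auto.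
      * intros P. apply K; auto; try lra. right; auto.
        destruct (Bdry P) as (Fr & Br & _). destruct (Red rho Fr) as [_ E]. rewrite E in Br.
        apply Rmult_integral in Br. destruct Br as [Br|Br]; auto. exfalso. apply P1.
        apply (curvature_vanishes a alpha beta co rho sigma X e r z rho rho HC); auto; try lra.
        fold s. lra.
Qed.
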